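(* Let $\ell\ge 1$ be an integer and suppose that $\frac{\omega}{\ell}\le h<\frac{\omega}{\ell-\frac12}$. Let $\Phi=\{\varphi_j: 1\le j\le 2\ell\}$ be a subset of $B_\omega$. Then $E_{\Phi,t_o}$ is a frame for $B_\omega$ if and only if there exist positive constants $\delta,\gamma,\sigma,\eta$ such that (1) $\delta\le\sum_{j=1}^{2\ell}|\widehat{\varphi_j}|^2\le\gamma$ a.e. in $(-\omega,\omega)$; (2) $[J_{\Phi,t_o}]_{2\ell-1}\ge\sigma$ a.e. in $I_-\cup I_+$; (3) $|\det J_{\Phi,t_o}|\ge\eta$ a.e. in $I$. If $h=\frac{\omega}{\ell}$, the intervals $I_-$ and $I_+$ are empty; in this case $E_{\Phi,t_o}$ is a Riesz basis for $B_\omega$ if and only if conditions (1) and (3) hold (for some positive constants $\delta,\gamma,\eta$).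
   Context: Conventions: $\hat f(\xi)=\frac{1}{\sqrt{2\pi}}\int f(t)e^{-it\xi}\,dt$ (extended to $L^2(\mathbb R)$); $\tau_a f(x)=f(x+a)$. Fix $\omega>0$ and $B_\omega=\{f\in L^2(\mathbb R):\operatorname{supp}\hat f\subset[-\omega,\omega]\}$. $t_o>0$ is a parameter and $h=2\pi/t_o$. For a finite family $\Phi=\{\varphi_1,\dots,\varphi_N\}\subset B_\omega$, $E_{\Phi,t_o}=\{\tau_{nt_o}\varphi_j: n\in\mathbb Z,\ 1\le j\le N\}$. $E_{\Phi,t_o}$ is a frame for $B_\omega$ if there are $0<A\le B$ with $A\|f\|^2\le\sum_{j=1}^N\sum_{n\in\mathbb Z}|\langle f,\tau_{nt_o}\varphi_j\rangle|^2\le B\|f\|^2$ for all $f\in B_\omega$; it is a Riesz basis if moreover the operator $c\mapsto\sum_{j}\sum_n c_j(n)\tau_{nt_o}\varphi_j$ from $\ell^2(\mathbb Z;\mathbb C^N)$ to $B_\omega$ is injective. Intervals (for $\frac{\omega}{\ell}\le h<\frac{\omega}{\ell-1/2}$): $I_-=(0,-\omega+\ell h)$, $I=(-\omega+\ell h,\ \omega-(\ell-1)h)$, $I_+=(\omega-(\ell-1)h,\ h)$. Pre-Gramian: for $x\in[0,h]$, $J_{\Phi,t_o}(x)$ is the $2\ell\times 2\ell$ matrix with entries $\sqrt h\,\widehat{\varphi_i}(x+jh)$, rows indexed by $j=-\ell,\dots,\ell-1$ (in increasing order) and columns by $i=1,\dots,2\ell$ (all other rows $j\in\mathbb Z$ vanish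 a.e. on $[0,h]$; the row $j=-\ell$ vanishes on $I_-$ and the row $j=\ell-1$ vanishes on $I_+$). $[J]_n$ denotes the sum of the squares of the absolute values of the minors of order $n$ of the matrix $J$. *)

(* Defs.v *)
From mathcomp Require Import all_boot all_order all_algebra.
From mathcomp Require Import complex.
From mathcomp Require Import all_classical all_reals all_analysis.

Set Implicit Arguments.
Unset Strict Implicit.
Unset Printing Implicit Defensive.

Import Order.TTheory GRing.Theory Num.Theory.
Import numFieldNormedType.Exports.

Local Open Scope classical_set_scope.
Local Open Scope ring_scope.
Local Open Scope complex_scope.

Section L2.
Context {R : realType}.
Implicit Types f g : R -> R[i].

Local Notation mu := (@lebesgue_measure R).

Definition cabs (z : R[i]) : R := ComplexField.Normc.normc z.

Definition expi (t : R) : R[i] := cos t +i* sin t.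

Definition cintegral (D : set R) f : R[i] :=
  (\int[mu]_(x in D) complex.Re (f x))%R +i*
  (\int[mu]_(x in D) complex.Im (f x))%R.

Definition L2norm f : \bar R := 'N[mu]_2%:E[EFin \o (cabs \o f)].

(* Elements of L^2 are handled through (Borel) representatives. *)
Definition L2 f : Prop :=
  [/\ measurable_fun setT (fun x => complex.Re (f x)),
      measurable_fun setT (fun x => complex.Im (f x)) &
      (L2norm f < +oo)%E].

Definition inner f g : R[i] := cintegral setT (fun x => f x * (g x)^*).

Definition is_L2lim (u : nat -> R -> R[i]) g : Prop :=
  L2 g /\ (fun n => L2norm (fun x => u n x - g x)) @ \oo --> (0 : \bar R).

(* A representative of the limit in L^2-norm, which is only determined up to a
   null set (0 if there is no limit). *)
Definition L2lim (u : nat -> R -> R[i]) : R -> R[i] :=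
  xget (fun=> 0) [set g | is_L2lim u g].

Definition fourier_on (D : set R) f (xi : R) : R[i] :=
  ((Num.sqrt (2 * pi))^-1)%:C * cintegral D (fun t => f t * expi (- (t * xi))).

(* The Fourier transform on L^2, as the L^2-limit of the integrals over [-n, n]
   (on which an L^2 function is integrable). *)
Definition fourier f : R -> R[i] :=
  L2lim (fun n => fourier_on `[- n%:R, n%:R] f).

(* The support of a function defined up to null sets: the complement of the
   largest open set on which it vanishes a.e. *)
Definition ess_supp f : set R :=
  ~` \bigcup_(U in [set U | open U /\ {ae mu, forall x, U x -> f x = 0}]) U.

Definition bandlimited (w : R) : set (R -> R[i]) :=
  [set f | L2 f /\ ess_supp (fourier f) `<=` `[- w, w]].

Definition translate (a : R) f : R -> R[i] := fun x => f (x + a).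

End L2.

Section Frames.
Context {R : realType}.
Variables (w t0 : R) (N : nat) (phi : 'I_N -> R -> R[i]).

Local Notation mu := (@lebesgue_measure R).

Definition frame_elt (j : 'I_N) (n : int) : R -> R[i] :=
  translate (n%:~R * t0) (phi j).

Definition is_frame : Prop :=
  exists A B : R, [/\ 0 < A, A <= B &
    forall f, bandlimited w f ->
      let S := (\sum_(j < N) \esum_(n in [set: int])
                  ((cabs (inner f (frame_elt j n)) ^+ 2)%:E))%E in
      (A%:E * L2norm f ^+ 2 <= S /\ S <= B%:E * L2norm f ^+ 2)%E].

Definition ell2 (c : 'I_N -> int -> R[i]) : Prop :=
  (\sum_(j < N) \esum_(n in [set: int]) ((cabs (c j n) ^+ 2)%:E) < +oo)%E.

(* The series over n in Z is the L^2-limit of its sums over -M <= n <= M; it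
   converges for every c in ell2 as soon as the upper frame bound holds. *)
Definition synthesis (c : 'I_N -> int -> R[i]) : R -> R[i] :=
  L2lim (fun M x => \sum_(j < N) \sum_(0 <= k < (2 * M).+1)
    c j (k%:Z - M%:Z) * frame_elt j (k%:Z - M%:Z) x).

Definition is_riesz_basis : Prop :=
  is_frame /\
  forall c c', ell2 c -> ell2 c' ->
    {ae mu, forall x, synthesis c x = synthesis c' x} -> c = c'.

End Frames.

(* Row k : 'I_(2 * l) stands for the index j = k - l of the translate by j h. *)
Definition pre_gramian {R : realType} (h : R) (l : nat)
    (phi : 'I_(2 * l) -> R -> R[i]) (x : R) : 'M[R[i]]_(2 * l) :=
  \matrix_(k, i)
    ((Num.sqrt h)%:C * fourier (phi i) (x + (k%:R - l%:R) * h)).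

Definition increasing_ffun (n m : nat) (f : {ffun 'I_n -> 'I_m}) : bool :=
  [forall i : 'I_n, forall j : 'I_n, (i < j)%N ==> (f i < f j)%N].

(* Each minor of order n is counted once: the chosen rows and columns are
   enumerated by strictly increasing maps. *)
Definition sum_sq_minors {R : realType} (n p q : nat) (J : 'M[R[i]]_(p, q)) : R :=
  \sum_(f : {ffun 'I_n -> 'I_p} | increasing_ffun f)
    \sum_(g : {ffun 'I_n -> 'I_q} | increasing_ffun g)
      cabs (\det (mxsub f g J)) ^+ 2.

(* Main.v *)
(* A band-limited f is determined by the samples of its Fourier transform F over one period:
   the vector V(x) = (F(x + j h)), -l <= j < l, for x in [0, h). Parseval's identity on [0, h)
   turns the frame sum of f into the integral of |V(x)^* J(x)|^2, while |f|^2 is the integral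
   of |V(x)|^2. The vector V is arbitrary, except that its first entry vanishes on I_- and its
   last one on I_+. Hence the frame inequalities hold if and only if, for a.e. x, J(x) is
   bounded, and bounded below on the admissible vectors. On I this is a lower bound on |det J|,
   by Cramer's rule; on I_- and I_+ it is a lower bound on the Gram determinant of J without
   its zero row, which is controlled by the sum of the squares of the (2l-1)-minors.
   When h = w / l, the rows of the inverse of J, modulated by e^(-i n t_o x), are the samples
   of functions biorthogonal to the system, so that the coefficients of a series can be
   recovered from its sum. *)
Require Import Defs.
From HB Require Import structures.
From mathcomp Require Import all_boot all_order all_algebra.
From mathcomp Require Import complex.
From mathcomp Require Import all_classical all_reals all_analysis.
From mathcomp Require Import perm measurable_realfun.
From mathcomp Require Import zify ring lra.

Import Order.TTheory GRing.Theory Num.Theory.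
Import numFieldNormedType.Exports.

Local Open Scope classical_set_scope.
Local Open Scope complex_scope.
Local Open Scope ring_scope.

Arguments cabs : simpl never.
Arguments expi : simpl never.
Arguments inner : simpl never.
Arguments cintegral : simpl never.
Arguments L2norm : simpl never.

(** The transform is a limit chosen only up to a null set, so its rules (linearity, translation,
    inversion) all come from one adjoint identity against square-integrable functions of bounded
    support, which determines it almost everywhere. Plancherel's theorem comes from Parseval's
    identity on intervals, and the latter from uniqueness of Fourier coefficients, obtained by
    trigonometric approximation of indicators of intervals and Lebesgue differentiation. The
    delicate direction goes from the frame inequalities to the pointwise bounds. Localizing the
    integrals gives an inequality for almost every x, but with a null set that depends on the vector
    field, so it cannot be minimized over all vectors at a fixed x. The determinant bound is reached
    by an induction on rows that tests only finitely many measurable fields, built from rows of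
    adjugates of Gram matrices. In the converse direction Cramer's rule gives constants uniform over
    all the matrices concerned, so the quantifier over vectors can stand inside the
    almost-everywhere statement. *)

Section ComplexModulus.
Context {R : realType}.
Implicit Types (z y : R[i]) (t s : R).

Lemma cabs2E z : cabs z ^+ 2 = complex.Re z ^+ 2 + complex.Im z ^+ 2.
Proof.
case: z => a b; rewrite /cabs /ComplexField.Normc.normc sqr_sqrtr//.
by rewrite addr_ge0// sqr_ge0.
Qed.

Lemma cabs_ge0 z : 0 <= cabs z.
Proof. by case: z => a b; exact: sqrtr_ge0. Qed.

Lemma cabsM z y : cabs (z * y) = cabs z * cabs y.
Proof. exact: ComplexField.Normc.normcM. Qed.

Lemma cabs0 : cabs (0 : R[i]) = 0.
Proof. exact: ComplexField.Normc.normc0. Qed.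

Lemma cabs1 : cabs (1 : R[i]) = 1.
Proof. exact: ComplexField.Normc.normc1. Qed.

Lemma cabs_eq0 z : (cabs z == 0) = (z == 0).
Proof.
apply/eqP/eqP => [/ComplexField.Normc.eq0_normc//|->]; exact: cabs0.
Qed.

Lemma cabsD z y : cabs (z + y) <= cabs z + cabs y.
Proof. exact: le_normcD. Qed.

Lemma cabsN z : cabs (- z) = cabs z.
Proof. exact: normcN. Qed.

Lemma cabsJ z : cabs (z^*) = cabs z.
Proof.
apply/eqP; rewrite -(@eqrXn2 _ 2)// ?cabs_ge0//; apply/eqP.
by rewrite !cabs2E; case: z => a b /=; rewrite sqrrN.
Qed.

Lemma cabs_real t : cabs t%:C = `|t|.
Proof.
apply/eqP; rewrite -(@eqrXn2 _ 2)// ?cabs_ge0//; apply/eqP.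
by rewrite cabs2E/= expr0n/= addr0 real_normK// num_real.
Qed.

Lemma mulJ_cabs2 z : z * z^* = (cabs z ^+ 2)%:C.
Proof.
rewrite cabs2E; case: z => a b; apply/eqP; rewrite eq_complex/=.
by apply/andP; split; apply/eqP; ring.
Qed.

Lemma cabs_sum (I : Type) (r : seq I) (P : pred I) (F : I -> R[i]) :
  cabs (\sum_(i <- r | P i) F i) <= \sum_(i <- r | P i) cabs (F i).
Proof.
elim/big_rec2 : _ => [|i x y _ yx]; first by rewrite cabs0.
by rewrite (le_trans (cabsD _ _))// lerD2l.
Qed.

Lemma cabs_prod (I : Type) (r : seq I) (P : pred I) (F : I -> R[i]) :
  cabs (\prod_(i <- r | P i) F i) = \prod_(i <- r | P i) cabs (F i).
Proof.
by elim/big_rec2 : _ => [|i x y _ <-]; [rewrite cabs1|rewrite cabsM].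
Qed.

Lemma normRe_le_cabs z : `|complex.Re z| <= cabs z.
Proof.
rewrite -(@ler_pXn2r _ 2)// ?nnegrE ?cabs_ge0// cabs2E real_normK ?num_real//.
by rewrite lerDl sqr_ge0.
Qed.

Lemma normIm_le_cabs z : `|complex.Im z| <= cabs z.
Proof.
rewrite -(@ler_pXn2r _ 2)// ?nnegrE ?cabs_ge0// cabs2E real_normK ?num_real//.
by rewrite lerDr sqr_ge0.
Qed.

Lemma ReM z y :
  complex.Re (z * y) = complex.Re z * complex.Re y - complex.Im z * complex.Im y.
Proof. by case: z y => [a b] [c d]. Qed.

Lemma ImM z y :
  complex.Im (z * y) = complex.Re z * complex.Im y + complex.Im z * complex.Re y.
Proof. by case: z y => [a b] [c d]. Qed.

Lemma ReD z y : complex.Re (z + y) = complex.Re z + complex.Re y.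
Proof. by case: z y => [a b] [c d]. Qed.

Lemma ImD z y : complex.Im (z + y) = complex.Im z + complex.Im y.
Proof. by case: z y => [a b] [c d]. Qed.

Lemma cabs2D_le z y : cabs (z + y) ^+ 2 <= 2 * cabs z ^+ 2 + 2 * cabs y ^+ 2.
Proof.
rewrite !cabs2E; case: z y => [a b] [c d] /=.
have := sqr_ge0 (a - c); have := sqr_ge0 (b - d); nra.
Qed.

Lemma expiD s t : expi (s + t) = expi s * expi t :> R[i].
Proof.
rewrite /expi cosD sinD; apply/eqP; rewrite eq_complex/=.
by apply/andP; split; apply/eqP; ring.
Qed.

Lemma expi0 : expi 0 = 1 :> R[i].
Proof. by rewrite /expi cos0 sin0. Qed.

Lemma expiJ t : (expi t)^* = expi (- t) :> R[i].
Proof. by rewrite /expi cosN sinN. Qed.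

Lemma cabs_expi t : cabs (expi t) = 1 :> R.
Proof.
apply/eqP; rewrite -(@eqrXn2 _ 2)// ?cabs_ge0//; apply/eqP.
by rewrite cabs2E/= cos2Dsin2 expr1n.
Qed.

Lemma expi_periodic (t : R) (n : int) : expi (t + 2 * pi * n%:~R) = expi t :> R[i].
Proof.
have H m u : expi (u + 2 * pi * m%:R) = expi u :> R[i].
  elim: m u => [|m ih] u; first by rewrite mulr0 addr0.
  rewrite -(@natr1 _ m) mulrDr mulr1 addrA expiD ih -expiD.
  by rewrite /expi mulr_natl cosD2pi sinD2pi.
case: n => n; first by rewrite -pmulrn H.
by rewrite NegzE mulrNz -pmulrn -[LHS](H n.+1) mulrN addrNK.
Qed.

End ComplexModulus.

(** * Integrals of complex functions *)

Set Implicit Arguments.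
Unset Strict Implicit.

Section ComplexIntegral.
Context {R : realType}.
Local Notation mu := (@lebesgue_measure R).
Implicit Types (f g : R -> R[i]) (c : R[i]).

Lemma aeS (P Q : R -> Prop) : (forall x, P x -> Q x) ->
  {ae mu, forall x, P x} -> {ae mu, forall x, Q x}.
Proof. by move=> PQ; apply: (@filterS _ _ (ae_filter_ringOfSetsType mu)). Qed.

Lemma aeS2 (P Q S : R -> Prop) : (forall x, P x -> Q x -> S x) ->
  {ae mu, forall x, P x} -> {ae mu, forall x, Q x} -> {ae mu, forall x, S x}.
Proof. by move=> PQ; apply: (@filterS2 _ _ (ae_filter_ringOfSetsType mu)). Qed.

Definition cmeas f := measurable_fun setT (fun x => complex.Re (f x)) /\
  measurable_fun setT (fun x => complex.Im (f x)).

Lemma cmeasD f g : cmeas f -> cmeas g -> cmeas (fun x => f x + g x).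
Proof.
move=> [f1 f2] [g1 g2]; split.
  by under eq_fun do rewrite ReD; exact: measurable_funD.
by under eq_fun do rewrite ImD; exact: measurable_funD.
Qed.

Lemma cmeasM f g : cmeas f -> cmeas g -> cmeas (fun x => f x * g x).
Proof.
move=> [f1 f2] [g1 g2]; split.
  by under eq_fun do rewrite ReM; apply: measurable_funB; exact: measurable_funM.
by under eq_fun do rewrite ImM; apply: measurable_funD; exact: measurable_funM.
Qed.

Lemma cmeas_cst c : cmeas (fun=> c).
Proof. by split; exact: measurable_cst. Qed.

Lemma cmeasJ f : cmeas f -> cmeas (fun x => (f x)^*).
Proof.
move=> [f1 f2]; split.
  by apply: (eq_measurable_fun (fun x => complex.Re (f x))) => // x _; case: (f x).
apply: (eq_measurable_fun (fun x => - complex.Im (f x))) => [x _|].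
  by case: (f x).
exact: measurableT_comp.
Qed.

Lemma cmeasN f : cmeas f -> cmeas (fun x => - f x).
Proof.
move=> mf; under eq_fun do rewrite -mulN1r.
by apply: cmeasM => //; exact: cmeas_cst.
Qed.

Lemma cmeasB f g : cmeas f -> cmeas g -> cmeas (fun x => f x - g x).
Proof. by move=> mf mg; apply: cmeasD => //; exact: cmeasN. Qed.

Lemma cmeas_real (r : R -> R) : measurable_fun setT r -> cmeas (fun x => (r x)%:C).
Proof. by move=> mr; split => //=; exact: measurable_cst. Qed.

Lemma cmeas_sum I (s : seq I) (P : pred I) (F : I -> R -> R[i]) :
  (forall i, P i -> cmeas (F i)) -> cmeas (fun x => \sum_(i <- s | P i) F i x).
Proof.
move=> mF; elim: s => [|i s ih].
  by under eq_fun do rewrite big_nil; exact: cmeas_cst.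
under eq_fun do rewrite big_cons; case Pi: (P i) => //.
by apply: cmeasD => //; exact: mF.
Qed.

Lemma cmeas_prod I (s : seq I) (P : pred I) (F : I -> R -> R[i]) :
  (forall i, P i -> cmeas (F i)) -> cmeas (fun x => \prod_(i <- s | P i) F i x).
Proof.
move=> mF; elim: s => [|i s ih].
  by under eq_fun do rewrite big_nil; exact: cmeas_cst.
under eq_fun do rewrite big_cons; case Pi: (P i) => //.
by apply: cmeasM => //; exact: mF.
Qed.

Lemma cmeas_comp f (u : R -> R) : measurable_fun setT u -> cmeas f ->
  cmeas (fun x => f (u x)).
Proof.
move=> mu' [f1 f2]; split.
  exact: (measurableT_comp f1).
exact: (measurableT_comp f2).
Qed.

Lemma cmeas_expi : cmeas (@expi R).
Proof.
split; first exact: (continuous_measurable_fun (@continuous_cos R)).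
exact: (continuous_measurable_fun (@continuous_sin R)).
Qed.

Lemma measurable_cabs2 f : cmeas f -> measurable_fun setT (fun x => cabs (f x) ^+ 2).
Proof.
move=> [f1 f2]; under eq_fun do rewrite cabs2E.
by apply: measurable_funD; exact: measurable_funX.
Qed.

Lemma measurable_cabs f : cmeas f -> measurable_fun setT (fun x => cabs (f x)).
Proof.
move=> mf; apply: (eq_measurable_fun (fun x => Num.sqrt (cabs (f x) ^+ 2))) => [x _|].
  by rewrite sqrtr_sqr ger0_norm// cabs_ge0.
apply: measurableT_comp; last exact: measurable_cabs2.
apply: continuous_measurable_fun; exact: sqrt_continuous.
Qed.

(** Turns every integral over D into one over the whole line, so that one set of rules for [cint] is
    enough. *)
Definition res (D : set R) f : R -> R[i] := fun x => (\1_D x)%:C * f x.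

Lemma res_in (D : set R) f x : D x -> res D f x = f x.
Proof. by move=> Dx; rewrite /res indicE mem_set// mul1r. Qed.

Lemma res_out (D : set R) f x : ~ D x -> res D f x = 0.
Proof. by move=> Dx; rewrite /res indicE memNset// mul0r. Qed.

Lemma cmeas_res (D : set R) f : measurable D -> cmeas f -> cmeas (res D f).
Proof. by move=> mD mf; apply: cmeasM => //; exact/cmeas_real/measurable_indic. Qed.

Definition cigr f := mu.-integrable setT (EFin \o (fun x => complex.Re (f x))) /\
  mu.-integrable setT (EFin \o (fun x => complex.Im (f x))).

Notation cint f := (cintegral setT f).

Lemma cigr_meas f : cigr f -> cmeas f.
Proof.
by move=> [/measurable_int/measurable_EFinP f1 /measurable_int/measurable_EFinP f2].
Qed.

Lemma cigr_dom f (g : R -> R) : cmeas f -> (forall x, cabs (f x) <= g x) ->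
  mu.-integrable setT (EFin \o g) -> cigr f.
Proof.
move=> [f1 f2] fg ig.
have H (h : R -> R) : measurable_fun setT h -> (forall x, `|h x| <= cabs (f x)) ->
    mu.-integrable setT (EFin \o h).
  move=> mh hf; apply: le_integrable ig => //; first exact/measurable_EFinP.
  move=> x _ /=; rewrite lee_fin (le_trans (hf x))// (le_trans (fg x))//.
  exact: ler_norm.
split; apply: H => // x; [exact: normRe_le_cabs|exact: normIm_le_cabs].
Qed.

Lemma cigr_cabs f : cigr f -> mu.-integrable setT (EFin \o (fun x => cabs (f x))).
Proof.
move=> fi; have mf := cigr_meas fi; case: fi => f1 f2.
have := integrableD measurableT (integrable_norm f1) (integrable_norm f2).
apply: le_integrable => //; first by apply/measurable_EFinP; exact: measurable_cabs.
move=> x _ /=; rewrite lee_fin ger0_norm ?cabs_ge0// ger0_norm ?addr_ge0//.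
rewrite -(@ler_pXn2r _ 2)// ?nnegrE ?cabs_ge0 ?addr_ge0// cabs2E sqrrD.
by rewrite !real_normK ?num_real// lerD2r lerDl mulrn_wge0// mulr_ge0.
Qed.

Lemma cigrD f g : cigr f -> cigr g -> cigr (fun x => f x + g x).
Proof.
move=> [f1 f2] [g1 g2]; split.
  rewrite (_ : _ \o _ = (EFin \o (fun x => complex.Re (f x))) \+
    (EFin \o (fun x => complex.Re (g x)))); first exact: integrableD.
  by apply/funext => x /=; rewrite ReD.
rewrite (_ : _ \o _ = (EFin \o (fun x => complex.Im (f x))) \+
  (EFin \o (fun x => complex.Im (g x)))); first exact: integrableD.
by apply/funext => x /=; rewrite ImD.
Qed.

Lemma cintD f g : cigr f -> cigr g -> cint (fun x => f x + g x) = cint f + cint g.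
Proof.
move=> [f1 f2] [g1 g2]; apply/eqP; rewrite eq_complex/=; apply/andP; split; apply/eqP.
  by rewrite -RintegralD//; apply: eq_Rintegral => x _; rewrite ReD.
by rewrite -RintegralD//; apply: eq_Rintegral => x _; rewrite ImD.
Qed.

Lemma cigrZ c f : cigr f -> cigr (fun x => c * f x).
Proof.
move=> fi; apply: (@cigr_dom _ (fun x => cabs c * cabs (f x))).
- by apply: cmeasM; [exact: cmeas_cst|exact: cigr_meas].
- by move=> x; rewrite cabsM.
- by have := integrableZl measurableT (cabs c) (cigr_cabs fi).
Qed.

Lemma cintZ c f : cigr f -> cint (fun x => c * f x) = c * cint f.
Proof.
move=> [f1 f2]; apply/eqP; rewrite eq_complex/= ReM ImM /=; apply/andP; split; apply/eqP.
  rewrite -!RintegralZl// -RintegralB//; last 2 first.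
  - by have := integrableZl measurableT (complex.Re c) f1.
  - by have := integrableZl measurableT (complex.Im c) f2.
  by apply: eq_Rintegral => x _; rewrite ReM.
rewrite -!RintegralZl// -RintegralD//; last 2 first.
- by have := integrableZl measurableT (complex.Re c) f2.
- by have := integrableZl measurableT (complex.Im c) f1.
by apply: eq_Rintegral => x _; rewrite ImM.
Qed.

Lemma cigr0 : cigr (fun=> 0).
Proof. by split; exact: integrable0. Qed.

Lemma cint0 : cint (fun=> 0 : R[i]) = 0.
Proof. by rewrite /cintegral/= !Rintegral_cst// !mul0r. Qed.

Lemma cigr_sum I (s : seq I) (F : I -> R -> R[i]) :
  (forall i, cigr (F i)) -> cigr (fun x => \sum_(i <- s) F i x).
Proof.
move=> iF; elim: s => [|i s ih].
  by under eq_fun do rewrite big_nil; exact: cigr0.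
by under eq_fun do rewrite big_cons; exact: cigrD.
Qed.

Lemma cint_sum I (s : seq I) (F : I -> R -> R[i]) :
  (forall i, cigr (F i)) ->
  cint (fun x => \sum_(i <- s) F i x) = \sum_(i <- s) cint (F i).
Proof.
move=> iF; elim: s => [|i s ih].
  by under eq_fun do rewrite big_nil; rewrite big_nil cint0.
under eq_fun do rewrite big_cons; rewrite big_cons cintD//; last exact: cigr_sum.
by rewrite ih.
Qed.

Lemma cintJ f : cigr f -> cint (fun x => (f x)^*) = (cint f)^*.
Proof.
move=> [f1 f2]; apply/eqP; rewrite eq_complex/=; apply/andP; split; apply/eqP.
  by apply: eq_Rintegral => x _; case: (f x).
rewrite -mulN1r -RintegralZl//; apply: eq_Rintegral => x _.
by case: (f x) => a b /=; rewrite mulN1r.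
Qed.

Lemma cint_res (D : set R) f : cintegral D f = cint (res D f).
Proof.
rewrite /cintegral !(Rintegral_mkcond mu D); congr (_ +i* _); apply: eq_Rintegral => x _.
  by rewrite patchE /res indicE; case: ifP => _; rewrite ?mul1r ?mul0r.
by rewrite patchE /res indicE; case: ifP => _; rewrite ?mul1r ?mul0r.
Qed.

Lemma ae_eq_cint f g : cigr f -> cigr g -> {ae mu, forall x, f x = g x} -> cint f = cint g.
Proof.
move=> [f1 f2] [g1 g2] fg; rewrite /cintegral /Rintegral; congr (fine _ +i* fine _).
  apply: ae_eq_integral => //.
  - exact: measurable_int f1.
  - exact: measurable_int g1.
  by apply: aeS fg => x /= -> _.
apply: ae_eq_integral => //.
- exact: measurable_int f2.
- exact: measurable_int g2.
by apply: aeS fg => x /= -> _.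
Qed.

End ComplexIntegral.
Notation cint f := (cintegral setT f).

(** * Square-integrable functions *)

Section SquareIntegrable.
Context {R : realType}.
Local Notation mu := (@lebesgue_measure R).
Implicit Types (f g : R -> R[i]) (c : R[i]).

Definition e2 f : \bar R := (\int[mu]_x (cabs (f x) ^+ 2)%:E)%E.

(** The squared norm as a real number; it is 0 when the norm is infinite, so it carries information
    only together with [L2 f]. *)
Definition nn f : R := fine (e2 f).

Lemma L2norm_sqr f : (L2norm f ^+ 2 = e2 f)%E.
Proof.
have -> : (L2norm f ^+ 2 = L2norm f `^ 2)%E.
  have : (0 <= L2norm f)%E by exact: Lnorm_ge0.
  case: (L2norm f) => [r| |]// r0.
    by rewrite poweR_EFin -EFin_expe powR_mulrn.
  by rewrite poweRyr ?pnatr_eq0.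
rewrite /L2norm poweR_Lnorm//; apply: eq_integral => x _ /=.
rewrite powR_mulrn ?normr_ge0//.
by rewrite ger0_norm ?cabs_ge0.
Qed.

Lemma e2_ge0 f : (0 <= e2 f)%E.
Proof. by apply: integral_ge0 => x _; rewrite lee_fin sqr_ge0. Qed.

Lemma nn_ge0 f : 0 <= nn f.
Proof. by rewrite fine_ge0// e2_ge0. Qed.

Lemma L2norm_lty f : (L2norm f < +oo)%E <-> (e2 f < +oo)%E.
Proof.
rewrite -L2norm_sqr; have : (0 <= L2norm f)%E by exact: Lnorm_ge0.
case: (L2norm f) => [r| |]// r0; first by rewrite -EFin_expe !ltry.
Qed.

Lemma L2P f : L2 f <-> cmeas f /\ (e2 f < +oo)%E.
Proof.
split; first by case=> f1 f2 /L2norm_lty.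
by case=> -[f1 f2] /L2norm_lty.
Qed.

Lemma L2_meas f : L2 f -> cmeas f.
Proof. by case/L2P. Qed.

Lemma e2E f : L2 f -> e2 f = (nn f)%:E.
Proof. by move=> /L2P[_ fy]; rewrite /nn fineK// ge0_fin_numE// e2_ge0. Qed.

Lemma measurable_cabs2E f : cmeas f -> measurable_fun setT (fun x => (cabs (f x) ^+ 2)%:E).
Proof. by move=> mf; apply/measurable_EFinP; exact: measurable_cabs2. Qed.

Lemma L2_integrable f : L2 f -> mu.-integrable setT (EFin \o (fun x => cabs (f x) ^+ 2)).
Proof.
move=> /L2P[mf fy]; apply/integrableP; split; first exact: measurable_cabs2E.
by under eq_integral do rewrite /= ger0_norm ?sqr_ge0//.
Qed.

Lemma L2_dom f (g : R -> R) : cmeas f -> (forall x, cabs (f x) ^+ 2 <= g x) ->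
  mu.-integrable setT (EFin \o g) -> L2 f.
Proof.
move=> mf fg ig; apply/L2P; split => //.
have /integrableP[_] : mu.-integrable setT (EFin \o (fun x => cabs (f x) ^+ 2)).
  apply: le_integrable ig => //; first exact: measurable_cabs2E.
  move=> x _ /=; rewrite lee_fin ger0_norm ?sqr_ge0// (le_trans (fg x))//.
  exact: ler_norm.
by under eq_integral do rewrite /= ger0_norm ?sqr_ge0//.
Qed.

Lemma L20 : L2 (fun=> 0 : R[i]).
Proof.
apply: (@L2_dom _ (fun=> 0)); first exact: cmeas_cst.
  by move=> x; rewrite cabs0 expr0n.
exact: integrable0.
Qed.

Lemma L2D f g : L2 f -> L2 g -> L2 (fun x => f x + g x).
Proof.
move=> f2 g2; apply: (@L2_dom _ (fun x => 2 * cabs (f x) ^+ 2 + 2 * cabs (g x) ^+ 2)).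
- by apply: cmeasD; exact: L2_meas.
- by move=> x; exact: cabs2D_le.
- exact: (integrableD measurableT (integrableZl measurableT 2 (L2_integrable f2))
    (integrableZl measurableT 2 (L2_integrable g2))).
Qed.

Lemma L2_bounded_mul f g (C : R) : cmeas g -> (forall x, cabs (g x) <= C) ->
  L2 f -> L2 (fun x => g x * f x).
Proof.
move=> mg gC f2; apply: (@L2_dom _ (fun x => C ^+ 2 * cabs (f x) ^+ 2)).
- by apply: cmeasM => //; exact: L2_meas.
- move=> x; rewrite cabsM exprMn ler_wpM2r ?sqr_ge0// ler_pXn2r ?nnegrE ?cabs_ge0//.
  by rewrite (le_trans _ (gC x))// cabs_ge0.
- exact: (integrableZl measurableT _ (L2_integrable f2)).
Qed.

Lemma L2Z c f : L2 f -> L2 (fun x => c * f x).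
Proof. by apply: (@L2_bounded_mul _ (fun=> c) (cabs c)) => //; exact: cmeas_cst. Qed.

Lemma L2N f : L2 f -> L2 (fun x => - f x).
Proof. by move=> f2; under eq_fun do rewrite -mulN1r; exact: L2Z. Qed.

Lemma L2B f g : L2 f -> L2 g -> L2 (fun x => f x - g x).
Proof. by move=> f2 g2; apply: L2D => //; exact: L2N. Qed.

Lemma L2J f : L2 f -> L2 (fun x => (f x)^*).
Proof.
move=> f2; apply: (@L2_dom _ (fun x => cabs (f x) ^+ 2)).
- exact/cmeasJ/L2_meas.
- by move=> x; rewrite cabsJ.
- exact: L2_integrable.
Qed.

Lemma L2_res (D : set R) f : measurable D -> L2 f -> L2 (res D f).
Proof.
move=> mD; apply: (@L2_bounded_mul _ _ 1); first exact/cmeas_real/measurable_indic.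
by move=> x; rewrite cabs_real indicE ger0_norm//; case: (_ \in _).
Qed.

Lemma L2_sum I (s : seq I) (F : I -> R -> R[i]) :
  (forall i, L2 (F i)) -> L2 (fun x => \sum_(i <- s) F i x).
Proof.
move=> iF; elim: s => [|i s ih].
  by under eq_fun do rewrite big_nil; exact: L20.
by under eq_fun do rewrite big_cons; exact: L2D.
Qed.

Lemma cigrM f g : L2 f -> L2 g -> cigr (fun x => f x * g x).
Proof.
move=> f2 g2; apply: (@cigr_dom _ _ (fun x => cabs (f x) ^+ 2 + cabs (g x) ^+ 2)).
- by apply: cmeasM; exact: L2_meas.
- move=> x; rewrite cabsM.
  have := sqr_ge0 (cabs (f x) - cabs (g x)).
  have := cabs_ge0 (f x); have := cabs_ge0 (g x); nra.
- exact: (integrableD measurableT (L2_integrable f2) (L2_integrable g2)).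
Qed.

Lemma cigrMJ f g : L2 f -> L2 g -> cigr (fun x => f x * (g x)^*).
Proof. by move=> f2 g2; apply: cigrM => //; exact: L2J. Qed.

Lemma innerDl f g k : L2 f -> L2 g -> L2 k ->
  inner (fun x => f x + g x) k = inner f k + inner g k.
Proof.
move=> f2 g2 k2; rewrite /inner -cintD; [|exact: cigrMJ|exact: cigrMJ].
by congr cintegral; apply/funext => x; rewrite mulrDl.
Qed.

Lemma innerZl c f g : L2 f -> L2 g -> inner (fun x => c * f x) g = c * inner f g.
Proof.
move=> f2 g2; rewrite /inner -cintZ; last exact: cigrMJ.
by congr cintegral; apply/funext => x; rewrite mulrA.
Qed.

Lemma innerC f g : L2 f -> L2 g -> inner g f = (inner f g)^*.
Proof.
move=> f2 g2; rewrite /inner -cintJ; last exact: cigrMJ.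
by congr cintegral; apply/funext => x; rewrite rmorphM/= conjCK mulrC.
Qed.

Lemma innerDr f g k : L2 f -> L2 g -> L2 k ->
  inner k (fun x => f x + g x) = inner k f + inner k g.
Proof.
move=> f2 g2 k2; rewrite innerC ?innerDl//; last exact: L2D.
by rewrite rmorphD/= -!innerC.
Qed.

Lemma innerZr c f g : L2 f -> L2 g -> inner f (fun x => c * g x) = c^* * inner f g.
Proof.
move=> f2 g2; rewrite innerC ?innerZl//; last exact: L2Z.
by rewrite rmorphM/= -innerC.
Qed.

Lemma inner_suml I (s : seq I) (F : I -> R -> R[i]) g : (forall i, L2 (F i)) -> L2 g ->
  inner (fun x => \sum_(i <- s) F i x) g = \sum_(i <- s) inner (F i) g.
Proof.
move=> iF g2; rewrite /inner -cint_sum; last by move=> i; exact: cigrMJ.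
by congr cintegral; apply/funext => x; rewrite mulr_suml.
Qed.

Lemma inner_sumr I (s : seq I) (F : I -> R -> R[i]) g : (forall i, L2 (F i)) -> L2 g ->
  inner g (fun x => \sum_(i <- s) F i x) = \sum_(i <- s) inner g (F i).
Proof.
move=> iF g2; rewrite innerC ?inner_suml//; last exact: L2_sum.
by rewrite rmorph_sum; apply: eq_bigr => i _ /=; rewrite -innerC.
Qed.

Lemma innerBl f g k : L2 f -> L2 g -> L2 k ->
  inner (fun x => f x - g x) k = inner f k - inner g k.
Proof.
move=> f2 g2 k2; rewrite innerDl//; last exact: L2N.
by congr (_ + _); under eq_fun do rewrite -mulN1r; rewrite innerZl// mulN1r.
Qed.

Lemma innerff f : inner f f = (nn f)%:C.
Proof.
rewrite /inner /cintegral; under eq_Rintegral do rewrite mulJ_cabs2.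
by under [in X in _ +i* X]eq_Rintegral do rewrite mulJ_cabs2/=; rewrite Rintegral_cst// mul0r.
Qed.

Lemma nnD f g : L2 f -> L2 g ->
  nn (fun x => f x + g x) = nn f + nn g + 2 * complex.Re (inner f g).
Proof.
move=> f2 g2; have fg2 := L2D f2 g2.
have : inner (fun x => f x + g x) (fun x => f x + g x) =
    inner f f + inner g g + inner f g + (inner f g)^*.
  by rewrite innerDl// !innerDr// -innerC//; ring.
rewrite !innerff; case: (inner f g) => a b /(congr1 (@complex.Re R)) /= ->; ring.
Qed.

Lemma nnZ c f : L2 f -> nn (fun x => c * f x) = cabs c ^+ 2 * nn f.
Proof.
move=> f2; have := innerff (fun x => c * f x).
rewrite innerZl// ?innerZr//; last exact: L2Z.
rewrite mulrA mulJ_cabs2 innerff -rmorphM/= => H.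
by have := congr1 (@complex.Re R) H.
Qed.

Lemma nnN f : L2 f -> nn (fun x => - f x) = nn f.
Proof.
by move=> f2; under eq_fun do rewrite -mulN1r; rewrite nnZ// cabsN cabs1 expr1n mul1r.
Qed.

Lemma nnB f g : L2 f -> L2 g ->
  nn (fun x => f x - g x) = nn f + nn g - 2 * complex.Re (inner f g).
Proof.
move=> f2 g2; rewrite nnD//; last exact: L2N.
rewrite nnN//; under eq_fun do rewrite -mulN1r; rewrite innerZr//.
by case: (inner f g) => a b /=; ring.
Qed.

Lemma nn_BC f g : L2 f -> L2 g -> nn (fun x => f x - g x) = nn (fun x => g x - f x).
Proof.
move=> f2 g2; rewrite -nnN; last exact: L2B.
by congr nn; apply/funext => x; rewrite opprB.
Qed.

Lemma nnD_le f g : L2 f -> L2 g ->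
  nn (fun x => f x + g x) <= 2 * nn f + 2 * nn g.
Proof.
move=> f2 g2; have := nn_ge0 (fun x => f x - g x).
by rewrite nnB// nnD//; lra.
Qed.

Lemma nnB_le f g k : L2 f -> L2 g -> L2 k ->
  nn (fun x => f x - k x) <= 2 * nn (fun x => f x - g x) + 2 * nn (fun x => g x - k x).
Proof.
move=> f2 g2 k2.
rewrite (_ : (fun x => f x - k x) = (fun x => (f x - g x) + (g x - k x))).
  by apply: nnD_le; exact: L2B.
by apply/funext => x; rewrite addrA subrK.
Qed.

Lemma cauchy_schwarz f g : L2 f -> L2 g -> cabs (inner f g) ^+ 2 <= nn f * nn g.
Proof.
move=> f2 g2; set a := inner f g.
(* Expansion of the squared norm of [f - t a g]: the factor a makes the cross term real. *)
have H t : 0 <= nn f + t ^+ 2 * cabs a ^+ 2 * nn g - 2 * (t * cabs a ^+ 2).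
  have := nn_ge0 (fun x => f x - (t%:C * a) * g x).
  rewrite nnB//; last exact: L2Z.
  rewrite nnZ// innerZr// -/a cabsM cabs_real exprMn real_normK ?num_real//.
  rewrite (_ : complex.Re ((t%:C * a)^* * a) = t * cabs a ^+ 2)//.
  by rewrite cabs2E; case: (a) => u v /=; ring.
have [g0|g0] := eqVneq (nn g) 0.
  rewrite g0 mulr0 leNgt; apply/negP => a0.
  (* The expansion is affine in t when [nn g = 0]; this t makes it negative. *)
  have := H ((nn f + 1) / cabs a ^+ 2).
  rewrite g0 mulr0 addr0 divfK ?gt_eqF//; have := nn_ge0 f; lra.
have g1 : 0 < nn g by rewrite lt_neqAle eq_sym g0 nn_ge0.
(* The minimizing t. *)
have := H (nn g)^-1; rewrite -(ler_pM2r g1) mul0r => /le_trans; rewrite -subr_ge0; apply.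
by rewrite le_eqVlt; apply/orP; left; apply/eqP; field.
Qed.

Lemma ae_eq_e2 f g : cmeas f -> cmeas g -> {ae mu, forall x, f x = g x} -> e2 f = e2 g.
Proof.
move=> mf mg fg; apply: ae_eq_integral => //; try exact: measurable_cabs2E.
by apply: aeS fg => x /= -> _.
Qed.

Lemma ae_eq_nn f g : cmeas f -> cmeas g -> {ae mu, forall x, f x = g x} -> nn f = nn g.
Proof. by move=> mf mg fg; rewrite /nn (ae_eq_e2 mf mg fg). Qed.

Lemma ae_eq_innerl f g k : L2 f -> L2 g -> L2 k -> {ae mu, forall x, f x = g x} ->
  inner f k = inner g k.
Proof.
by move=> f2 g2 k2 fg; apply: ae_eq_cint; [exact: cigrMJ..|apply: aeS fg => x ->].
Qed.

Lemma ae_eq_innerr f g k : L2 f -> L2 g -> L2 k -> {ae mu, forall x, f x = g x} ->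
  inner k f = inner k g.
Proof.
by move=> f2 g2 k2 fg; apply: ae_eq_cint; [exact: cigrMJ..|apply: aeS fg => x ->].
Qed.

Lemma nn_eq0 f : L2 f -> nn f = 0 -> {ae mu, forall x, f x = 0}.
Proof.
move=> f2 f0; have mf := measurable_cabs2E (L2_meas f2).
have /(ae_eq_integral_abs mu measurableT mf) : (\int[mu]_x `|(cabs (f x) ^+ 2)%:E| = 0)%E.
  under eq_integral do rewrite /= ger0_norm ?sqr_ge0//.
  by rewrite -[LHS]/(e2 f) e2E// f0.
apply: aeS => x /(_ I) [] /eqP.
by rewrite sqrf_eq0 cabs_eq0 => /eqP.
Qed.

Lemma nnB_eq0 f g : L2 f -> L2 g -> nn (fun x => f x - g x) = 0 ->
  {ae mu, forall x, f x = g x}.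
Proof.
move=> f2 g2 /nn_eq0; move/(_ (L2B f2 g2)); apply: aeS => x.
by move/eqP; rewrite subr_eq0 => /eqP.
Qed.

(** Replaces the extended-valued norm of the definition by squared real norms, on which the algebra
    of inner products works; the square root, being continuous, leads back. *)
Lemma is_L2limP (u : nat -> R -> R[i]) g : (forall n, L2 (u n)) ->
  is_L2lim u g <-> L2 g /\ (fun n => nn (fun x => u n x - g x)) @ \oo --> (0 : R).
Proof.
move=> u2; rewrite /is_L2lim; split => -[g2 H]; split => //.
  have /fine_cvgP[_] : (fun n => (L2norm (fun x => (u n x - g x)%R) ^+ 2)%E) @ \oo --> (0%E : \bar R).
    rewrite -[X in _ --> X](mule0 0%E).
    under eq_fun do rewrite expe2.
    by apply: cvgeM => //; rewrite mule_def_fin.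
  by under eq_fun do rewrite L2norm_sqr.
have L0 n : (0 <= L2norm (fun x => (u n x - g x)%R))%E by exact: Lnorm_ge0.
have LE n : L2norm (fun x => u n x - g x) = (Num.sqrt (nn (fun x => u n x - g x)))%:E.
  have := L2norm_sqr (fun x => u n x - g x); rewrite e2E; last exact: L2B.
  have := L0 n; case: (L2norm _) => [r| |]// r0.
  by rewrite -EFin_expe => -[<-]; rewrite sqrtr_sqr ger0_norm.
under eq_fun do rewrite LE.
apply: cvg_EFin; first by near=> n.
rewrite -[X in _ --> X]sqrtr0; apply: continuous_cvg => //; exact: sqrt_continuous.
Unshelve. all: by end_near. Qed.

Lemma cvg_inner (u : nat -> R -> R[i]) f g : (forall n, L2 (u n)) -> is_L2lim u f -> L2 g ->
  (fun n => cabs (inner (u n) g - inner f g) ^+ 2) @ \oo --> (0 : R).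
Proof.
move=> u2 /(is_L2limP _ u2)[f2 uf] g2.
apply: (@squeeze_cvgr _ _ _ _ (fun=> 0) (fun n => nn (fun x => u n x - f x) * nn g)).
- near=> n; rewrite sqr_ge0/= -innerBl//.
  by apply: cauchy_schwarz => //; exact: L2B.
- exact: cvg_cst.
- by rewrite -(mul0r (nn g)); apply: cvgMl.
Unshelve. all: by end_near. Qed.

(** Meant for partial sums, whose inner product with a suitable function is eventually the
    coefficient sought. *)
Lemma inner_lim (u : nat -> R -> R[i]) f g c : (forall n, L2 (u n)) -> is_L2lim u f ->
  L2 g -> (\forall n \near \oo, inner (u n) g = c) -> inner f g = c.
Proof.
move=> u2 uf g2 uc; have H := cvg_inner u2 uf g2.
have : (fun n => cabs (inner (u n) g - inner f g) ^+ 2) @ \oo --> cabs (c - inner f g) ^+ 2.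
  by apply: cvg_near_cst; apply: filterS uc => n ->.
move=> /(cvg_unique (@Rhausdorff R))/(_ H)/eqP.
by rewrite sqrf_eq0 cabs_eq0 subr_eq0 => /eqP.
Qed.

End SquareIntegrable.

(** * Completeness of the space of square-integrable functions *)

Section Completeness.
Context {R : realType}.
Local Notation mu := (@lebesgue_measure R).
Implicit Types (f g : R -> R[i]) (u v : nat -> R -> R[i]).

Lemma geometric_quarter_sum (n : nat) : \sum_(0 <= k < n) 4^-1 ^+ k <= 2 :> R.
Proof.
suff : \sum_(0 <= k < n) 4^-1 ^+ k <= 2 - 2 * 4^-1 ^+ n :> R.
  move=> /le_trans; apply; have : 0 <= (4^-1 : R) ^+ n by rewrite exprn_ge0.
  lra.
elim: n => [|n ih]; first by rewrite big_geq// expr0; lra.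
rewrite big_nat_recr//= exprS; have : 0 <= (4^-1 : R) ^+ n by rewrite exprn_ge0.
move: ih; set s := \sum_(0 <= _ < _) _; lra.
Qed.

Lemma cvg_of_geometric_increments (a : nat -> R) (C : R) :
  (forall k, `|a k.+1 - a k| <= C * 2^-1 ^+ k) -> cvgn a.
Proof.
move=> aC.
have C0 : 0 <= C by have := aC 0%N; rewrite expr0 mulr1; apply: le_trans.
have /cvg_ex[l al] : cvgn (series (telescope a)).
  apply: normed_cvg; apply: (@series_le_cvg _ _ (geometric C 2^-1)) => [n|n|n|].
  - exact: normr_ge0.
  - by rewrite /geometric/= mulr_ge0// exprn_ge0.
  - by rewrite /geometric/telescope/=.
  - by apply: is_cvg_geometric_series; rewrite ger0_norm ?invf_lt1 ?ltr1n.
apply/cvg_ex; exists (a 0%N + l).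
have H : (fun n => a 0%N + series (telescope a) n) @ \oo --> a 0%N + l.
  by apply: cvgD => //; exact: cvg_cst.
rewrite (_ : (fun n => _) = a) in H => //.
by apply/funext => n; rewrite -eq_sum_telescope.
Qed.

(** Fatou's lemma: the norm is lower semicontinuous under pointwise convergence. *)
Lemma e2_fatou u g (c : \bar R) : (forall n, cmeas (u n)) -> cmeas g ->
  (forall x, (fun n => cabs (u n x) ^+ 2) @ \oo --> cabs (g x) ^+ 2) ->
  (\forall n \near \oo, e2 (u n) <= c)%E -> (e2 g <= c)%E.
Proof.
move=> mu_ mg ug uc.
have -> : e2 g = (\int[mu]_x limn_einf (fun n => (cabs (u n x) ^+ 2)%:E))%E.
  apply: eq_integral => x _.
  have /cvg_limn_einf_sup[-> _//] : (fun n => (cabs (u n x) ^+ 2)%:E) @ \oo --> (cabs (g x) ^+ 2)%:E.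
  apply: cvg_EFin; [by near=> n|exact: ug].
apply: (le_trans (fatou mu measurableT _ _)).
- by move=> n; exact: measurable_cabs2E.
- by move=> n x _; rewrite lee_fin sqr_ge0.
have [N _ uN] := uc.
rewrite limn_einf_lim; apply: lime_le; first exact: is_cvg_einfs.
near=> n; apply: (@le_trans _ _ (e2 (u (maxn n N)))).
  by apply: ereal_inf_lbound; exists (maxn n N) => //=; rewrite leq_maxl.
by apply: uN => /=; rewrite leq_maxr.
Unshelve. all: by end_near. Qed.

(** Riesz-Fischer. Along a fast subsequence a weighted sum of squared increments has finite
    integral, hence is finite almost everywhere, and there the increments decay geometrically.
    Fatou's lemma turns the pointwise limit into a limit in norm. *)
Lemma L2_complete u : (forall n, L2 (u n)) ->
  (forall e : R, 0 < e -> exists N, forall m n, (N <= m)%N -> (N <= n)%N ->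
     nn (fun x => u m x - u n x) <= e) ->
  exists g, is_L2lim u g.
Proof.
move=> u2 uC.
(* The rate [16^-k] is balanced against the weight [4^k] in [F]: the integrals are at most [4^-k],
   while a finite sum at x still gives [cabs (d k x) <= sqrt (S x) * 2^-k]. *)
have /choice[N0 N0P] : forall k, exists N, forall m n, (N <= m)%N -> (N <= n)%N ->
    nn (fun x => u m x - u n x) <= 16^-1 ^+ k by move=> k; apply: uC; rewrite exprn_gt0.
(* Summing the thresholds makes them nondecreasing. *)
pose N k := (\sum_(0 <= i < k.+1) N0 i)%N.
have NS k : (N k <= N k.+1)%N by rewrite /N [in leqRHS]big_nat_recr//= leq_addr.
have Nmono k m : (k <= m)%N -> (N k <= N m)%N.
  by move=> /subnK <-; elim: (m - k)%N => // j /leq_trans; apply; exact: NS.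
have N0N k : (N0 k <= N k)%N by rewrite /N big_nat_recr//= leq_addl.
have NP k m n : (N k <= m)%N -> (N k <= n)%N -> nn (fun x => u m x - u n x) <= 16^-1 ^+ k.
  by move=> km kn; apply: N0P; exact: leq_trans (N0N k) _.
pose v k := u (N k).
have v2 k : L2 (v k) by exact: u2.
pose d k x := v k.+1 x - v k x.
have d2 k : L2 (d k) by exact: L2B.
pose F k x : \bar R := (4 ^+ k * cabs (d k x) ^+ 2)%:E.
have F0 k x : (0 <= F k x)%E by rewrite lee_fin mulr_ge0 ?exprn_ge0 ?cabs_ge0.
have mF k : measurable_fun setT (F k).
  apply/measurable_EFinP; apply: measurable_funM => //.
  by apply: measurable_cabs2; exact: L2_meas.
pose S x : \bar R := (\sum_(0 <= k <oo) F k x)%E.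
have S0 x : (0 <= S x)%E by exact: nneseries_ge0.
have mS : measurable_fun setT S.
  by apply: ge0_emeasurable_sum => // k x _.
have intS : (\int[mu]_x S x <= 2%:E)%E.
  rewrite integral_nneseries//.
  apply: lime_le; first by apply: is_cvg_nneseries => k _ _; exact: integral_ge0.
  near=> n; apply: (@le_trans _ _ (\sum_(0 <= k < n) (4^-1 ^+ k)%:E)%E); last first.
    by rewrite sumEFin lee_fin geometric_quarter_sum.
  apply: lee_sum => k _; rewrite /F.
  under eq_integral do rewrite EFinM.
  rewrite ge0_integralZl ?lee_fin ?exprn_ge0//; last 2 first.
  - by apply: measurable_cabs2E; exact: L2_meas.
  - by move=> x _; rewrite lee_fin sqr_ge0.
  rewrite -[(\int[mu]_x _)%E]/(e2 (d k)) e2E// -EFinM lee_fin.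
  apply: (@le_trans _ _ (4 ^+ k * 16^-1 ^+ k)).
    by rewrite ler_wpM2l ?exprn_ge0//; apply: NP => //; exact: NS.
  by rewrite -exprMn (_ : 4 * 16^-1 = 4^-1)//; field.
pose A := [set x | (S x < +oo)%E].
have mA : measurable A.
  rewrite -[A]setTI; exact: emeasurable_fun_infty_o.
have aeA : {ae mu, forall x, A x}.
  have : mu.-integrable setT S.
    apply/integrableP; split => //; under eq_integral do rewrite gee0_abs//.
    by apply: (le_lt_trans intS); exact: ltry.
  move=> /(integrable_ae measurableT); apply: aeS => x /(_ I).
  by rewrite ge0_fin_numE.
have dA x : A x -> forall k, cabs (d k x) <= Num.sqrt (fine (S x)) * 2^-1 ^+ k.
  move=> Ax k.
  have H : 4 ^+ k * cabs (d k x) ^+ 2 <= fine (S x).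
    rewrite -lee_fin fineK ?ge0_fin_numE//.
    apply: (@le_trans _ _ (\sum_(0 <= i < k.+1) F i x)%E); last first.
      exact: nneseries_lim_ge.
    by rewrite big_nat_recr//= leeDr// sume_ge0.
  rewrite -(@ler_pXn2r _ 2)// ?nnegrE ?cabs_ge0 ?mulr_ge0 ?sqrtr_ge0 ?exprn_ge0//.
  rewrite exprMn sqr_sqrtr ?fine_ge0// -exprM mulnC exprM.
  rewrite (_ : 2^-1 ^+ 2 = 4^-1 :> R); last by field.
  by rewrite exprVn ler_pdivlMr ?exprn_gt0// mulrC.
(* Zero on the exceptional null set, so that the limit exists at every point and is measurable. *)
pose w k := res A (v k).
have w2 k : L2 (w k) by exact: L2_res.
have wRe x : cvgn (fun k => complex.Re (w k x)).
  have [Ax|Ax] := pselect (A x).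
    under eq_fun do rewrite /w res_in//.
    apply: (@cvg_of_geometric_increments _ (Num.sqrt (fine (S x)))) => k.
    apply: le_trans (dA x Ax k); rewrite /d.
    by case: (v k.+1 x) (v k x) => [a b] [a' b']; exact: (normRe_le_cabs ((a - a') +i* (b - b'))).
  by under eq_fun do rewrite /w res_out//; exact: is_cvg_cst.
have wIm x : cvgn (fun k => complex.Im (w k x)).
  have [Ax|Ax] := pselect (A x).
    under eq_fun do rewrite /w res_in//.
    apply: (@cvg_of_geometric_increments _ (Num.sqrt (fine (S x)))) => k.
    apply: le_trans (dA x Ax k); rewrite /d.
    by case: (v k.+1 x) (v k x) => [a b] [a' b']; exact: (normIm_le_cabs ((a - a') +i* (b - b'))).
  by under eq_fun do rewrite /w res_out//; exact: is_cvg_cst.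
pose g x := limn (fun k => complex.Re (w k x)) +i* limn (fun k => complex.Im (w k x)).
have mg : cmeas g.
  split => /=.
    apply: (@measurable_fun_cvg _ _ _ _ (fun k x => complex.Re (w k x))) => [k|x _].
      by case: (L2_meas (w2 k)).
    exact: wRe.
  apply: (@measurable_fun_cvg _ _ _ _ (fun k x => complex.Im (w k x))) => [k|x _].
    by case: (L2_meas (w2 k)).
  exact: wIm.
(* Fatou in k, with m fixed. *)
have gw m : (e2 (fun x => (g x - w m x)%R) <= (16^-1 ^+ m)%:E)%E.
  apply: (@e2_fatou (fun k x => w k x - w m x)).
  - by move=> k; exact/L2_meas/L2B.
  - by apply: cmeasB => //; exact: L2_meas.
  - move=> x; under eq_fun do rewrite cabs2E !ReD !ImD; rewrite cabs2E !ReD !ImD.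
    apply: cvgD; apply: cvgM; apply: cvgD; (try exact: cvg_cst); [exact: wRe..|exact: wIm|exact: wIm].
  - exists m => // k /= mk.
    rewrite (@ae_eq_e2 _ _ (fun x => v k x - v m x)).
    + rewrite e2E; last exact: L2B.
      by rewrite lee_fin; apply: NP => //; exact: Nmono.
    + exact/L2_meas/L2B.
    + exact/L2_meas/L2B.
    + by apply: aeS aeA => x Ax; rewrite /w !res_in.
have gw2 m : L2 (fun x => g x - w m x).
  apply/L2P; split; first by apply: cmeasB => //; exact: L2_meas.
  by apply: (le_lt_trans (gw m)); exact: ltry.
have g2 : L2 g.
  rewrite (_ : g = (fun x => (g x - w 0%N x) + w 0%N x)); first exact: L2D.
  by apply/funext => x; rewrite subrK.
exists g; apply/is_L2limP => //; split => //.
apply/cvgrPdist_le => e e0.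
(* [nnB_le] costs a factor 2 on each of two distances bounded by [16^-m]. *)
have : (fun m => 4 * 16^-1 ^+ m) @ \oo --> (4 * 0 : R).
  by apply: cvgMl_tmp; apply: cvg_expr; rewrite ger0_norm// invf_lt1// ltr1n.
rewrite mulr0 => /cvgrPdist_le /(_ e e0)[m _ /(_ m (leqnn m)) /= me].
exists (N m) => // n /= mn.
rewrite sub0r normrN ger0_norm ?nn_ge0//.
apply: (le_trans (nnB_le (u2 n) (v2 m) g2)).
have H1 : nn (fun x => u n x - v m x) <= 16^-1 ^+ m by exact: NP.
have H2 : nn (fun x => v m x - g x) <= 16^-1 ^+ m.
  rewrite nn_BC// -lee_fin -e2E; last exact: L2B.
  rewrite (@ae_eq_e2 _ _ (fun x => g x - w m x)) ?gw//.
  - exact/L2_meas/L2B.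
  - exact: L2_meas.
  - by apply: aeS aeA => x Ax; rewrite /w res_in.
move: me; rewrite sub0r normrN ger0_norm ?mulr_ge0 ?exprn_ge0//; lra.
Unshelve. all: by end_near. Qed.

End Completeness.

(** * Translation invariance and decomposition into translates of one cell *)

Section Translation.
Context {R : realType}.
Local Notation mu := (@lebesgue_measure R).
Implicit Types (f g : R -> R[i]).

Lemma measurable_shift (a : R) : measurable_fun setT (fun x : R => x + a).
Proof. by apply: measurable_funD. Qed.

Let shiftT (a : R) : measurableTypeR R -> measurableTypeR R := fun x : R => x + a.

Let mshift a : measurable_fun setT (shiftT a).
Proof. exact: measurable_shift. Qed.

HB.instance Definition _ a := isMeasurableFun.Build _ _ _ _ (shiftT a) (mshift a).

(** Lebesgue measure is determined by its values on half-open intervals, so only these are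
    compared. *)
Lemma lebesgue_measure_shift (a : R) (A : set R) : measurable A ->
  mu A = pushforward mu (shiftT a) A.
Proof.
move=> mA; apply: lebesgue_measure_unique => //= _ [[u v]] _ <- /=.
rewrite /pushforward (_ : _ @^-1` _ = `]u - a, v - a]%classic).
  rewrite !lebesgue_measure_itv/= !lte_fin ltrD2r; case: ifP => // _.
  by rewrite -!EFinB; congr EFin; ring.
by apply/seteqP; split => x; rewrite /shiftT/= !in_itv/= ltrBlDr lerBrDr.
Qed.

Lemma ge0_integral_shift (a : R) (D : set R) (f : R -> \bar R) : measurable D ->
  measurable_fun setT f -> (forall x, 0 <= f x)%E ->
  (\int[mu]_(x in D) f x = \int[mu]_(x in [set y | D (y + a)%R]) f (x + a)%R)%E.
Proof.
move=> mD mf f0; rewrite (eq_measure_integral (pushforward mu (shiftT a))); last first.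
  by move=> A mA _; exact: lebesgue_measure_shift.
by rewrite ge0_integral_pushforward//; exact: measurable_funS mf.
Qed.

Lemma e2_shift (a : R) f : cmeas f -> e2 (fun x => f (x + a)) = e2 f.
Proof.
move=> mf; rewrite /e2 [RHS](@ge0_integral_shift a)//.
- exact: measurable_cabs2E.
- by move=> x; rewrite lee_fin sqr_ge0.
Qed.

Lemma L2_shift (a : R) f : L2 f -> L2 (fun x => f (x + a)).
Proof.
move=> /L2P[mf f2]; apply/L2P; split; last by rewrite e2_shift.
by apply: cmeas_comp => //; exact: measurable_shift.
Qed.

Lemma Rintegral_shift (a : R) (r : R -> R) : mu.-integrable setT (EFin \o r) ->
  mu.-integrable setT (EFin \o (fun x => r (x + a))) /\
  \int[mu]_x r (x + a) = \int[mu]_x r x.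
Proof.
move=> ir; have /integrableP[mr ry] := ir.
have ish : mu.-integrable setT (EFin \o (fun x => r (x + a))).
  apply/integrableP; split; first exact: (measurableT_comp mr (mshift a)).
  rewrite (@ge0_integral_shift a) in ry => //.
  exact: measurableT_comp.
split => //; rewrite /Rintegral; congr fine.
rewrite [RHS](eq_measure_integral (pushforward mu (shiftT a))); last first.
  by move=> A mA _; exact: lebesgue_measure_shift.
by rewrite (integral_pushforward (mshift a)).
Qed.

Lemma cigr_shift (a : R) f : cigr f -> cigr (fun x => f (x + a)).
Proof. by move=> [/(Rintegral_shift a)[? _] /(Rintegral_shift a)[? _]]. Qed.

Lemma cint_shift (a : R) f : cigr f -> cint (fun x => f (x + a)) = cint f.
Proof.
move=> [/(Rintegral_shift a)[_ f1] /(Rintegral_shift a)[_ f2]].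
by rewrite /cintegral; congr (_ +i* _).
Qed.

Lemma inner_shift (a : R) f g : L2 f -> L2 g ->
  inner (fun x => f (x + a)) (fun x => g (x + a)) = inner f g.
Proof. by move=> f2 g2; rewrite /inner -[RHS](cint_shift a)//; exact: cigrMJ. Qed.

Lemma ge0_integral_tile (P a : R) (n : nat) (g : R -> \bar R) : 0 < P ->
  measurable_fun setT g -> (forall x, 0 <= g x)%E ->
  (\int[mu]_(x in `[a, (a + n%:R * P)%R[) g x =
   \sum_(k < n) \int[mu]_(x in `[0%R, P[) g (x + (a + k%:R * P))%R)%E.
Proof.
move=> P0 mg g0; elim: n => [|n ih].
  by rewrite mul0r addr0 set_itvco0 integral_set0 big_ord0.
have nP : a + n.+1%:R * P = a + n%:R * P + P by rewrite -(@natr1 _ n); ring.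
rewrite (@itv_bndbnd_setU _ _ _ (BLeft (a + n%:R * P))); last 2 first.
- by rewrite bnd_simp lerDl mulr_ge0// ltW.
- by rewrite bnd_simp nP lerDl ltW.
rewrite ge0_integral_setU//=.
- rewrite ih big_ord_recr/=; congr (_ + _)%E.
  rewrite (@ge0_integral_shift (a + n%:R * P))//.
  congr (integral _ _ _); apply/seteqP; split => x /=; rewrite !in_itv/= nP;
    move=> /andP[H1 H2]; apply/andP; split; lra.
- exact: measurable_funS mg.
- by apply: lt_disjoint => x y; rewrite !in_itv/= => /andP[_ H] /andP[+ _]; exact: lt_le_trans.
Qed.

End Translation.

(** * Fourier series *)

Section TrigonometricUniqueness.
Context {R : realType}.
Local Notation mu := (@lebesgue_measure R).

Lemma ae_neq (a : R) : {ae mu, forall x, x <> a}.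
Proof.
exists [set a]; split => //; first exact: lebesgue_measure_set1.
by move=> x /= /contrapT.
Qed.

Lemma bernoulli_le (y : R) (n : nat) : -1 <= y -> 1 + n%:R * y <= (1 + y) ^+ n.
Proof.
move=> y1; elim: n => [|n ih]; first by rewrite mul0r addr0 expr0.
rewrite exprS; apply: (@le_trans _ _ ((1 + y) * (1 + n%:R * y))).
  rewrite -(@natr1 _ n).
  have : 0 <= n%:R * y ^+ 2 by rewrite mulr_ge0 ?sqr_ge0.
  set m := n%:R; nra.
by rewrite ler_wpM2l//; lra.
Qed.

Lemma ae_eq_Rintegral (r1 r2 : R -> R) : measurable_fun setT r1 -> measurable_fun setT r2 ->
  {ae mu, forall x, r1 x = r2 x} -> \int[mu]_x r1 x = \int[mu]_x r2 x.
Proof.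
move=> m1 m2 r12; rewrite /Rintegral; congr fine; apply: ae_eq_integral => //.
- exact/measurable_EFinP.
- exact/measurable_EFinP.
- by apply: aeS r12 => x -> _.
Qed.

(* Polynomials in s bounded by 1 that converge to the indicator of s < 1/2. *)
Definition step_poly (n : nat) (s : R) : R := (1 - s ^+ n) ^+ (2 ^ n).

Lemma step_poly_bound n s : 0 <= s <= 1 -> `|step_poly n s| <= 1.
Proof.
move=> /andP[s0 s1]; have sn : 0 <= 1 - s ^+ n <= 1.
  by rewrite subr_ge0 exprn_ile1//= lerBlDr lerDl exprn_ge0.
case/andP: sn => sn0 sn1.
by rewrite /step_poly ger0_norm ?exprn_ge0// exprn_ile1.
Qed.

(** Bernoulli's inequality gives [1 - (2 s)^n <= step_poly n s]. These polynomials are those of an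
    elementary proof of the Stone-Weierstrass theorem. *)
Lemma step_poly_cvg1 s : 0 <= s -> s < 2^-1 -> step_poly ^~ s @ \oo --> (1 : R).
Proof.
move=> s0 s1; have s2 : `|2 * s| < 1 by rewrite ger0_norm ?mulr_ge0//; lra.
apply: (@squeeze_cvgr _ _ _ _ (fun n => 1 - (2 * s) ^+ n) (fun=> 1)).
- near=> n.
  have sn : 0 <= s ^+ n <= 1 by rewrite exprn_ge0//= exprn_ile1//; lra.
  rewrite /step_poly exprn_ile1 ?andbT; [|lra|lra].
  have := @bernoulli_le (- s ^+ n) (2 ^ n); rewrite natrX exprMn mulrN.
  by apply; lra.
- rewrite -[X in _ --> X]subr0; apply: cvgB; first exact: cvg_cst.
  exact: cvg_expr.
- exact: cvg_cst.
Unshelve. all: by end_near. Qed.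

(** From [(1 - s^n) (1 + s^n) <= 1] and Bernoulli's inequality, [step_poly n s] is at most the
    inverse of [(1 + s^n)^(2^n)], hence at most [(2 s)^-n]. *)
Lemma step_poly_cvg0 s : s <= 1 -> 2^-1 < s -> step_poly ^~ s @ \oo --> (0 : R).
Proof.
move=> s1 s2; have s0 : 0 < s by lra.
have s3 : `|(2 * s)^-1| < 1.
  by rewrite ger0_norm ?invr_ge0 ?mulr_ge0 ?ltW// invf_lt1 ?mulr_gt0//; lra.
apply: (@squeeze_cvgr _ _ _ _ (fun=> 0) (fun n => (2 * s)^-1 ^+ n)).
- near=> n.
  have sn : 0 <= s ^+ n <= 1.
    by apply/andP; split; [exact/exprn_ge0/ltW|apply: exprn_ile1 => //; exact: ltW].
  case/andP: sn => sn0 sn1.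
  rewrite /step_poly exprn_ge0 ?subr_ge0//=.
  have B : (2 * s) ^+ n <= (1 + s ^+ n) ^+ (2 ^ n).
    have := @bernoulli_le (s ^+ n) (2 ^ n); rewrite natrX exprMn => H.
    have := H (le_trans (lerN10 R) sn0).
    by apply: le_trans; rewrite lerDr.
  have p0 : 0 < (2 * s) ^+ n by rewrite exprn_gt0// mulr_gt0.
  rewrite exprVn -[leRHS]mul1r ler_pdivlMr//.
  apply: (@le_trans _ _ ((1 - s ^+ n) ^+ (2 ^ n) * (1 + s ^+ n) ^+ (2 ^ n))).
    by rewrite ler_wpM2l// exprn_ge0// subr_ge0.
  rewrite -exprMn exprn_ile1//; last nra.
  by rewrite mulr_ge0 ?subr_ge0 ?addr_ge0.
- exact: cvg_cst.
- exact: cvg_expr.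
Unshelve. all: by end_near. Qed.

Variables (a L : R).
Hypothesis L0 : 0 < L.
Local Notation D := (`[a, a + L[%classic : set R).
Local Notation kap := (2 * pi / L).

Definition echar (n : int) (x : R) : R[i] := expi (x * (n%:~R * kap)).

Lemma echarD m n x : echar (m + n) x = echar m x * echar n x.
Proof. by rewrite /echar -expiD -mulrDr -mulrDl -intrD. Qed.

Lemma echarN n x : echar (- n) x = (echar n x)^*.
Proof. by rewrite /echar expiJ mulrNz mulNr mulrN. Qed.

Lemma cmeas_echar n : cmeas (echar n).
Proof. apply: (cmeas_comp _ cmeas_expi); exact: measurable_funM. Qed.

(** Trigonometric polynomials, as the span of the characters: measurability, boundedness and
    orthogonality to G are all obtained by induction on this span. *)
Inductive trig : (R -> R[i]) -> Prop :=
| trig_char n : trig (echar n)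
| trigD p q : trig p -> trig q -> trig (fun x => p x + q x)
| trigZ c p : trig p -> trig (fun x => c * p x).

Lemma trig_cst c : trig (fun=> c).
Proof.
rewrite (_ : (fun=> c) = (fun x => c * echar 0 x)).
  by apply: trigZ; exact: trig_char.
by apply/funext => x; rewrite /echar mul0r mulr0 expi0 mulr1.
Qed.

Lemma trigM p q : trig p -> trig q -> trig (fun x => p x * q x).
Proof.
move=> tp tq; elim: tp => [n|p1 p2 _ t1 _ t2|c p1 _ t1].
- elim: tq => [m|q1 q2 _ t1 _ t2|c q1 _ t1].
  + rewrite (_ : (fun x => _) = echar (n + m)); first exact: trig_char.
    by apply/funext => x; rewrite echarD.
  + by under eq_fun do rewrite mulrDr; exact: trigD.
  + by under eq_fun do rewrite mulrCA; exact: trigZ.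
- by under eq_fun do rewrite mulrDl; exact: trigD.
- by under eq_fun do rewrite -mulrA; exact: trigZ.
Qed.

Lemma trigX p n : trig p -> trig (fun x => p x ^+ n).
Proof.
move=> tp; elim: n => [|n ih]; first exact: trig_cst.
by under eq_fun do rewrite exprS; exact: trigM.
Qed.

Lemma trig_cos (c : R) : trig (fun x => (cos (kap * (x - c)))%:C).
Proof.
rewrite (_ : (fun x => _) = (fun x => 2^-1 * (expi (- (c * kap)) * echar 1 x) +
    2^-1 * (expi (c * kap) * echar (-1) x))).
  by apply: trigD; apply: trigZ; apply: trigZ; exact: trig_char.
apply/funext => x; rewrite echarN /echar mul1r expiJ -!expiD.
rewrite (_ : - (c * kap) + x * kap = kap * (x - c)); last by ring.
rewrite (_ : c * kap - x * kap = - (kap * (x - c))); last by ring.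
rewrite -expiJ -mulrDr /expi.
apply: (@mulfI _ 2%:R); rewrite ?pnatr_eq0// mulrA divff ?pnatr_eq0// mul1r.
apply/eqP; rewrite eq_complex; apply/andP; split; apply/eqP => /=; ring.
Qed.

Lemma trig_meas p : trig p -> cmeas p.
Proof.
elim=> [n|p1 p2 _ t1 _ t2|c p1 _ t1]; first exact: cmeas_echar.
  exact: cmeasD.
by apply: cmeasM => //; exact: cmeas_cst.
Qed.

Lemma trig_bounded p : trig p -> exists C, forall x, cabs (p x) <= C.
Proof.
elim=> [n|p1 p2 _ [C1 t1] _ [C2 t2]|c p1 _ [C t1]].
- by exists 1 => x; rewrite cabs_expi.
- by exists (C1 + C2) => x; rewrite (le_trans (cabsD _ _))// lerD.
- by exists (cabs c * C) => x; rewrite cabsM ler_wpM2l// cabs_ge0.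
Qed.

Lemma mD : measurable D.
Proof. exact: measurable_itv. Qed.

Lemma L2_resD (p : R -> R[i]) (C : R) : cmeas p -> (forall x, cabs (p x) <= C) -> L2 (res D p).
Proof.
move=> mp pC; apply: (@L2_dom _ _ (fun x => C ^+ 2 * \1_D x)).
- by apply: cmeas_res => //; exact: mD.
- move=> x; rewrite cabsM cabs_real exprMn mulrC indicE.
  case: (x \in D) => /=; last by rewrite normr0 expr0n !mulr0.
  rewrite normr1 expr1n !mulr1 ler_pXn2r ?nnegrE ?cabs_ge0//.
  by rewrite (le_trans _ (pC x))// cabs_ge0.
- exact: (integrableZl measurableT _ (integrable_indic_itv _ _ _ _)).
Qed.

Definition bchar n := res D (echar n).

Lemma L2_bchar n : L2 (bchar n).
Proof. by apply: (@L2_resD _ 1); [exact: cmeas_echar|move=> x; rewrite cabs_expi]. Qed.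

Variable G : R -> R[i].
Hypothesis G2 : L2 G.
Hypothesis GD : forall x, ~ D x -> G x = 0.
Hypothesis Gperp : forall n, inner G (bchar n) = 0.

Let GresE p x : G x * p x = G x * res D p x.
Proof.
by have [Dx|Dx] := pselect (D x); [rewrite res_in|rewrite GD// !mul0r].
Qed.

Let cigr_Gtrig p : trig p -> cigr (fun x => G x * p x).
Proof.
move=> tp; have [C pC] := trig_bounded tp.
under eq_fun do rewrite GresE; apply: cigrM => //.
by apply: L2_resD pC; exact: trig_meas.
Qed.

Let Gtrig p : trig p -> cint (fun x => G x * p x) = 0.
Proof.
elim=> [n|p1 p2 t1 i1 t2 i2|c p1 t1 i1].
- rewrite -(Gperp (- n)) /inner; congr cintegral; apply/funext => x.
  rewrite GresE; have [Dx|Dx] := pselect (D x); last by rewrite GD// !mul0r.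
  by rewrite /bchar !res_in// echarN conjCK.
- under eq_fun do rewrite mulrDr; rewrite cintD ?i1 ?i2 ?addr0//; exact: cigr_Gtrig.
- under eq_fun do rewrite mulrCA; rewrite cintZ ?i1 ?mulr0//; exact: cigr_Gtrig.
Qed.

Lemma cigr_of_L2 : cigr G.
Proof.
have := cigr_Gtrig (trig_cst 1); by under eq_fun do rewrite mulr1.
Qed.

(* s < 1/2 inside (a, b) and s > 1/2 on the rest of the period *)
Let s (b x : R) : R :=
  2^-1 - 4^-1 * (cos (kap * (x - (a + b) / 2)) - cos (kap * ((b - a) / 2))).

Let s01 b x : 0 <= s b x <= 1.
Proof.
rewrite /s; set u := cos _; set v := cos (kap * ((b - a) / 2)).
have := cos_geN1 (kap * (x - (a + b) / 2)); have := cos_le1 (kap * (x - (a + b) / 2)).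
have := cos_geN1 (kap * ((b - a) / 2)); have := cos_le1 (kap * ((b - a) / 2)).
rewrite -/u -/v => *; apply/andP; split; lra.
Qed.

Let kap0 : 0 < kap. Proof. by rewrite divr_gt0// mulr_gt0// pi_gt0. Qed.

Let kapL : kap * L = 2 * pi. Proof. by rewrite divfK// gt_eqF. Qed.

Let cos_lt (x y : R) : 0 <= x -> x < y -> y <= pi -> cos y < cos x.
Proof.
move=> x0 xy ypi; rewrite ltr_cos// in_itv/=; apply/andP; split => //.
  by rewrite (le_trans _ ypi)// ltW.
by rewrite (le_trans x0)// ltW.
Qed.

(** Cosine decreases on [[0, pi]], so s compares the distance from x to the midpoint of [(a, b)]
    with half the length of that interval. *)
Let s_in b x : a < b -> b < a + L -> a < x < b -> s b x < 2^-1.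
Proof.
move=> ab bL /andP[ax xb].
have K (u v : R) : u < v -> kap * u < kap * v by move=> uv; rewrite ltr_pM2l.
have d1 : kap * ((b - a) / 2) <= pi.
  have := K ((b - a) / 2) (L / 2).
  rewrite (_ : kap * (L / 2) = (kap * L) / 2); last by ring.
  rewrite kapL; lra.
suff : cos (kap * ((b - a) / 2)) < cos (kap * (x - (a + b) / 2)) by rewrite /s; lra.
have [xc|cx] := leP (x - (a + b) / 2) 0.
  rewrite -[ltRHS]cosN -mulrN; apply: cos_lt => //.
    by rewrite mulr_ge0 ?(ltW kap0)//; lra.
  by apply: K; lra.
apply: cos_lt => //; first by rewrite mulr_ge0 ?(ltW kap0)//; lra.
by apply: K; lra.
Qed.

Let s_out b x : a < b -> b < a + L -> b < x < a + L -> 2^-1 < s b x.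
Proof.
move=> ab bL /andP[bx xL].
have K (u v : R) : u < v -> kap * u < kap * v by move=> uv; rewrite ltr_pM2l.
have d0 : 0 <= kap * ((b - a) / 2) by rewrite mulr_ge0 ?(ltW kap0)//; lra.
suff : cos (kap * (x - (a + b) / 2)) < cos (kap * ((b - a) / 2)) by rewrite /s; lra.
have t1 : kap * ((b - a) / 2) < kap * (x - (a + b) / 2) by apply: K; lra.
have t2 : kap * (x - (a + b) / 2) < 2 * pi - kap * ((b - a) / 2).
  rewrite (_ : 2 * pi - _ = kap * (L - (b - a) / 2)); last by rewrite mulrBr kapL.
  by apply: K; lra.
have [tp|tp] := leP (kap * (x - (a + b) / 2)) pi; first exact: cos_lt.
(* Beyond [pi] the angle is replaced by [2 * pi] minus itself, which has the same cosine. *)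
rewrite -[ltLHS]cosN -[ltLHS]cosD2pi; apply: cos_lt => //; rewrite -mulr_natl; lra.
Qed.

Let trig_step b n : trig (fun x => (step_poly n (s b x))%:C).
Proof.
pose v := cos (kap * ((b - a) / 2)).
have ts : trig (fun x => (s b x)%:C).
  rewrite (_ : (fun x => _) = (fun x => (2^-1 + 4^-1 * v)%:C +
      (- 4^-1)%:C * (cos (kap * (x - (a + b) / 2)))%:C)).
    by apply: trigD; [exact: trig_cst|apply: trigZ; exact: trig_cos].
  by apply/funext => x; rewrite -rmorphM -rmorphD/=; congr (_%:C); rewrite /s -/v; ring.
rewrite (_ : (fun x => _) = (fun x => (1 + -1 * (s b x)%:C ^+ n) ^+ (2 ^ n))).
  by apply: trigX; apply: trigD; [exact: trig_cst|apply: trigZ; exact: trigX].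
by apply/funext => x; rewrite /step_poly rmorphXn rmorphB rmorphXn mulN1r.
Qed.

(** Dominated convergence along the step polynomials shows that r has integral 0 over every
    half-line []-oo, y]]; its primitive is then constant, and r is almost everywhere the derivative
    of its primitive. *)
Let real_part_vanishes (r : R -> R) : mu.-integrable setT (EFin \o r) ->
  (forall x, ~ D x -> r x = 0) ->
  (forall p : R -> R, trig (fun x => (p x)%:C) -> \int[mu]_x (r x * p x) = 0) ->
  {ae mu, forall x, r x = 0}.
Proof.
move=> ir rD rp.
have mr : measurable_fun setT r by have /measurable_int/measurable_EFinP := ir.
have mry y : measurable_fun setT (r \_ `]-oo, y]).
  apply/(measurable_restrictT r) => //; exact: measurable_funS mr.
have mstep y n : measurable_fun setT (fun x => step_poly n (s y x)).
  by have [] := trig_meas (trig_step y n).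
have F0 y : \int[mu]_(x in `]-oo, y]) r x = 0.
  rewrite Rintegral_mkcond.
  have [ya|ay] := leP y a.
    rewrite (@ae_eq_Rintegral _ (fun=> 0))//; first by rewrite Rintegral_cst// mul0r.
    apply: aeS (ae_neq a) => x xa; rewrite patchE; case: ifPn => //.
    rewrite inE/= in_itv/= => xy; apply: rD; rewrite /= in_itv/= => /andP[ax _].
    by apply: xa; apply/eqP; rewrite eq_le ax andbT (le_trans xy).
  (* The half-line contains the whole period, and the constant 1 is itself a trigonometric
     polynomial. *)
  have [Ly|yL] := leP (a + L) y.
    rewrite -(rp (fun=> 1) (trig_cst 1)); apply: eq_Rintegral => x _.
    rewrite mulr1 patchE; case: ifPn => //; rewrite notin_setE/= in_itv/= => /negP.
    rewrite -ltNge => yx; apply/esym/rD; rewrite /= in_itv/= => /andP[_].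
    by rewrite ltNge (le_trans Ly)// ltW.
  have [] := @dominated_convergence _ _ _ mu setT measurableT
    (fun n x => (r x * step_poly n (s y x))%:E) (EFin \o (r \_ `]-oo, y]))
    (fun x => `|r x|%:E).
  - by move=> n; apply/measurable_EFinP; apply: measurable_funM => //; exact: mstep.
  - by apply/measurable_EFinP; exact: mry.
  (* At [a] and at [y] the value of s is 1/2, where the step polynomials tend neither to 0 nor to
     1. *)
  - apply: (aeS2 _ (ae_neq a) (ae_neq y)) => x xa xy _.
    apply: cvg_EFin; first by apply: nearW.
    rewrite patchE; have [Dx|Dx] := pselect (D x); last first.
      by rewrite rD// if_same; under eq_fun do rewrite /= mul0r; exact: cvg_cst.
    have /andP[ax xL] : a <= x < a + L by move: Dx; rewrite /= in_itv.
    have ax' : a < x by rewrite lt_neqAle ax andbT eq_sym; apply/eqP.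
    case: ifPn => [|].
      rewrite inE/= in_itv/= => xley.
      have xlty : x < y by rewrite lt_neqAle xley andbT; apply/eqP.
      rewrite -[X in _ --> X]mulr1; apply: cvgMl_tmp; apply: step_poly_cvg1.
        by have /andP[] := s01 y x.
      by apply: s_in => //; apply/andP.
    rewrite notin_setE/= in_itv/= => /negP; rewrite -ltNge => yx.
    rewrite -[X in _ --> X](mulr0 (r x)); apply: cvgMl_tmp; apply: step_poly_cvg0.
      by have /andP[] := s01 y x.
    by apply: s_out => //; apply/andP.
  - exact: integrable_norm.
  - apply: nearW => x n _; rewrite lee_fin normrM ler_piMr//; apply: step_poly_bound; exact: s01.
  move=> ig _; rewrite -[X in _ --> X](fineK (integrable_fin_num measurableT ig)).
  move=> /fine_cvgP[_]; set u := (X in X @ _ --> _ -> _) => H.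
  have u0 : u = (fun=> 0).
    apply/funext => n; rewrite /u/= -[LHS]/(\int[mu]_x (r x * step_poly n (s y x))).
    exact/rp/trig_step.
  move: H; rewrite u0 => H.
  by apply/esym/(cvg_unique (@Rhausdorff R) _ H); exact: cvg_cst.
(* Lebesgue differentiation of the zero primitive. *)
have loc : locally_integrable setT r by exact: open_integrable_locally openT ir.
have iry y : mu.-integrable `]-oo, y] (EFin \o r) by exact: integrableS ir.
have /= := FTC1Ny iry loc.
apply: aeS => x [_]; rewrite (_ : (fun _ => _) = fun=> 0); first by rewrite derive1_cst.
by apply/funext => y; exact: F0.
Qed.

(** Real trigonometric polynomials test the real and the imaginary part of G separately. *)
Lemma trig_uniqueness : {ae mu, forall x, G x = 0}.
Proof.
have [i1 i2] := cigr_of_L2.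
have rp (p : R -> R) : trig (fun x => (p x)%:C) ->
    \int[mu]_x (complex.Re (G x) * p x) = 0 /\ \int[mu]_x (complex.Im (G x) * p x) = 0.
  move=> /Gtrig; rewrite /cintegral => -[H1 H2]; split.
    by rewrite -{}[RHS]H1; apply: eq_Rintegral => x _; case: (G x) => u v /=; ring.
  by rewrite -{}[RHS]H2; apply: eq_Rintegral => x _; case: (G x) => u v /=; ring.
have := @real_part_vanishes (fun x => complex.Im (G x)) i2.
have := @real_part_vanishes (fun x => complex.Re (G x)) i1.
move=> h1 h2; apply: (aeS2 _ (h1 _ _) (h2 _ _)).
- by move=> x; case: (G x) => u v /= -> ->.
- by move=> x /GD ->.
- by move=> p /rp[].
- by move=> x /GD ->.
- by move=> p /rp[].
Qed.

End TrigonometricUniqueness.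

(** * Symmetric partial sums over the integers *)

Section SymmetricSums.

(** Indexed like the partial sums in [synthesis], so that the two agree by conversion. *)
Definition symsum (V : zmodType) (M : nat) (g : int -> V) : V :=
  \sum_(0 <= k < (2 * M).+1) g (k%:Z - M%:Z).

Lemma symsumS (V : zmodType) (M : nat) (g : int -> V) :
  symsum M.+1 g = symsum M g + g (M.+1)%:Z + g (- (M.+1)%:Z).
Proof.
rewrite /symsum mulnS add2n big_nat_recr//= big_nat_recl//= sub0r.
rewrite (_ : (2 * M).+2%:Z - M.+1%:Z = M.+1%:Z); last by lia.
rewrite -[RHS]addrA [in RHS](addrC (g _)) addrA; congr (_ + _); rewrite addrC; congr (_ + _).
by apply: eq_bigr => k _; congr g; lia.
Qed.

Lemma symsum0 (V : zmodType) (g : int -> V) : symsum 0 g = g 0.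
Proof. by rewrite /symsum muln0 big_nat1 subr0. Qed.

Lemma symsum_delta (V : zmodType) (M : nat) (m : int) (c : V) :
  symsum M (fun n => if n == m then c else 0) = if (`|m| <= M)%N then c else 0.
Proof.
elim: M => [|M ih].
  rewrite symsum0 (_ : (`|m| <= 0)%N = (0 == m))//; lia.
rewrite symsumS ih.
have [mM|mM] := leqP `|m| M.
  rewrite (_ : (`|m| <= M.+1)%N = true); last by lia.
  rewrite (_ : (M.+1%:Z == m) = false); last by lia.
  rewrite (_ : (- M.+1%:Z == m) = false); last by lia.
  by rewrite !addr0.
have [mE|m1] := eqVneq (M.+1%:Z) m.
  rewrite (_ : (- M.+1%:Z == m) = false); last by lia.
  rewrite (_ : (`|m| <= M.+1)%N = true); last by lia.
  by rewrite add0r addr0.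
have [mE|m2] := eqVneq (- M.+1%:Z) m.
  rewrite (_ : (`|m| <= M.+1)%N = true); last by lia.
  by rewrite add0r add0r.
by rewrite (_ : (`|m| <= M.+1)%N = false) ?addr0//; lia.
Qed.

Lemma eq_symsum (V : zmodType) (M : nat) (g g' : int -> V) :
  (forall n, (`|n| <= M)%N -> g n = g' n) -> symsum M g = symsum M g'.
Proof.
move=> gg; rewrite /symsum; apply: eq_big_nat => k /andP[_ kM]; apply: gg; lia.
Qed.

Lemma symsum_cut (V : zmodType) (M M' : nat) (g : int -> V) : (M <= M')%N ->
  symsum M' (fun n => if (`|n| <= M)%N then g n else 0) = symsum M g.
Proof.
move=> /subnK <-; elim: (M' - M)%N => [|k ih].
  by rewrite add0n; apply: eq_symsum => n ->.
rewrite addSn symsumS ih (_ : (`|(k + M).+1%:Z| <= M)%N = false); last by lia.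
by rewrite !addr0.
Qed.

(** The enumeration 0, 1, -1, 2, -2, ...: its first [2 M + 1] values are the integers of absolute
    value at most M, which makes a symmetric sum a partial sum of an ordinary series. *)
Definition zigzag (k : nat) : int :=
  if odd k then (k./2.+1)%:Z else - (k./2)%:Z.

Definition zagzig (z : int) : nat :=
  match z with Posz 0 => 0%N | Posz n.+1 => n.*2.+1 | Negz n => n.*2.+2 end.

Lemma zigzagK : cancel zigzag zagzig.
Proof.
move=> k; rewrite /zigzag; case: ifPn => ok.
  rewrite /= -[RHS](odd_double_half k) ok/= add1n//.
rewrite -[RHS](odd_double_half k) (negbTE ok) add0n.
by case: (k./2) => [|j]//=.
Qed.

Lemma zagzigK : cancel zagzig zigzag.
Proof.
case=> [[|n]|n] //=; rewrite /zigzag/= odd_double/=.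
  by rewrite uphalf_double.
by rewrite doubleK NegzE.
Qed.

Lemma symsum_zigzag (V : zmodType) (M : nat) (g : int -> V) :
  symsum M g = \sum_(0 <= k < (2 * M).+1) g (zigzag k).
Proof.
elim: M => [|M ih]; first by rewrite symsum0 muln0 big_nat1 /zigzag/= oppr0.
rewrite symsumS ih mulnS add2n [RHS]big_nat_recr//= [in RHS]big_nat_recr//=.
congr (_ + g _ + g _).
  by rewrite /zigzag mul2n/= odd_double/= uphalf_double.
by rewrite /zigzag mul2n/= odd_double/= doubleK.
Qed.

Context {R : realType}.

Lemma esum_symsum (a : int -> R) : (forall n, 0 <= a n) ->
  (fun M => (symsum M a)%:E) @ \oo --> (\esum_(n in [set: int]) (a n)%:E)%E.
Proof.
move=> a0.
have -> : (\esum_(n in [set: int]) (a n)%:E = \sum_(0 <= k <oo) (a (zigzag k))%:E)%E.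
  rewrite nneseries_esumT; last by move=> n; rewrite lee_fin.
  apply: (@reindex_esum _ _ _ setT setT zigzag).
  rewrite setTT_bijective; exists zagzig; [exact: zigzagK|exact: zagzigK].
have H : (fun n => (\sum_(0 <= k < n) (a (zigzag k))%:E)%E) @ \oo -->
    (\sum_(0 <= k <oo) (a (zigzag k))%:E)%E.
  by apply: is_cvg_nneseries => k _ _; rewrite lee_fin.
under eq_fun do rewrite symsum_zigzag -sumEFin.
apply: (cvg_comp _ _ _ H) => //.
by move=> A [N _ NA]; exists N => // n /= Nn; apply: NA => /=; lia.
Qed.

Lemma symsum_nondecreasing (a : int -> R) : (forall n, 0 <= a n) ->
  nondecreasing_seq (fun M => symsum M a).
Proof.
by move=> a0; apply/nondecreasing_seqP => M; rewrite symsumS -addrA lerDl addr_ge0.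
Qed.

Lemma esum_symsum_lim (a : int -> R) (l : R) : (forall n, 0 <= a n) ->
  (fun M => symsum M a) @ \oo --> l -> (\esum_(n in [set: int]) (a n)%:E = l%:E)%E.
Proof.
move=> a0 al; have H := esum_symsum a0.
by apply: (cvg_unique _ H) => //; apply: cvg_EFin => //; exact: nearW.
Qed.

End SymmetricSums.

(** * Parseval's identity on one period *)

Section FourierSeries.
Context {R : realType}.
Local Notation mu := (@lebesgue_measure R).

Let FTC (F f : R -> R) (a b : R) : a < b -> (forall x : R, is_derive x 1 F (f x)) ->
  continuous f -> \int[mu]_(x in `[a, b[) f x = F b - F a.
Proof.
move=> ab dF cf.
have cF x : F @ x --> F x.
  apply: differentiable_continuous; apply/derivable1_diffP; exact: ex_derive.
rewrite Rintegral_itv_bndo_bndc; last first.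
  apply: (@integrableS _ _ R mu `[a, b]%classic) => //.
    by apply: subset_itvl; rewrite bnd_simp.
  apply: continuous_compact_integrable; first exact: segment_compact.
  exact: continuous_subspaceT.
rewrite /Rintegral (@continuous_FTC2 _ f F)//.
- exact: continuous_subspaceT.
- split.
  + by move=> x _; exact: ex_derive.
  + exact: cvg_at_right_filter.
  + exact: cvg_at_left_filter.
- by move=> x _; rewrite derive1E; exact: derive_val.
Qed.

Lemma cintegral_expi (a L k : R) : 0 < L -> k != 0 -> expi (L * k) = 1 :> R[i] ->
  cintegral `[a, a + L[ (fun x => expi (x * k)) = 0.
Proof.
move=> L0 k0 Lk; have aL : a < a + L by rewrite ltrDl.
rewrite /cintegral /expi/=.
have dsin (x : R) : is_derive x 1 (fun x => k^-1 * sin (x * k)) (cos (x * k)).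
  by apply: is_derive_eq; rewrite scaler0 add0r /GRing.scale/= mulr1 mulrCA mulVf// mulr1.
have dcos (x : R) : is_derive x 1 (fun x => - k^-1 * cos (x * k)) (sin (x * k)).
  apply: is_derive_eq; rewrite scaler0 add0r /GRing.scale/= mulr1.
  by rewrite mulNr mulrCA mulVf// mulr1 opprK.
have /eqP : expi ((a + L) * k) = expi (a * k) :> R[i] by rewrite mulrDl expiD Lk mulr1.
rewrite eq_complex /expi/= => /andP[/eqP Ec /eqP Es].
rewrite (FTC aL dsin) ?(FTC aL dcos) ?Es ?Ec ?subrr//.
- by move=> x; apply: continuous_comp; [exact: mulrr_continuous|exact: continuous_sin].
- by move=> x; apply: continuous_comp; [exact: mulrr_continuous|exact: continuous_cos].
Qed.

Variables (a L : R).
Hypothesis L0 : 0 < L.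
Local Notation D := (`[a, a + L[%classic : set R).
Local Notation kap := (2 * pi / L).
Local Notation e := (bchar a L).

Lemma inner_bchar m n : inner (e m) (e n) = if m == n then L%:C else 0.
Proof.
have -> : inner (e m) (e n) = cintegral D (fun x => expi (x * ((m - n)%:~R * kap))).
  rewrite cint_res /inner; congr cintegral; apply/funext => x.
  have [Dx|Dx] := pselect (D x); last by rewrite /bchar !res_out// mul0r.
  by rewrite /bchar !res_in// -echarN -echarD.
have [->|mn] := eqVneq m n.
  rewrite subrr /cintegral; under eq_Rintegral do rewrite mul0r mulr0 expi0.
  under [in X in _ +i* X]eq_Rintegral do rewrite mul0r mulr0 expi0/=.
  rewrite !Rintegral_cst//= mul0r mul1r lebesgue_measure_itv/= lte_fin ltrDl L0/=.
  by rewrite [a + L]addrC addrK.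
apply: cintegral_expi => //.
  by rewrite mulf_neq0 ?intr_eq0 ?subr_eq0// gt_eqF// divr_gt0// mulr_gt0// pi_gt0.
rewrite -[RHS]expi0 -(expi_periodic 0 (m - n)) add0r; congr expi.
by field; rewrite gt_eqF.
Qed.

Variable G : R -> R[i].
Hypothesis G2 : L2 G.

Definition fcoef n := inner G (e n).

(** The factor [L^-1] is there because the characters are not normalized: each has squared norm L on
    the period. *)
Definition fpartial M (x : R) : R[i] := L^-1%:C * symsum M (fun n => fcoef n * e n x).

Lemma L2_fpartial M : L2 (fpartial M).
Proof. by apply: L2Z; apply: L2_sum => k; apply: L2Z; exact: L2_bchar. Qed.

Lemma inner_fpartial M f : L2 f ->
  inner (fpartial M) f = L^-1%:C * symsum M (fun n => fcoef n * inner (e n) f).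
Proof.
move=> f2; have e2 n : L2 (e n) by exact: L2_bchar.
rewrite /fpartial /symsum innerZl//; last by apply: L2_sum => k; exact: L2Z.
rewrite inner_suml//; last by move=> k; exact: L2Z.
by congr (_ * _); apply: eq_bigr => k _; rewrite innerZl.
Qed.

Lemma inner_fpartial_bchar M m : (`|m| <= M)%N -> inner (fpartial M) (e m) = fcoef m.
Proof.
move=> mM; rewrite inner_fpartial; last exact: L2_bchar.
rewrite (@eq_symsum _ _ _ (fun n => if n == m then fcoef m * L%:C else 0)).
  rewrite symsum_delta mM mulrCA -rmorphM/= mulVf ?gt_eqF//; exact: mulr1.
by move=> n _; rewrite inner_bchar; case: eqVneq => [->//|_]; rewrite mulr0.
Qed.

Local Notation S M := (symsum M (fun n => cabs (fcoef n) ^+ 2)).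

Lemma nn_fpartial_cross M M' : (M <= M')%N ->
  inner (fpartial M) (fpartial M') = (L^-1 * S M)%:C.
Proof.
move=> MM; rewrite inner_fpartial; last exact: L2_fpartial.
rewrite rmorphM; congr (_ * _).
rewrite (@eq_symsum _ _ _ (fun n => (cabs (fcoef n) ^+ 2)%:C)).
  by rewrite /symsum rmorph_sum.
move=> n nM; rewrite innerC; [|exact: L2_fpartial|exact: L2_bchar].
by rewrite inner_fpartial_bchar ?(leq_trans nM)// mulJ_cabs2.
Qed.

Lemma nn_fpartial M : nn (fpartial M) = L^-1 * S M.
Proof. by have := nn_fpartial_cross (leqnn M); rewrite innerff => -[]. Qed.

Lemma inner_G_fpartial M : inner G (fpartial M) = (L^-1 * S M)%:C.
Proof.
rewrite innerC ?inner_fpartial//; last exact: L2_fpartial.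
rewrite (@eq_symsum _ _ _ (fun n => (cabs (fcoef n) ^+ 2)%:C)).
  rewrite /symsum -rmorph_sum -rmorphM/=.
  by apply/eqP; rewrite eq_complex/= oppr0 !eqxx.
by move=> n _; rewrite innerC//; [rewrite mulJ_cabs2|exact: L2_bchar].
Qed.

Lemma nn_G_fpartial M : nn (fun x => G x - fpartial M x) = nn G - L^-1 * S M.
Proof.
rewrite nnB//; last exact: L2_fpartial.
by rewrite nn_fpartial inner_G_fpartial/=; ring.
Qed.

Lemma bessel M : S M <= L * nn G.
Proof.
have := nn_ge0 (fun x => G x - fpartial M x).
by rewrite nn_G_fpartial subr_ge0 mulrC ler_pdivrMr// mulrC.
Qed.

Hypothesis GD : forall x, ~ D x -> G x = 0.

Lemma S_nondecreasing : nondecreasing_seq (fun M => S M).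
Proof. by apply: symsum_nondecreasing => n; rewrite sqr_ge0. Qed.

(** Bessel's inequality makes the Fourier partial sums Cauchy. Their limit H has the same
    coefficients as G, so uniqueness identifies the two on D, and the defect [nn G - L^-1 * S M] in
    Bessel's inequality tends to 0. *)
Lemma parseval : (fun M => S M) @ \oo --> L * nn G.
Proof.
have Scvg : cvgn (fun M => S M).
  apply: nondecreasing_is_cvgn; first exact: S_nondecreasing.
  by exists (L * nn G) => _ [M _ <-]; exact: bessel.
have [H HL] : exists H, is_L2lim fpartial H.
  apply: L2_complete => [M|eps eps0]; first exact: L2_fpartial.
  have /cauchy_cvgP/cauchy_ballP := Scvg.
  have Leps : 0 < L * eps by rewrite mulr_gt0.
  move=> /(_ _ Leps) [[A B] /= [[N1 _ A1] [N2 _ A2]] AB].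
  have key m n : (maxn N1 N2 <= m)%N -> (m <= n)%N ->
      nn (fun x => fpartial m x - fpartial n x) <= eps.
    move=> Nm mn.
    rewrite nnB; [|exact: L2_fpartial..].
    rewrite nn_fpartial_cross// !nn_fpartial/=.
    have : ball (S m) (L * eps) (S n).
      by apply: (AB (_, _)); split; [apply: A1|apply: A2]; rewrite /=; lia.
    rewrite /ball/= distrC ger0_norm ?subr_ge0 ?S_nondecreasing// => H.
    rewrite (_ : _ - _ = L^-1 * (S n - S m)); last by ring.
    by rewrite mulrC ler_pdivrMr// mulrC ltW.
  exists (maxn N1 N2) => m n Nm Nn.
  have [mn|nm] := leqP m n; first exact: key.
  rewrite nn_BC; [|exact: L2_fpartial..]; apply: key => //; exact: ltnW.
have [H2 HS] := (is_L2limP _ L2_fpartial).1 HL.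
have He n : inner H (e n) = fcoef n.
  apply: (inner_lim L2_fpartial HL); first exact: L2_bchar.
  by exists `|n|%N => // M /= nM; exact: inner_fpartial_bchar.
have mDD : measurable D by exact: measurable_itv.
have GH : {ae mu, forall x, G x - res D H x = 0}.
  apply: (@trig_uniqueness _ a L L0 (fun x => G x - res D H x)).
  - by apply: L2B => //; exact: L2_res.
  - by move=> x Dx; rewrite GD// res_out// subrr.
  - move=> n; rewrite innerBl//; [|exact: L2_res|exact: L2_bchar].
    suff -> : inner (res D H) (e n) = inner H (e n) by rewrite He subrr.
    rewrite /inner; congr cintegral; apply/funext => x.
    have [Dx|Dx] := pselect (D x); first by rewrite res_in.
    by rewrite /bchar !res_out// !(mul0r, conjC0, mulr0).
(* Only an inequality: off D both G and the partial sums vanish, while no value of H is known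
   there. *)
have H1 M : nn (fun x => G x - fpartial M x) <= nn (fun x => fpartial M x - H x).
  rewrite -lee_fin -!e2E; [|by apply: L2B => //; exact: L2_fpartial..].
  apply: ae_ge0_le_integral => //.
  - by move=> x _; rewrite lee_fin sqr_ge0.
  - by apply: measurable_cabs2E; apply: L2_meas; apply: L2B => //; exact: L2_fpartial.
  - by move=> x _; rewrite lee_fin sqr_ge0.
  - by apply: measurable_cabs2E; apply: L2_meas; apply: L2B => //; exact: L2_fpartial.
  apply: aeS GH => x /eqP; rewrite subr_eq0 => /eqP Gx _; rewrite lee_fin.
  have [Dx|Dx] := pselect (D x).
    by rewrite Gx res_in// -cabsN opprB.
  rewrite GD// (_ : fpartial M x = 0) ?subrr ?cabs0 ?expr0n ?sqr_ge0//.
  rewrite /fpartial /symsum big1 ?mulr0// => k _.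
  by rewrite /bchar res_out// mulr0.
have H3 : (fun M => nn G - L^-1 * S M) @ \oo --> (0 : R).
  apply: (squeeze_cvgr _ _ HS); last exact: cvg_cst.
  by apply: nearW => M; rewrite -nn_G_fpartial nn_ge0 H1.
have : (fun M => L * (nn G - (nn G - L^-1 * S M))) @ \oo --> L * (nn G - 0).
  by apply: cvgMl_tmp; apply: cvgB => //; exact: cvg_cst.
rewrite subr0 (_ : (fun M => L * _) = (fun M => S M))//.
by apply/funext => M; field; rewrite gt_eqF.
Qed.

Lemma parseval_esum :
  (\esum_(n in [set: int]) (cabs (fcoef n) ^+ 2)%:E = (L * nn G)%:E)%E.
Proof. by apply: esum_symsum_lim parseval => n; rewrite sqr_ge0. Qed.

End FourierSeries.

(** * The Fourier transform and Plancherel's theorem *)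

Section FourierCompact.
Context {R : realType}.
Local Notation mu := (@lebesgue_measure R).
Implicit Types (f g : R -> R[i]).

Definition FT g (xi : R) : R[i] :=
  ((Num.sqrt (2 * pi))^-1)%:C * cint (fun t => g t * expi (- (t * xi))).

(** For these functions the transform is a genuine integral, and the support fits into one period of
    a Fourier series. *)
Definition csupp g := L2 g /\ exists2 T : R, 0 < T & forall x, T <= `|x| -> g x = 0.

Lemma cigr_bounded f g (C : R) : cigr f -> cmeas g -> (forall x, cabs (g x) <= C) ->
  cigr (fun x => f x * g x).
Proof.
move=> fi mg gC; apply: (@cigr_dom _ _ (fun x => C * cabs (f x))).
- by apply: cmeasM => //; exact: cigr_meas.
- by move=> x; rewrite cabsM mulrC ler_wpM2r ?cabs_ge0.
- exact: (integrableZl measurableT C (cigr_cabs fi)).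
Qed.

Lemma csupp_off (T x : R) : 0 < T -> ~ (`[- T, - T + 2 * T[%classic : set R) x -> T <= `|x|.
Proof.
move=> T0; rewrite /= in_itv/= => H; rewrite leNgt; apply/negP; rewrite ltr_norml => /andP[H1 H2].
by apply: H; rewrite (ltW H1)/=; lra.
Qed.

Lemma csupp_cigr g : csupp g -> cigr g.
Proof.
move=> [g2 [T T0 gT]]; apply: (@cigr_of_L2 _ (- T) (2 * T)) => //.
by move=> x /(csupp_off T0); exact: gT.
Qed.

Lemma csuppD f g : csupp f -> csupp g -> csupp (fun x => f x + g x).
Proof.
move=> [f2 [T T0 fT]] [g2 [S S0 gS]]; split; first exact: L2D.
exists (Num.max T S); first by rewrite lt_max T0.
by move=> x; rewrite ge_max => /andP[/fT -> /gS ->]; rewrite addr0.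
Qed.

Lemma csupp_mul f (p : R -> R[i]) (C : R) : cmeas p -> (forall x, cabs (p x) <= C) ->
  csupp f -> csupp (fun x => p x * f x).
Proof.
move=> mp pC [f2 [T T0 fT]]; split; first exact: (L2_bounded_mul mp pC).
by exists T => // x /fT ->; rewrite mulr0.
Qed.

Lemma csuppZ c f : csupp f -> csupp (fun x => c * f x).
Proof. by apply: (@csupp_mul _ _ (cabs c)) => //; exact: cmeas_cst. Qed.

Lemma csuppB f g : csupp f -> csupp g -> csupp (fun x => f x - g x).
Proof.
move=> cf cg; apply: csuppD => //; under eq_fun do rewrite -mulN1r; exact: csuppZ.
Qed.

Lemma csuppJ f : csupp f -> csupp (fun x => (f x)^*).
Proof.
move=> [f2 [T T0 fT]]; split; first exact: L2J.
by exists T => // x /fT ->; rewrite conjC0.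
Qed.

Lemma cmeas_expiM (u : R -> R) : measurable_fun setT u -> cmeas (fun t => expi (u t)).
Proof. by move=> mu_; exact: (cmeas_comp mu_ cmeas_expi). Qed.

Lemma cmeas_echr (xi : R) : cmeas (fun t => expi (- (t * xi))).
Proof. by apply: cmeas_expiM; apply: measurableT_comp => //; exact: measurable_funM. Qed.

Lemma cigr_echr f (xi : R) : cigr f -> cigr (fun t => f t * expi (- (t * xi))).
Proof.
move=> fi; apply: (@cigr_bounded _ _ 1) => //; first exact: cmeas_echr.
by move=> x; rewrite cabs_expi.
Qed.

Lemma FTD f g xi : cigr f -> cigr g -> FT (fun x => f x + g x) xi = FT f xi + FT g xi.
Proof.
move=> fi gi; rewrite /FT -mulrDr -cintD; [|exact: cigr_echr..].
by congr (_ * cintegral _ _); apply/funext => t; rewrite mulrDl.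
Qed.

Lemma FTZ c f xi : cigr f -> FT (fun x => c * f x) xi = c * FT f xi.
Proof.
move=> fi; rewrite /FT.
have -> : cint (fun t => c * f t * expi (- (t * xi))) = c * cint (fun t => f t * expi (- (t * xi))).
  by rewrite -cintZ; [congr cintegral; apply/funext => t; rewrite mulrA|exact: cigr_echr].
by rewrite mulrCA.
Qed.

Let Re_echr g t (xi : R) : complex.Re (g t * expi (- (t * xi))) =
  complex.Re (g t) * cos (- (t * xi)) - complex.Im (g t) * sin (- (t * xi)).
Proof. by rewrite ReM. Qed.

Let Im_echr g t (xi : R) : complex.Im (g t * expi (- (t * xi))) =
  complex.Re (g t) * sin (- (t * xi)) + complex.Im (g t) * cos (- (t * xi)).
Proof. by rewrite ImM. Qed.

Let lin_cont (t : R) : continuous (fun xi : R => - (t * xi)).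
Proof. by move=> x; apply: continuousN; exact: mulrl_continuous. Qed.

Let cos_cont (t : R) : continuous (fun xi : R => cos (- (t * xi))).
Proof. by move=> x; apply: continuous_comp; [exact: lin_cont|exact: continuous_cos]. Qed.

Let sin_cont (t : R) : continuous (fun xi : R => sin (- (t * xi))).
Proof. by move=> x; apply: continuous_comp; [exact: lin_cont|exact: continuous_sin]. Qed.

Let continuous_param (F : R -> R -> R) (g : R -> R) :
  (forall x, mu.-integrable setT (EFin \o F x)) -> (forall y, continuous (F ^~ y)) ->
  mu.-integrable setT (EFin \o g) -> (forall x y, `|F x y| <= g y) ->
  continuous (fun x => \int[mu]_y F x y).
Proof.
move=> iF cF ig Fg x.
have xI : x \in `]x - 1, x + 1[ by rewrite in_itv/=; apply/andP; split; lra.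
apply: (@continuity_under_integral _ _ _ mu F setT measurableT (x - 1) (x + 1) _ _ g ig _ x).
- by move=> y _; exact: iF.
- by apply: nearW => y _ z _; exact: cF.
- by move=> y _; apply: nearW => z _; exact: Fg.
- by rewrite inE.
Qed.

(** Dominated convergence under the integral sign makes the transform continuous. *)
Lemma cmeas_FT g : cigr g -> cmeas (FT g).
Proof.
move=> gi; apply: cmeasM; first exact: cmeas_cst.
have gi' xi := cigr_echr xi gi.
have b xi y : cabs (g y * expi (- (y * xi))) <= cabs (g y).
  by rewrite cabsM cabs_expi mulr1.
split; apply: continuous_measurable_fun.
  apply: (continuous_param _ _ (cigr_cabs gi)).
  - by move=> x; case: (gi' x).
  - move=> y x; under eq_fun do rewrite Re_echr.
    by apply: cvgB; apply: cvgMl_tmp; [exact: cos_cont|exact: sin_cont].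
  - by move=> x y; apply: le_trans (b x y); exact: normRe_le_cabs.
apply: (continuous_param _ _ (cigr_cabs gi)).
- by move=> x; case: (gi' x).
- move=> y x; under eq_fun do rewrite Im_echr.
  by apply: cvgD; apply: cvgMl_tmp; [exact: sin_cont|exact: cos_cont].
- by move=> x y; apply: le_trans (b x y); exact: normIm_le_cabs.
Qed.

Section PlancherelCompact.
Variable g : R -> R[i].
Hypothesis g2 : L2 g.
Variable T : R.
Hypothesis T0 : 0 < T.
Hypothesis gT : forall x, T <= `|x| -> g x = 0.

Let kap : R := 2 * pi / (2 * T).

Let kap0 : 0 < kap.
Proof. by rewrite divr_gt0// mulr_gt0// pi_gt0. Qed.

Let gcs : csupp g. Proof. by split => //; exists T. Qed.

(** Up to the factor [sqrt (2 pi)], the samples are the Fourier coefficients on [[-T, T)] of g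
    multiplied by [expi (- (t * s))]. Parseval's identity applies, and the modulation does not
    change the norm, so the sum does not depend on s. *)
Let sample_sum (s : R) :
  (fun M => symsum M (fun n => cabs (FT g (s + n%:~R * kap)) ^+ 2)) @ \oo --> nn g / kap.
Proof.
pose G t := expi (- (t * s)) * g t.
have mG : cmeas (fun t : R => expi (- (t * s))) by exact: cmeas_echr.
have e1 (t : R) : cabs (expi (- (t * s)) : R[i]) <= 1 by rewrite cabs_expi.
have G2 : L2 G by exact: (L2_bounded_mul mG e1).
have nG : nn G = nn g.
  by rewrite /nn /e2; under eq_integral do rewrite cabsM cabs_expi mul1r.
have T20 : 0 < 2 * T by rewrite mulr_gt0.
have GD x : ~ (`[- T, - T + 2 * T[%classic : set R) x -> G x = 0.
  by move=> /(csupp_off T0) /gT; rewrite /G => ->; rewrite mulr0.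
have := parseval T20 G2 GD; rewrite nG => H.
have : (fun M => (2 * pi)^-1 * symsum M (fun n => cabs (fcoef (- T) (2 * T) G n) ^+ 2))
    @ \oo --> (2 * pi)^-1 * (2 * T * nn g) by exact: cvgMl_tmp.
rewrite (_ : _ * (2 * T * nn g) = nn g / kap); last first.
  have T1 : T != 0 by rewrite gt_eqF.
  have p1 : (pi : R) != 0 by rewrite gt_eqF// pi_gt0.
  by move: p1; rewrite /kap; move: (pi : R) => p p1; field; rewrite T1.
rewrite (_ : (fun M => _) = (fun M => symsum M (fun n => cabs (FT g (s + n%:~R * kap)) ^+ 2)))//.
apply/funext => M; rewrite /symsum mulr_sumr; apply: eq_bigr => k _.
set n := k%:Z - M%:Z.
have -> : fcoef (- T) (2 * T) G n = (Num.sqrt (2 * pi))%:C * FT g (s + n%:~R * kap).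
  rewrite /FT mulrA -rmorphM/= divff; last first.
    by rewrite sqrtr_eq0 -ltNge mulr_gt0// pi_gt0.
  rewrite mul1r /fcoef /inner; congr cintegral; apply/funext => t.
  have [Dx|Dx] := pselect ((`[- T, - T + 2 * T[%classic : set R) t); last first.
    by rewrite (GD _ Dx) mul0r gT ?mul0r//; exact: csupp_off.
  rewrite /bchar res_in// /G mulrAC -/kap mulrC; congr (_ * _).
  by rewrite -echarN /echar -expiD; congr expi; rewrite -/kap mulrNz; ring.
rewrite cabsM exprMn cabs_real ger0_norm ?sqrtr_ge0// sqr_sqrtr; last first.
  by rewrite mulr_ge0// ltW// pi_gt0.
by rewrite mulrA mulVf ?mul1r// gt_eqF// mulr_gt0// pi_gt0.
Qed.

(** Integrating [sample_sum] over s in one cell of length [kap] covers the line by the translates of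
    the cell; monotone convergence applies to both sides. *)
Lemma e2_FT : e2 (FT g) = (nn g)%:E.
Proof.
pose h (x : R) := (cabs (FT g x) ^+ 2)%:E.
have mh : measurable_fun setT h.
  by apply: measurable_cabs2E; apply: cmeas_FT; exact: csupp_cigr.
have h0 x : (0 <= h x)%E by rewrite lee_fin sqr_ge0.
(* The [2 M + 1] cells [[n kap, (n + 1) kap)] with n from -M to M. *)
pose I M : set R := `[- (M%:R * kap), - (M%:R * kap) + (2 * M).+1%:R * kap[%classic.
have tile M : (\int[mu]_(x in I M) h x = \int[mu]_(s in `[0%R, kap[)
    (symsum M (fun n => cabs (FT g (s + n%:~R * kap)) ^+ 2))%:E)%E.
  rewrite /I ge0_integral_tile// -ge0_integral_sum//=.
  - apply: eq_integral => s _; rewrite /symsum big_mkord -sumEFin; apply: eq_bigr => k _.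
    rewrite /h; congr (cabs (FT g _) ^+ 2)%:E.
    by rewrite intrB -!pmulrn; ring.
  - move=> k; apply: measurable_funS measurableT _ _ => //.
    exact: (measurableT_comp mh (measurable_shift _)).
have IM : (\int[mu]_(x in I M) h x)%E @[M --> \oo] --> (\int[mu]_(x in \bigcup_M I M) h x)%E.
  apply: ge0_nondecreasing_set_cvg_integral => //.
  - move=> m n mn; apply/subsetPset => x; rewrite /I /= !in_itv/= => /andP[H1 H2].
    have mn' : (m%:R <= n%:R :> R) by rewrite ler_nat.
    have := ler_wpM2r (ltW kap0) mn'.
    rewrite -!(@natr1 _ (2 * _)%N) !natrM in H2 *; move=> ?; apply/andP; split; lra.
  - by move=> M; exact: measurable_itv.
  - by move=> M; apply: (measurable_funS measurableT).
have UI : \bigcup_M I M = setT.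
  apply/seteqP; split => // x _.
  have xk0 : 0 <= `|x| / kap by rewrite divr_ge0// ltW.
  exists (Num.trunc (`|x| / kap)).+1 => //; rewrite /I/= in_itv/=.
  have := Num.Theory.truncnS_gt (`|x| / kap); rewrite ltr_pdivrMr//.
  set M := (Num.trunc _).+1; rewrite ltr_norml => /andP[H1 H2].
  rewrite -!(@natr1 _ (2 * _)%N) !natrM mulrDl mul1r -mulrA.
  move: kap0 H1 H2; set u := M%:R * kap => k0 H1 H2; apply/andP; split; lra.
rewrite UI -[X in _ --> X]/(e2 (FT g)) in IM.
apply: (cvg_unique _ IM) => //.
rewrite /= (funext tile).
have nnE : ((nn g)%:E = \int[mu]_(s in `[0%R, kap[) (nn g / kap)%:E)%E.
  rewrite integral_cst//= lebesgue_measure_itv/= lte_fin kap0 sube0 -EFinM.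
  by rewrite divfK// gt_eqF.
rewrite nnE.
rewrite (_ : (fun s : R => (nn g / kap)%:E) = (fun s => limn (fun M =>
    (symsum M (fun n => cabs (FT g (s + n%:~R * kap)) ^+ 2))%:E))); last first.
  apply/funext => s; apply/esym/cvg_lim => //; apply: cvg_EFin; first exact: nearW.
  exact: sample_sum.
apply: cvg_monotone_convergence => //.
- move=> M; apply/measurable_EFinP; apply: (measurable_funS measurableT) => //.
  apply: measurable_sum => k.
  apply: (@measurable_cabs2 _ (fun x => FT g (x + (k%:Z - M%:Z)%:~R * kap))).
  by apply: (cmeas_comp (measurable_shift _)); apply: cmeas_FT; exact: csupp_cigr.
- by move=> M s _; rewrite lee_fin; apply: sumr_ge0 => k _; rewrite sqr_ge0.
- move=> s _ m n mn; rewrite lee_fin; apply: symsum_nondecreasing => // k.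
  by rewrite sqr_ge0.
Qed.

End PlancherelCompact.

Lemma L2_FT g : csupp g -> L2 (FT g).
Proof.
move=> gcs; case: (gcs) => g2 [T T0 gT]; apply/L2P; split.
  by apply: cmeas_FT; exact: csupp_cigr.
by rewrite (e2_FT g2 T0 gT) ltry.
Qed.

Lemma nn_FT g : csupp g -> nn (FT g) = nn g.
Proof. by move=> [g2 [T T0 gT]]; rewrite {1}/nn (e2_FT g2 T0 gT). Qed.

(** The norm of [P + Q] gives the real part of the inner product, that of [P + i Q] the imaginary
    part. *)
Lemma polarization (P Q f g : R -> R[i]) : L2 P -> L2 Q -> L2 f -> L2 g ->
  nn P = nn f -> nn Q = nn g ->
  nn (fun x => P x + Q x) = nn (fun x => f x + g x) ->
  nn (fun x => P x + 'i%C * Q x) = nn (fun x => f x + 'i%C * g x) ->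
  inner P Q = inner f g.
Proof.
move=> P2 Q2 f2 g2 nP nQ; rewrite !nnD ?nnZ//; try exact: L2Z.
rewrite !innerZr// nP nQ => /addrI H1 /addrI H2.
apply/eqP; rewrite eq_complex; apply/andP; split; apply/eqP.
  by move: H1; lra.
move: H2; rewrite !ReM; case: (inner P Q) (inner f g) => [a b] [a' b'] /=; lra.
Qed.

Lemma inner_FT f g : csupp f -> csupp g -> inner (FT f) (FT g) = inner f g.
Proof.
move=> cf cg; have ci := csuppZ 'i%C cg.
apply: polarization; rewrite ?nn_FT//; try exact: L2_FT; [by case: cf|by case: cg|..].
  rewrite -(nn_FT (csuppD cf cg)); congr nn; apply/funext => x.
  by rewrite FTD//; exact: csupp_cigr.
rewrite -(nn_FT (csuppD cf ci)); congr nn; apply/funext => x.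
rewrite FTD; [|exact: csupp_cigr..].
by rewrite FTZ//; exact: csupp_cigr.
Qed.

(** The inverse transform, written with two conjugations so that it inherits the isometry property
    of [FT]. *)
Definition IFT g (t : R) : R[i] := (FT (fun x => (g x)^*) t)^*.

Lemma L2_IFT g : csupp g -> L2 (IFT g).
Proof. by move=> cg; apply: L2J; apply: L2_FT; exact: csuppJ. Qed.

Lemma inner_J f g : L2 f -> L2 g ->
  inner (fun x => (f x)^*) (fun x => (g x)^*) = (inner f g)^*.
Proof.
move=> f2 g2; rewrite /inner -cintJ; last exact: cigrMJ.
by congr cintegral; apply/funext => x; rewrite rmorphM.
Qed.

Lemma inner_IFT f g : csupp f -> csupp g -> inner (IFT f) (IFT g) = inner f g.
Proof.
move=> cf cg; rewrite inner_J; [|exact/L2_FT/csuppJ..].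
rewrite inner_FT; [|exact: csuppJ..].
by rewrite inner_J ?conjCK//; [case: cf|case: cg].
Qed.

Lemma IFTE g (t : R) : csupp g ->
  IFT g t = ((Num.sqrt (2 * pi))^-1)%:C * cint (fun x => g x * expi (x * t)).
Proof.
move=> cg; rewrite /IFT /FT rmorphM/=; congr (_ * _).
  by apply/eqP; rewrite eq_complex/= oppr0 !eqxx.
rewrite -[LHS]cintJ; last by apply: cigr_echr; apply: csupp_cigr; exact: csuppJ.
by congr cintegral; apply/funext => x; rewrite rmorphM/= conjCK; congr (_ * _); rewrite [LHS]expiJ opprK.
Qed.

End FourierCompact.

(** * Extension of the transform to all square-integrable functions *)

Section FourierL2.
Context {R : realType}.
Local Notation mu := (@lebesgue_measure R).
Implicit Types (f g : R -> R[i]).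

Definition trunc (n : nat) f := res (`[- n%:R, n%:R]%classic : set R) f.

Lemma csupp_trunc n f : L2 f -> csupp (trunc n f).
Proof.
move=> f2; split; first by apply: L2_res => //; exact: measurable_itv.
exists (n%:R + 1); first by rewrite ltr_wpDl.
move=> x nx; rewrite /trunc res_out//= in_itv/= => H.
by have : `|x| <= n%:R by [rewrite ler_norml]; lra.
Qed.

Lemma L2_trunc n f : L2 f -> L2 (trunc n f).
Proof. by move=> /(csupp_trunc n)[]. Qed.

Lemma trunc_lim f : L2 f -> is_L2lim (fun n => trunc n f) f.
Proof.
move=> f2; apply/is_L2limP; first by move=> n; exact: L2_trunc.
split => //.
have [] := @dominated_convergence _ _ _ mu setT measurableT
  (fun n x => (cabs (trunc n f x - f x) ^+ 2)%:E) (fun=> 0%E)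
  (fun x => (cabs (f x) ^+ 2)%:E).
- move=> n; apply: measurable_cabs2E; apply: L2_meas; apply: L2B => //; exact: L2_trunc.
- exact: measurable_cst.
- apply: nearW => x _; apply: cvg_near_cst.
  exists (Num.trunc `|x|).+1 => // n /= xn; rewrite /trunc res_in ?subrr ?cabs0 ?expr0n//.
  rewrite /= in_itv/= -ler_norml; apply: ltW.
  by apply: (lt_le_trans (Num.Theory.truncnS_gt _)); rewrite ler_nat.
- exact: L2_integrable.
- apply: nearW => x n _; rewrite lee_fin ger0_norm ?sqr_ge0//.
  rewrite ler_pXn2r ?nnegrE ?cabs_ge0// /trunc.
  have [Dx|Dx] := pselect ((`[- n%:R, n%:R]%classic : set R) x).
    by rewrite res_in// subrr cabs0 cabs_ge0.
  by rewrite res_out// sub0r cabsN.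
move=> _ _; rewrite integral0 => /fine_cvgP[_].
by [].
Qed.

Lemma cvg_nn (u : nat -> R -> R[i]) f : (forall n, L2 (u n)) -> is_L2lim u f ->
  (fun n => nn (u n)) @ \oo --> nn f.
Proof.
move=> u2 uf; have [f2 nf] := (is_L2limP _ u2).1 uf.
have H : (fun n => cabs (inner (u n) f - inner f f) ^+ 2) @ \oo --> (0 : R).
  exact: cvg_inner.
have H2 : (fun n => cabs (inner (u n) f - inner f f)) @ \oo --> (0 : R).
  rewrite -[X in _ --> X]sqrtr0.
  rewrite (_ : (fun n => _) = (fun n => Num.sqrt (cabs (inner (u n) f - inner f f) ^+ 2))).
    by apply: continuous_cvg => //; exact: sqrt_continuous.
  by apply/funext => n; rewrite sqrtr_sqr ger0_norm// cabs_ge0.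
have H3 : (fun n => complex.Re (inner (u n) f - inner f f)) @ \oo --> (0 : R).
  apply: norm_cvg0; apply: (squeeze_cvgr _ _ H2); last exact: cvg_cst.
  by apply: nearW => n; apply/andP; split; [exact: normr_ge0|exact: normRe_le_cabs].
(* Expansion of the squared norm of [u n = (u n - f) + f]. *)
rewrite (_ : (fun n => nn (u n)) = (fun n => nn (fun x => u n x - f x) +
    2 * complex.Re (inner (u n) f - inner f f) + nn f)).
  rewrite -[X in _ --> X]add0r; apply: cvgD; last exact: cvg_cst.
  rewrite -[X in _ --> X]add0r; apply: cvgD => //.
  by rewrite -[X in _ --> X](mulr0 2); apply: cvgMl_tmp.
apply/funext => n; rewrite nnB// innerff.
by case: (inner (u n) f) => a b /=; ring.
Qed.

Lemma fourier_onE n f : fourier_on `[- n%:R, n%:R] f = FT (trunc n f).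
Proof.
apply/funext => xi; rewrite /fourier_on /FT cint_res; congr (_ * cintegral _ _).
by apply/funext => t; rewrite /trunc /res mulrA.
Qed.

Lemma L2_FT_trunc f : L2 f -> forall n, L2 (FT (trunc n f)).
Proof. by move=> f2 n; apply: L2_FT; exact: csupp_trunc. Qed.

(** The truncations are Cauchy and [FT] is isometric on them, so a limit exists and [L2lim] does not
    fall back on its default value. *)
Lemma fourier_lim f : L2 f -> is_L2lim (fun n => FT (trunc n f)) (fourier f).
Proof.
move=> f2; rewrite /fourier /L2lim.
rewrite (_ : (fun n : nat => _) = (fun n => FT (trunc n f))); last first.
  by apply/funext => n; exact: fourier_onE.
apply: xgetPex; apply: L2_complete => [|eps eps0]; first exact: L2_FT_trunc.
have [_ H] := (is_L2limP _ (fun n => L2_trunc n f2)).1 (trunc_lim f2).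
have e4 : 0 < eps / 4 by rewrite divr_gt0.
move/cvgrPdist_le : H => /(_ _ e4)[N _ HN]; exists N => m n Nm Nn.
have -> : nn (fun x => FT (trunc m f) x - FT (trunc n f) x) =
    nn (fun x => trunc m f x - trunc n f x).
  rewrite -[RHS]nn_FT; last by apply: csuppB; exact: csupp_trunc.
  congr nn; apply/funext => x; rewrite FTD; last 2 first.
  - exact/csupp_cigr/csupp_trunc.
  - under eq_fun do rewrite -mulN1r; apply: cigrZ; exact/csupp_cigr/csupp_trunc.
  congr (_ + _); under [in RHS]eq_fun do rewrite -mulN1r.
  by rewrite FTZ ?mulN1r//; exact/csupp_cigr/csupp_trunc.
apply: (le_trans (nnB_le (L2_trunc m f2) f2 (L2_trunc n f2))).
have := HN _ Nm; have := HN _ Nn.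
rewrite !sub0r !normrN !ger0_norm ?nn_ge0// (nn_BC f2 (L2_trunc n f2)); lra.
Qed.

Lemma L2_fourier f : L2 f -> L2 (fourier f).
Proof. by move=> /fourier_lim[]. Qed.

Lemma nn_fourier f : L2 f -> nn (fourier f) = nn f.
Proof.
move=> f2; have H1 := cvg_nn (L2_FT_trunc f2) (fourier_lim f2).
have H2 := cvg_nn (fun n => L2_trunc n f2) (trunc_lim f2).
rewrite (_ : (fun n => nn (trunc n f)) = (fun n => nn (FT (trunc n f)))) in H2.
  exact: (cvg_unique (@Rhausdorff R) H1 H2).
by apply/funext => n; rewrite nn_FT//; exact: csupp_trunc.
Qed.

Let fubini_real (H : R -> R -> R) (A B : R -> R) :
  measurable_fun setT (fun z : R * R => H z.1 z.2) ->
  mu.-integrable setT (EFin \o A) -> mu.-integrable setT (EFin \o B) ->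
  (forall x y, `|H x y| <= A x * B y) ->
  \int[mu]_x \int[mu]_y H x y = \int[mu]_y \int[mu]_x H x y.
Proof.
move=> mH iA iB HAB.
pose h (z : R * R) := (H z.1 z.2)%:E.
have mh : measurable_fun setT h by exact/measurable_EFinP.
have mH1 x : measurable_fun setT (H x).
  exact: (measurable_fun_pair2 x mH).
have mH2 y : measurable_fun setT (H ^~ y).
  exact: (measurable_fun_pair1 y mH).
have iH1 x : mu.-integrable setT (EFin \o H x).
  apply: (@le_integrable _ _ _ mu _ measurableT _ (fun y => (A x)%:E * (B y)%:E)%E).
  - by apply/measurable_EFinP; first [exact: mH1|exact: mH2].
  - move=> y _ /=; rewrite lee_fin; apply: le_trans (HAB x y) _; exact: ler_norm.
  - exact: integrableZl.
have iH2 y : mu.-integrable setT (EFin \o H ^~ y).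
  apply: (@le_integrable _ _ _ mu _ measurableT _ (fun x => (B y)%:E * (A x)%:E)%E).
  - by apply/measurable_EFinP; first [exact: mH1|exact: mH2].
  - move=> x _ /=; rewrite lee_fin mulrC; apply: le_trans (HAB x y) _; exact: ler_norm.
  - exact: integrableZl.
have [_ Ay] := integrableP _ _ _ iA.
have [_ By] := integrableP _ _ _ iB.
have ih : (mu \x mu)%E.-integrable setT h.
  apply/integrable12ltyP => //=.
  apply: (@le_lt_trans _ _ (\int[mu]_x (`|A x|%:E * \int[mu]_y `|(B y)%:E|))%E).
    apply: ge0_le_integral => //.
    - by move=> x _; apply: integral_ge0.
    - apply: (@measurable_fun_fubini_tonelli_F _ _ _ _ _ mu (fun z => `|h z|%E)) => //.
      exact: measurableT_comp.
    - apply: emeasurable_funM => //.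
      by apply/measurable_EFinP; apply: measurableT_comp => //; case/integrableP : iA => /measurable_EFinP.
    move=> x _; rewrite -ge0_integralZl//; last first.
      by apply: measurableT_comp => //; case/integrableP : iB.
    apply: ge0_le_integral => //.
    - by apply/measurable_EFinP; apply: measurableT_comp => //; exact: mH1.
    - apply: measurable_funeM; by apply: measurableT_comp => //; case/integrableP : iB.
    move=> y _ /=; rewrite -EFinM lee_fin -normrM (le_trans (HAB x y))//; exact: ler_norm.
  have bfin : (\int[mu]_y `|(B y)%:E|)%E \is a fin_num.
    by rewrite ge0_fin_numE//; exact: integral_ge0.
  under eq_integral do rewrite -(fineK bfin) muleC.
  rewrite ge0_integralZl//; last 2 first.
  - by apply/measurable_EFinP; apply: measurableT_comp => //; case/integrableP : iA => /measurable_EFinP.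
  - by rewrite lee_fin fine_ge0// integral_ge0.
  by rewrite lte_mul_pinfty ?lee_fin ?fine_ge0 ?integral_ge0.
have := Fubini ih; rewrite /h/= => E.
rewrite /Rintegral; congr fine; transitivity (\int[mu]_x \int[mu]_y (H x y)%:E)%E.
  by apply: eq_integral => x _; rewrite fineK//; exact: (integrable_fin_num measurableT (iH1 x)).
rewrite E; apply: eq_integral => y _.
by rewrite fineK//; exact: (integrable_fin_num measurableT (iH2 y)).
Qed.

Lemma cint_fubini (H : R -> R -> R[i]) (A B : R -> R) :
  measurable_fun setT (fun z : R * R => complex.Re (H z.1 z.2)) ->
  measurable_fun setT (fun z : R * R => complex.Im (H z.1 z.2)) ->
  mu.-integrable setT (EFin \o A) -> mu.-integrable setT (EFin \o B) ->
  (forall x y, cabs (H x y) <= A x * B y) ->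
  cint (fun x => cint (H x)) = cint (fun y => cint (fun x => H x y)).
Proof.
move=> m1 m2 iA iB HAB; rewrite /cintegral /=; congr (_ +i* _).
  apply: (fubini_real m1 iA iB) => x y; apply: le_trans (HAB x y); exact: normRe_le_cabs.
apply: (fubini_real m2 iA iB) => x y; apply: le_trans (HAB x y); exact: normIm_le_cabs.
Qed.

Lemma cigrJ f : cigr f -> cigr (fun x => (f x)^*).
Proof.
move=> fi; apply: (@cigr_dom _ _ (fun x => cabs (f x))).
- exact/cmeasJ/cigr_meas.
- by move=> x; rewrite cabsJ.
- exact: cigr_cabs.
Qed.

Let jmeas (F : R * R -> R[i]) := measurable_fun setT (fun z => complex.Re (F z)) /\
  measurable_fun setT (fun z => complex.Im (F z)).

Let jmeasM F1 F2 : jmeas F1 -> jmeas F2 -> jmeas (fun z => F1 z * F2 z).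
Proof.
move=> [a1 b1] [a2 b2]; split.
  under eq_fun do rewrite ReM.
  by apply: measurable_funB; exact: measurable_funM.
under eq_fun do rewrite ImM.
by apply: measurable_funD; exact: measurable_funM.
Qed.

Let jmeas_comp (u : R * R -> R) f : measurable_fun setT u -> cmeas f ->
  jmeas (fun z => f (u z)).
Proof.
by move=> mu_ [a1 b1]; split; [exact: (measurableT_comp a1)|exact: (measurableT_comp b1)].
Qed.

(** Fubini's theorem for the kernel [expi (- (t * xi))]; the bounded supports make g and G
    integrable, and a multiple of the product of their moduli dominates the integrand. *)
Lemma inner_FT_IFT g G : csupp g -> csupp G -> inner (FT g) G = inner g (IFT G).
Proof.
move=> cg cG; have gi := csupp_cigr cg; have Gi := csupp_cigr cG.
have [[g2 _] [G2 _]] := (cg, cG).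
pose c : R[i] := ((Num.sqrt (2 * pi))^-1)%:C.
have cJ : c^* = c by apply/eqP; rewrite eq_complex/= oppr0 !eqxx.
pose H (t xi : R) := c * (g t * (expi (- (t * xi)) * (G xi)^*)).
have eJ (x t : R) : (expi (x * t) : R[i])^* = expi (- (t * x)).
  by rewrite [LHS]expiJ mulrC.
have E : cint (fun t => cint (H t)) = cint (fun xi => cint (fun t => H t xi)).
  have mE : measurable_fun setT (fun z : R * R => - (z.1 * z.2)).
    by apply: measurableT_comp => //; apply: measurable_funM.
  have jH : jmeas (fun z => H z.1 z.2).
    apply: jmeasM; first by split; exact: measurable_cst.
    apply: jmeasM; first exact: (jmeas_comp measurable_fst (L2_meas g2)).
    apply: jmeasM; first exact: (jmeas_comp mE cmeas_expi).
    exact: (jmeas_comp measurable_snd (L2_meas (L2J G2))).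
  apply: (@cint_fubini H (fun t => cabs c * cabs (g t)) (fun xi => cabs (G xi))).
  - exact: jH.1.
  - exact: jH.2.
  - exact: (integrableZl measurableT _ (cigr_cabs gi)).
  - exact: cigr_cabs.
  - by move=> t xi; rewrite /H !cabsM cabs_expi mul1r cabsJ mulrA.
have -> : inner (FT g) G = cint (fun xi => cint (fun t => H t xi)).
  rewrite /inner; congr cintegral; apply/funext => xi.
  rewrite /FT -/c mulrAC -cintZ; last exact: cigr_echr.
  by congr cintegral; apply/funext => t; rewrite /H; ring.
rewrite -E /inner; congr cintegral; apply/funext => t.
have Ge : cigr (fun x => G x * expi (x * t)).
  apply: (@cigr_bounded _ G (fun x => expi (x * t)) 1 Gi); last by move=> x; rewrite cabs_expi.
  by apply: cmeas_expiM; exact: measurable_funM.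
rewrite (IFTE t cG) rmorphM/= -/c cJ mulrA -[(cint _)^*](cintJ Ge) -cintZ; last exact: cigrJ.
by congr cintegral; apply/funext => xi; rewrite /H rmorphM/= eJ; ring.
Qed.

(** The handle on [fourier f]: it pins down the chosen representative up to a null set, without any
    return to the limit that defines it. *)
Lemma fourier_adjoint f G : L2 f -> csupp G -> inner (fourier f) G = inner f (IFT G).
Proof.
move=> f2 cG; have [G2 _] := cG; have I2 := L2_IFT cG.
have H1 := cvg_inner (L2_FT_trunc f2) (fourier_lim f2) G2.
have H2 := cvg_inner (fun n => L2_trunc n f2) (trunc_lim f2) I2.
apply/eqP; rewrite -subr_eq0 -cabs_eq0 -sqrf_eq0 eq_le sqr_ge0 andbT.
set z := inner (fourier f) G; set y := inner f (IFT G).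
(* Both inner products are limits of one sequence, so the squared distance between them is at most a
   quantity that tends to 0. *)
have H3 : (fun n => 2 * cabs (inner (FT (trunc n f)) G - z) ^+ 2 +
    2 * cabs (inner (trunc n f) (IFT G) - y) ^+ 2) @ \oo --> (2 * 0 + 2 * 0 : R).
  by apply: cvgD; exact: cvgMl_tmp.
rewrite !mulr0 addr0 in H3.
apply: (cvgr_to_ge H3); apply: nearW => n.
rewrite (inner_FT_IFT (csupp_trunc n f2) cG).
set u := inner (trunc n f) (IFT G).
rewrite (_ : z - y = - (u - z) + (u - y)); last by ring.
by apply: (le_trans (cabs2D_le _ _)); rewrite cabsN.
Qed.

(** Tested with the truncations of [F - H] itself. *)
Lemma L2_test F H : L2 F -> L2 H -> (forall G, csupp G -> inner F G = inner H G) ->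
  {ae mu, forall x, F x = H x}.
Proof.
move=> F2 H2 FH; apply: nnB_eq0 => //.
have d2 := L2B F2 H2; set d := (fun x => F x - H x) in d2 *.
have d0 n : nn (trunc n d) = 0.
  have cT := csupp_trunc n d2; have [T2 _] := cT.
  have : inner (trunc n d) (trunc n d) = inner d (trunc n d).
    rewrite /inner; congr cintegral; apply/funext => x.
    have [Dx|Dx] := pselect ((`[- n%:R, n%:R]%classic : set R) x).
      by rewrite /trunc res_in.
    by rewrite /trunc res_out// conjC0 !mulr0.
  rewrite innerff /d innerBl// FH// subrr => -[].
  by [].
have := cvg_nn (fun n => L2_trunc n d2) (trunc_lim d2).
rewrite (funext d0) => H1; apply/esym/(cvg_unique (@Rhausdorff R) _ H1); exact: cvg_cst.
Qed.

Lemma fourier_unique f H : L2 f -> L2 H ->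
  (forall G, csupp G -> inner H G = inner f (IFT G)) -> {ae mu, forall x, fourier f x = H x}.
Proof.
move=> f2 H2 HG; apply: L2_test => //; first exact: L2_fourier.
by move=> G cG; rewrite fourier_adjoint// HG.
Qed.

Lemma fourier_linear c f g : L2 f -> L2 g ->
  {ae mu, forall x, fourier (fun x => f x + c * g x) x = fourier f x + c * fourier g x}.
Proof.
move=> f2 g2; have [F2 G2] := (L2_fourier f2, L2_fourier g2).
apply: fourier_unique.
- by apply: L2D => //; exact: L2Z.
- by apply: L2D => //; exact: L2Z.
move=> G cG; have [G2' _] := cG; have I2 := L2_IFT cG.
rewrite !innerDl//; [|exact: L2Z..].
by rewrite !innerZl// !fourier_adjoint.
Qed.

Lemma fourierD f g : L2 f -> L2 g ->
  {ae mu, forall x, fourier (fun x => f x + g x) x = fourier f x + fourier g x}.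
Proof.
move=> f2 g2; have := fourier_linear 1 f2 g2.
by under [fun x => f x + g x]eq_fun do rewrite -[g _]mul1r; apply: aeS => x; rewrite !mul1r.
Qed.

Lemma inner_fourier f g : L2 f -> L2 g -> inner (fourier f) (fourier g) = inner f g.
Proof.
move=> f2 g2; have [F2 G2] := (L2_fourier f2, L2_fourier g2).
apply: polarization => //; rewrite ?nn_fourier//.
  rewrite -[RHS]nn_fourier; last exact: L2D.
  apply/esym/ae_eq_nn; last exact: fourierD.
    by apply/L2_meas/L2_fourier/L2D.
  exact/L2_meas/L2D.
rewrite -[RHS]nn_fourier; last by apply: L2D => //; exact: L2Z.
apply/esym/ae_eq_nn; last exact: fourier_linear.
  by apply/L2_meas/L2_fourier/L2D => //; exact: L2Z.
by apply/L2_meas/L2D => //; exact: L2Z.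
Qed.

Lemma fourier_IFT F : csupp F -> {ae mu, forall x, fourier (IFT F) x = F x}.
Proof.
move=> cF; apply: fourier_unique; [exact: L2_IFT|by case: cF|].
by move=> G cG; rewrite inner_IFT.
Qed.

(** The modulation is moved onto the test function, where it becomes a translation of the inverse
    transform. *)
Lemma fourier_translate (a : R) f : L2 f ->
  {ae mu, forall xi, fourier (translate a f) xi = expi (a * xi) * fourier f xi}.
Proof.
move=> f2; have F2 := L2_fourier f2.
have me (s : R) : cmeas (fun xi => expi (s * xi)).
  by apply: cmeas_expiM; exact: measurable_funM.
have e1 (s xi : R) : cabs (expi (s * xi) : R[i]) <= 1 by rewrite cabs_expi.
apply: fourier_unique; first exact: L2_shift.
  exact: (L2_bounded_mul (me a) (e1 a)).
move=> G cG; have [G2 _] := cG.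
pose G' xi := expi (- a * xi) * G xi.
have cG' : csupp G' := csupp_mul (me (- a)) (e1 (- a)) cG.
have -> : inner (fun x => expi (a * x) * fourier f x) G = inner (fourier f) G'.
  rewrite /inner; congr cintegral; apply/funext => x.
  rewrite /G' rmorphM/= [X in _ * (X * _)]expiJ mulNr opprK; ring.
rewrite (fourier_adjoint f2 cG') -[LHS](inner_shift a f2 (L2_IFT cG')).
congr inner; apply/funext => t; rewrite !IFTE//; congr (_ * cintegral _ _).
apply/funext => x; rewrite /G' mulrAC -expiD mulrC; congr (_ * expi _); ring.
Qed.

End FourierL2.

(** * Bounds for finite matrices *)

Section RowNorm.
Context {R : realType}.
Local Notation C := R[i].

Definition rn2 n (u : 'rV[C]_n) : R := \sum_j cabs (u 0 j) ^+ 2.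

Definition adjm m n (M : 'M[C]_(m, n)) : 'M[C]_(n, m) := map_mx Num.conj M^T.

Lemma rn2_ge0 n (u : 'rV[C]_n) : 0 <= rn2 u.
Proof. by apply: sumr_ge0 => j _; rewrite sqr_ge0. Qed.

Lemma cabs2_le_rn2 n (u : 'rV[C]_n) j : cabs (u 0 j) ^+ 2 <= rn2 u.
Proof. by rewrite /rn2 (bigD1 j)//= lerDl; apply: sumr_ge0 => i _; rewrite sqr_ge0. Qed.

Lemma adjmM m n p (A : 'M[C]_(m, n)) (B : 'M[C]_(n, p)) : adjm (A *m B) = adjm B *m adjm A.
Proof. by rewrite /adjm trmx_mul map_mxM. Qed.

Lemma det_adjm n (A : 'M[C]_n) : \det (adjm A) = (\det A)^*.
Proof. by rewrite /adjm det_map_mx det_tr. Qed.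

Lemma rn2_form n (u : 'rV[C]_n) : (u *m adjm u) 0 0 = (rn2 u)%:C.
Proof.
rewrite !mxE /rn2 rmorph_sum; apply: eq_bigr => j _.
by rewrite !mxE mulJ_cabs2.
Qed.

(** Lagrange's identity: twice the difference of the two sides is a double sum of squares. *)
Lemma sum_cauchy_schwarz n (a b : 'I_n -> R) :
  (\sum_i a i * b i) ^+ 2 <= (\sum_i a i ^+ 2) * (\sum_i b i ^+ 2).
Proof.
have H : 0 <= \sum_i \sum_j (a i * b j - a j * b i) ^+ 2.
  by apply: sumr_ge0 => i _; apply: sumr_ge0 => j _; rewrite sqr_ge0.
have E : \sum_i \sum_j (a i * b j - a j * b i) ^+ 2 =
    2 * ((\sum_i a i ^+ 2) * (\sum_i b i ^+ 2)) - 2 * (\sum_i a i * b i) ^+ 2.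
  rewrite (eq_bigr (fun i => a i ^+ 2 * (\sum_j b j ^+ 2) + b i ^+ 2 * (\sum_j a j ^+ 2)
      - 2 * (a i * b i) * (\sum_j a j * b j))).
    rewrite !big_split/= sumrN -!mulr_suml -mulr_sumr; ring.
  move=> i _; rewrite !mulr_sumr -big_split/= -sumrB; apply: eq_bigr => j _; ring.
by move: H; rewrite E; lra.
Qed.

Lemma cabs_sum_cauchy_schwarz n (a b : 'I_n -> C) :
  cabs (\sum_i a i * b i) ^+ 2 <= (\sum_i cabs (a i) ^+ 2) * (\sum_i cabs (b i) ^+ 2).
Proof.
apply: (le_trans _ (sum_cauchy_schwarz (fun i => cabs (a i)) (fun i => cabs (b i)))).
rewrite ler_pXn2r ?nnegrE ?cabs_ge0 ?sumr_ge0// => [|i _]; last by rewrite mulr_ge0 ?cabs_ge0.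
by apply: (le_trans (@cabs_sum _ _ _ _ _)); apply: ler_sum => i _; rewrite cabsM.
Qed.

Lemma cabs_det_le n (M : 'M[C]_n) (c : R) : (forall i j, cabs (M i j) <= c) ->
  cabs (\det M) <= n`!%:R * c ^+ n.
Proof.
move=> Mc; apply: (le_trans (@cabs_sum _ _ _ _ _)).
apply: (@le_trans _ _ (\sum_(s : 'S_n) c ^+ n)); last by rewrite sumr_const card_Sn mulr_natl.
apply: ler_sum => s _; rewrite cabsM cabs_prod.
have -> : cabs ((-1) ^+ s : C) = 1.
  by case: (odd_perm s); rewrite ?expr0 ?expr1 ?cabsN cabs1.
rewrite mul1r -[leRHS](_ : \prod_(i < n) c = _); last by rewrite prodr_const card_ord.
by apply: ler_prod => i _; rewrite cabs_ge0/=.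
Qed.

(** Cramer's rule: [\det M * v] is [v *m M] times [\adj M], and the cofactors are bounded in terms
    of c alone. Hence K serves all the matrices at once. *)
Lemma rn2_le_of_det n (c eta : R) : 0 < eta -> exists2 K : R, 0 < K &
  forall M : 'M[C]_n, (forall i j, cabs (M i j) <= c) -> eta <= cabs (\det M) ->
  forall v, rn2 v <= K * rn2 (v *m M).
Proof.
move=> eta0; pose B0 : R := n.-1`!%:R * c ^+ n.-1.
(* Each of the n coordinates costs [n * B0 ^+ 2 / eta ^+ 2] by Cauchy-Schwarz; the added 1 keeps the
   constant positive in degenerate cases. *)
exists (n%:R ^+ 2 * B0 ^+ 2 / eta ^+ 2 + 1).
  by rewrite ltr_wpDl// divr_ge0 ?sqr_ge0// mulr_ge0 ?sqr_ge0.
move=> M Mc Meta v.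
have adjB i k : cabs (\adj M i k) <= B0.
  rewrite !mxE cabsM (_ : cabs _ = 1); last first.
    by rewrite -signr_odd; case: (odd _); rewrite ?expr0 ?expr1 ?cabsN cabs1.
  by rewrite mul1r; apply: cabs_det_le => i' j'; rewrite !mxE.
have H k : eta ^+ 2 * cabs (v 0 k) ^+ 2 <= rn2 (v *m M) * (n%:R * B0 ^+ 2).
  apply: (@le_trans _ _ (cabs (\det M * v 0 k) ^+ 2)).
    rewrite cabsM exprMn ler_wpM2r ?sqr_ge0// ler_pXn2r ?nnegrE ?cabs_ge0//.
    exact: ltW.
  have -> : \det M * v 0 k = \sum_i (v *m M) 0 i * \adj M i k.
    have := congr1 (fun A : 'rV[C]_n => A 0 k) (mulmxA v M (\adj M)).
    by rewrite mul_mx_adj mul_mx_scalar mxE => ->; rewrite mxE.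
  apply: (le_trans (cabs_sum_cauchy_schwarz _ _)).
  apply: ler_wpM2l; first exact: rn2_ge0.
  apply: (@le_trans _ _ (\sum_(i < n) B0 ^+ 2)); last by rewrite sumr_const card_ord mulr_natl.
  apply: ler_sum => i _; rewrite ler_pXn2r ?nnegrE ?cabs_ge0//.
  by rewrite (le_trans _ (adjB i k))// cabs_ge0.
have e2 : 0 < eta ^+ 2 by rewrite exprn_gt0.
have : eta ^+ 2 * rn2 v <= n%:R ^+ 2 * B0 ^+ 2 * rn2 (v *m M).
  rewrite /rn2 mulr_sumr; apply: (le_trans (ler_sum _ (fun k _ => H k))).
  rewrite sumr_const card_ord -mulr_natl -/(rn2 _).
  by rewrite le_eqVlt; apply/orP; left; apply/eqP; ring.
move=> H2; have r0 := rn2_ge0 (v *m M).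
rewrite mulrDl mul1r; apply: (@le_trans _ _ (n%:R ^+ 2 * B0 ^+ 2 / eta ^+ 2 * rn2 (v *m M))).
  by rewrite mulrAC ler_pdivlMr// mulrC.
by rewrite lerDl.
Qed.

Lemma rn2_mul_le n m (c : R) (v : 'rV[C]_n) (M : 'M[C]_(n, m)) :
  (forall i j, cabs (M i j) ^+ 2 <= c) -> rn2 (v *m M) <= (m * n)%:R * c * rn2 v.
Proof.
move=> Mc; apply: (@le_trans _ _ (\sum_(j < m) rn2 v * (n%:R * c))).
  apply: ler_sum => j _; rewrite mxE; apply: (le_trans (cabs_sum_cauchy_schwarz _ _)).
  apply: ler_wpM2l; first exact: rn2_ge0.
  apply: (@le_trans _ _ (\sum_(i < n) c)); last by rewrite sumr_const card_ord mulr_natl.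
  exact: ler_sum.
rewrite sumr_const card_ord -mulr_natl natrM le_eqVlt; apply/orP; left; apply/eqP; ring.
Qed.

Lemma adj_row0_mul n (M : 'M[C]_n.+1) : row ord0 (\adj M) *m M = \det M *: delta_mx 0 ord0.
Proof.
rewrite -row_mul mul_adj_mx; apply/rowP => j; rewrite !mxE eqxx/=.
by rewrite eq_sym mulr_natr.
Qed.

(* For v the first row of adj (K K^H), v (K K^H) v^H = det (K K^H) * conj (v_0). *)
Lemma rn2_adj_row0 n m (K : 'M[C]_(n.+1, m)) (M := K *m adjm K) :
  (rn2 (row ord0 (\adj M) *m K))%:C = \det M * (\det (row' ord0 K *m adjm (row' ord0 K)))^*.
Proof.
rewrite -rn2_form adjmM mulmxA -[_ *m K *m _]mulmxA -/M adj_row0_mul.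
rewrite -scalemxAl mxE; congr (_ * _).
rewrite mxE (bigD1 ord0)//= big1 ?addr0 => [|i i0]; last first.
  by rewrite mxE (negbTE i0) andbF mul0r.
rewrite !mxE !eqxx mul1r; congr (_^*).
rewrite /cofactor addn0 expr0 mul1r; congr (\det _).
apply/matrixP => i j; rewrite !mxE; apply: eq_bigr => k _.
by rewrite !mxE.
Qed.

Lemma adj_row0_0 n m (K : 'M[C]_(n.+1, m)) (M := K *m adjm K) :
  row ord0 (\adj M) 0 ord0 = \det (row' ord0 K *m adjm (row' ord0 K)).
Proof.
rewrite !mxE /cofactor addn0 expr0 mul1r; congr (\det _).
apply/matrixP => i j; rewrite !mxE; apply: eq_bigr => k _.
by rewrite !mxE.
Qed.

(** Let d and d' be the Gram determinants of K with and without its first row, and v the first row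
    of the adjugate. Then [v_0 = d'] and the squared norm of [v *m K] is [cabs d * cabs d'], so
    testing the lower bound on v gives [A * cabs d' <= cabs d]. *)
Lemma gram_det_step n m (K : 'M[C]_(n.+1, m)) (A : R) : 0 < A ->
  A ^+ n <= cabs (\det (row' ord0 K *m adjm (row' ord0 K))) ->
  A * rn2 (row ord0 (\adj (K *m adjm K))) <= rn2 (row ord0 (\adj (K *m adjm K)) *m K) ->
  A ^+ n.+1 <= cabs (\det (K *m adjm K)).
Proof.
move=> A0; set d' := \det (row' ord0 K *m _); set d := \det (K *m adjm K) => H1 H2.
have d'0 : 0 < cabs d' by apply: lt_le_trans H1; rewrite exprn_gt0.
have H3 : A * cabs d' ^+ 2 <= cabs d * cabs d'.
  apply: (@le_trans _ _ (A * rn2 (row ord0 (\adj (K *m adjm K))))).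
    by rewrite ler_wpM2l ?(ltW A0)// /d' -adj_row0_0; exact: cabs2_le_rn2.
  apply: (le_trans H2).
  have := rn2_adj_row0 K; rewrite -/d -/d' => /(congr1 (@cabs R)).
  by rewrite cabs_real cabsM cabsJ ger0_norm ?rn2_ge0// => ->.
rewrite exprS; apply: (@le_trans _ _ (A * cabs d')); first by rewrite ler_wpM2l// ltW.
by rewrite -(ler_pM2r d'0) -mulrA -expr2.
Qed.

(* L := K with a row z of its left-orthogonal complement on top: L L^H is block diagonal. *)
Lemma gram_det_le_minors n (K : 'M[C]_(n, n.+1)) :
  cabs (\det (K *m adjm K)) <= \sum_j cabs (\det (col' j K)) ^+ 2.
Proof.
have /rowV0Pn[z /sub_kermxP zK z0] : kermx (adjm K) != 0.
  rewrite -mxrank_eq0 mxrank_ker -lt0n subn_gt0; exact: (leq_ltn_trans (rank_leq_col _)).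
have rz0 : 0 < rn2 z.
  rewrite lt_neqAle rn2_ge0 andbT; apply: contra_neqN z0 => rz.
  apply/rowP => j; apply/eqP; rewrite mxE -cabs_eq0 -sqrf_eq0 eq_le sqr_ge0 andbT.
  by rewrite (eqP rz) cabs2_le_rn2.
pose L : 'M[C]_(1 + n) := col_mx z K.
have LL : L *m adjm L = block_mx (z *m adjm z) 0 0 (K *m adjm K).
  have -> : adjm L = row_mx (adjm z) (adjm K) by rewrite /adjm /L tr_col_mx map_row_mx.
  rewrite mul_col_row zK.
  have -> : K *m adjm z = adjm (z *m adjm K).
    rewrite adjmM /adjm; congr (_ *m _); apply/matrixP => i j; rewrite !mxE conjCK//.
  by rewrite zK /adjm trmx0 map_mx0.
have d1 : cabs (\det L) ^+ 2 = rn2 z * cabs (\det (K *m adjm K)).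
  have := congr1 (fun A => cabs (\det A)) LL.
  rewrite det_mulmx det_adjm det_ublock cabsM cabsJ -expr2 => ->.
  rewrite cabsM; congr (_ * _).
  by rewrite det_mx11 rn2_form cabs_real ger0_norm// rn2_ge0.
(* Laplace expansion along z, whose cofactors are up to sign the maximal minors of K, followed by
   Cauchy-Schwarz; this is the inequality half of the Cauchy-Binet formula. *)
have d2 : cabs (\det L) ^+ 2 <= rn2 z * \sum_j cabs (\det (col' j K)) ^+ 2.
  rewrite (expand_det_row L ord0).
  apply: (le_trans (cabs_sum_cauchy_schwarz _ _)).
  have Lz j : L ord0 j = z 0 j.
    by rewrite /L mxE; case: splitP => // i _; rewrite ord1.
  rewrite (eq_bigr (fun j => cabs (z 0 j) ^+ 2)) => [|j _]; last by rewrite Lz.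
  apply: ler_wpM2l; first exact: rn2_ge0.
  apply: ler_sum => j _; rewrite /cofactor cabsM.
  have -> : cabs ((-1) ^+ (0 + j) : C) = 1.
    by rewrite -signr_odd; case: (odd _); rewrite ?expr0 ?expr1 ?cabsN cabs1.
  rewrite mul1r (_ : row' _ (col' _ L) = col' j K)//.
  apply/matrixP => a b; rewrite !mxE; case: splitP => i /= ia.
    by move: (ltn_ord i); rewrite -ia.
  by congr (K _ _); apply/val_inj; case: ia.
by move: d2; rewrite d1 ler_pM2l.
Qed.

End RowNorm.

(** * Fiberization of band-limited functions *)

Section BandLimited.
Context {R : realType}.
Local Notation mu := (@lebesgue_measure R).
Implicit Types (f g F : R -> R[i]).

(** The complement of the support is an uncountable union of open sets. Intervals with rational
    endpoints reduce it to countably many null sets. *)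
Lemma ess_supp_itv (w : R) F : ess_supp F `<=` `[- w, w] <->
  {ae mu, forall x, ~ (`[- w, w]%classic : set R) x -> F x = 0}.
Proof.
split=> [H|H]; last first.
  move=> x; rewrite /ess_supp/= => Hx; apply: contrapT => xw; apply: Hx.
  exists (~` `[- w, w]%classic) => //; split => //.
  by apply: closed_openC; exact: itv_closed.
pose itv (p : rat * rat) : set R := `]ratr p.1, ratr p.2[%classic.
pose P p := {ae mu, forall x, itv p x -> F x = 0}.
(* A pair whose interval does not satisfy [P] imposes nothing, so every [Q n] holds almost
   everywhere. *)
pose Q (n : nat) (x : R) := match @unpickle (rat * rat)%type n with
  | Some p => P p -> itv p x -> F x = 0 | None => True end.
have : {ae mu, forall x, forall n, Q n x}.
  apply: ae_foralln => n; rewrite /Q; case: (unpickle n) => [p|]; last exact: nearW.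
  have [Pp|Pp] := pselect (P p); last by apply: nearW.
  by apply: aeS Pp => x + _.
apply: aeS => x Qx xw.
have : ~ ess_supp F x by move=> /H.
rewrite /ess_supp/= => /contrapT[U [oU UF] Ux].
have /nbhs_ballP[e /= e0 eU] : nbhs x U by exact: open_nbhs_nbhs.
have [p1 p1x] := @rat_in_itvoo R (x - e) x ltac:(by rewrite ltrBlDr ltrDl).
have [p2 p2x] := @rat_in_itvoo R x (x + e) ltac:(by rewrite ltrDl).
move: p1x p2x; rewrite !in_itv/= => /andP[a1 a2] /andP[b1 b2].
have := Qx (pickle (p1, p2)); rewrite /Q pickleK; apply.
  rewrite /P /itv/=; apply: aeS UF => y UF /=; rewrite in_itv/= => /andP[y1 y2].
  apply: UF; apply: eU; rewrite /ball/= ltr_norml; apply/andP; split; lra.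
by rewrite /itv/= in_itv/= a2 b1.
Qed.

Lemma bandlimitedP (w : R) f : bandlimited w f <->
  L2 f /\ {ae mu, forall x, ~ (`[- w, w]%classic : set R) x -> fourier f x = 0}.
Proof. by split => -[f2 /ess_supp_itv]. Qed.

Lemma ae_shift (a : R) (P : R -> Prop) :
  {ae mu, forall x, P x} -> {ae mu, forall x, P (x + a)}.
Proof.
case=> A [mA A0 PA]; exists [set x | A (x + a)]; split.
- rewrite -[X in measurable X]setTI; exact: (measurable_shift a).
- by rewrite -A0; exact/esym/lebesgue_measure_shift.
- by move=> x /= nP; exact: PA.
Qed.

Lemma L2_ae_bounded_mul f g (C : R) : cmeas g -> {ae mu, forall x, cabs (g x) <= C} ->
  L2 f -> L2 (fun x => g x * f x).
Proof.
move=> mg gC f2; have mf := L2_meas f2; apply/L2P; split; first exact: cmeasM.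
apply: (@le_lt_trans _ _ (\int[mu]_x (C ^+ 2 * cabs (f x) ^+ 2)%:E)%E).
  apply: ae_ge0_le_integral => //.
  - by move=> x _; rewrite lee_fin sqr_ge0.
  - by apply: measurable_cabs2E; exact: cmeasM.
  - by move=> x _; rewrite lee_fin mulr_ge0 ?sqr_ge0.
  - by apply/measurable_EFinP; apply: measurable_funM => //; exact: measurable_cabs2.
  apply: aeS gC => x gC _; rewrite lee_fin cabsM exprMn ler_wpM2r ?sqr_ge0//.
  by rewrite ler_pXn2r ?nnegrE ?cabs_ge0// (le_trans _ gC)// cabs_ge0.
have := integrableZl measurableT (C ^+ 2) (L2_integrable f2).
by move=> /(integrable_lty measurableT); under eq_integral do rewrite -EFinM.
Qed.

Lemma res_add_in (D E : set R) F x : [disjoint D & E] ->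
  res (D `|` E) F x = res D F x + res E F x.
Proof.
move=> /disj_setPLR DE; have [Dx|Dx] := pselect (D x).
  by rewrite (res_in _ Dx) res_in ?res_out ?addr0//; [exact: DE|left].
have [Ex|Ex] := pselect (E x).
  by rewrite (res_in _ Ex) res_in ?res_out ?add0r//; right.
by rewrite !res_out ?addr0// => -[].
Qed.

Lemma cigr_res (D : set R) F : measurable D -> cigr F -> cigr (res D F).
Proof.
move=> mD Fi; have := @cigr_bounded _ F (fun x => (\1_D x)%:C) 1 Fi.
rewrite (_ : (fun x => F x * (\1_D x)%:C) = res D F); last first.
  by apply/funext => x; rewrite /res mulrC.
apply; first exact/cmeas_real/measurable_indic.
by move=> x; rewrite cabs_real indicE ger0_norm//; case: (_ \in _).
Qed.

Lemma cint_tile (P a : R) (n : nat) F : 0 < P -> cigr F ->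
  cint (res (`[a, a + n%:R * P[%classic : set R) F) =
  \sum_(k < n) cint (res (`[0, P[%classic : set R) (fun x => F (x + (a + k%:R * P)))).
Proof.
move=> P0 Fi; elim: n => [|n ih].
  rewrite mul0r addr0 set_itvco0 big_ord0 -[RHS](@cint0 R); congr cintegral.
  by apply/funext => x; rewrite res_out.
have nP : a + n.+1%:R * P = a + n%:R * P + P by rewrite -(@natr1 _ n); ring.
rewrite big_ord_recr/= -ih.
have dis : [disjoint (`[a, a + n%:R * P[%classic : set R) & `[a + n%:R * P, a + n.+1%:R * P[%classic].
  by apply: lt_disjoint => x y; rewrite !in_itv/= => /andP[_ H] /andP[+ _]; exact: lt_le_trans.
rewrite (_ : res _ F = (fun x => res (`[a, a + n%:R * P[%classic : set R) F x +
    res (`[a + n%:R * P, a + n.+1%:R * P[%classic : set R) F x)); last first.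
  apply/funext => x; rewrite -res_add_in//; congr (res _ _ _).
  apply: itv_bndbnd_setU; first by rewrite bnd_simp lerDl mulr_ge0// ltW.
  by rewrite bnd_simp nP lerDl ltW.
rewrite cintD; [|by apply: cigr_res => //; exact: measurable_itv..].
congr (_ + _); rewrite -(@cint_shift _ (a + n%:R * P)); last first.
  by apply: cigr_res => //; exact: measurable_itv.
congr cintegral; apply/funext => x.
have [Dx|Dx] := pselect ((`[0, P[%classic : set R) x).
  rewrite !res_in//=; move: Dx; rewrite /= !in_itv/= nP => /andP[H1 H2]; apply/andP; split; lra.
rewrite !res_out//=; move: Dx; rewrite /= !in_itv/= nP => H1 /andP[H2 H3].
by apply: H1; apply/andP; split; lra.
Qed.

End BandLimited.

(** * Measurability of matrix-valued functions *)

Section MeasurableMatrices.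
Context {R : realType}.

Definition mcmeas m n (M : R -> 'M[R[i]]_(m, n)) := forall i j, cmeas (fun x => M x i j).

Lemma mcmeasM m n p (A : R -> 'M[R[i]]_(m, n)) (B : R -> 'M[R[i]]_(n, p)) :
  mcmeas A -> mcmeas B -> mcmeas (fun x => A x *m B x).
Proof.
move=> mA mB i j; under eq_fun do rewrite mxE.
by apply: cmeas_sum => k _; exact: cmeasM.
Qed.

Lemma mcmeas_adjm m n (A : R -> 'M[R[i]]_(m, n)) : mcmeas A -> mcmeas (fun x => adjm (A x)).
Proof. by move=> mA i j; under eq_fun do rewrite !mxE; exact: cmeasJ. Qed.

Lemma cmeas_det n (A : R -> 'M[R[i]]_n) : mcmeas A -> cmeas (fun x => \det (A x)).
Proof.
move=> mA; apply: cmeas_sum => s _; apply: cmeasM; first exact: cmeas_cst.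
by apply: cmeas_prod => i _; exact: mA.
Qed.

Lemma mcmeas_adj n (A : R -> 'M[R[i]]_n) : mcmeas A -> mcmeas (fun x => \adj (A x)).
Proof.
move=> mA i j; under eq_fun do rewrite mxE /cofactor.
apply: cmeasM; first exact: cmeas_cst.
by apply: cmeas_det => a b; under eq_fun do rewrite !mxE; exact: mA.
Qed.

Lemma measurable_rn2 n (v : R -> 'rV[R[i]]_n) : mcmeas v ->
  measurable_fun setT (fun x => rn2 (v x)).
Proof. by move=> mv; apply: measurable_sum => j; apply: measurable_cabs2; exact: mv. Qed.

End MeasurableMatrices.

(** * Frame sums as integrals over one period *)

Section Periodization.
Context {R : realType}.
Local Notation mu := (@lebesgue_measure R).
Variables (w t0 h : R) (l : nat) (phi : 'I_(2 * l) -> R -> R[i]).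
Hypothesis t00 : 0 < t0.
Hypothesis hE : h = 2 * pi / t0.
Hypothesis wlh : w <= l%:R * h.
Hypothesis phiB : forall j, bandlimited w (phi j).

Local Notation N := (2 * l)%N.
Local Notation P j := (fourier (phi j)).
Local Notation D := (`[0, h[%classic : set R).

Definition nodek (k : nat) : R := (k%:R - l%:R) * h.

Lemma period_gt0 : 0 < h.
Proof. by rewrite hE divr_gt0// mulr_gt0// pi_gt0. Qed.

Lemma L2_phi j : L2 (phi j).
Proof. by case: (phiB j). Qed.

Lemma L2_fourier_phi j : L2 (P j).
Proof. exact/L2_fourier/L2_phi. Qed.

Lemma fourier_phi_off_band j : {ae mu, forall x, ~ (`[- w, w]%classic : set R) x -> P j x = 0}.
Proof. by have /bandlimitedP[] := phiB j. Qed.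

(* Conjugated, so that the entries of [samples F x *m pre_gramian h phi x] are sqrt h times
   the conjugates of [gram_fun F j x] below. *)
Definition samples (F : R -> R[i]) (x : R) : 'rV[R[i]]_N := \row_k (F (x + nodek k))^*.

(** The h-periodization of F times the conjugate of [P j], read on one period; 2l cells are enough
    since they cover the band. *)
Definition gram_fun (F : R -> R[i]) (j : 'I_N) : R -> R[i] :=
  res D (fun x => \sum_(k < N) F (x + nodek k) * (P j (x + nodek k))^*).

Lemma L2_gram_fun F j : L2 (fun x => F x * (P j x)^*) -> L2 (gram_fun F j).
Proof.
move=> FP; apply: L2_res; first exact: measurable_itv.
by apply: L2_sum => k; exact: (L2_shift (nodek k) FP).
Qed.

Lemma nodek_itv : (- (l%:R * h) + N%:R * h = l%:R * h)%R.
Proof. by rewrite natrM; ring. Qed.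

Lemma nodekE k : nodek k = - (l%:R * h) + k%:R * h.
Proof. by rewrite /nodek; ring. Qed.

(** The half-open window contains the band, except possibly the endpoint [l h]. *)
Lemma off_window x : ~ (`[- (l%:R * h), - (l%:R * h) + N%:R * h[%classic : set R) x ->
  x <> l%:R * h -> ~ (`[- w, w]%classic : set R) x.
Proof.
rewrite nodek_itv /= !in_itv/= => H xl /andP[x1 x2]; apply: H.
have x3 : x <= l%:R * h := le_trans x2 wlh.
by rewrite lt_neqAle x3 andbT; apply/andP; split; [have := wlh; lra|apply/eqP].
Qed.

(** By Plancherel and the translation rule, the coefficient is an integral against [expi (n t0 x)].
    Since [t0 * h = 2 * pi] this character has period h, so the cells of the band can be folded onto
    one period. *)
Lemma frame_coef f j n : bandlimited w f ->
  inner f (frame_elt t0 phi j n) = inner (gram_fun (fourier f) j) (bchar 0 h n).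
Proof.
move=> /bandlimitedP[f2 fw]; have F2 := L2_fourier f2.
have e2' : L2 (frame_elt t0 phi j n) by apply: L2_shift; exact: L2_phi.
rewrite -(inner_fourier f2 e2').
pose E x : R[i] := expi (n%:~R * t0 * x).
have mE : cmeas E by apply: cmeas_expiM; exact: measurable_funM.
have E1 x : cabs (E x) <= 1 by rewrite cabs_expi.
have EP2 : L2 (fun x => E x * P j x) := L2_bounded_mul mE E1 (L2_fourier_phi j).
rewrite (ae_eq_innerr (L2_fourier e2') EP2 F2 (fourier_translate _ (L2_phi j))).
pose K x := fourier f x * (E x * P j x)^*.
have Ki : cigr K := cigrMJ F2 EP2.
have -> : inner (fourier f) (fun x => E x * P j x) =
    cint (res (`[- (l%:R * h), - (l%:R * h) + N%:R * h[%classic : set R) K).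
  apply: ae_eq_cint => //; first by apply: cigr_res => //; exact: measurable_itv.
  apply: (aeS2 _ fw (ae_neq (l%:R * h))) => x xw xl.
  have [Dx|Dx] := pselect ((`[- (l%:R * h), - (l%:R * h) + N%:R * h[%classic : set R) x).
    by rewrite res_in.
  by rewrite res_out// xw ?mul0r//; exact: off_window.
rewrite (cint_tile _ _ period_gt0 Ki) -cint_sum; last first.
  by move=> k; apply: cigr_res; [exact: measurable_itv|exact: cigr_shift].
rewrite /inner; congr cintegral; apply/funext => x.
have [Dx|Dx] := pselect (D x); last first.
  by rewrite /gram_fun res_out// mul0r big1// => k _; rewrite res_out.
rewrite /gram_fun (res_in _ Dx) mulr_suml; apply: eq_bigr => k _.
rewrite (res_in _ Dx) /K -nodekE rmorphM/= -[RHS]mulrA; congr (_ * _).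
rewrite mulrC; congr (_ * _); congr (_^*).
rewrite /bchar res_in ?add0r// /E /echar.
(* The shift by the k-th node changes the phase by [n * (k - l)] full turns. *)
rewrite -[RHS](expi_periodic _ (n * (k%:Z - l%:Z))); congr expi.
have -> : t0 = 2 * pi / h.
  have := gt_eqF t00; have := gt_eqF (pi_gt0 R); rewrite hE.
  by move: (pi : R) => p p0 t0'; field; rewrite p0 t0'.
rewrite /nodek intrM intrB -!pmulrn; field; rewrite gt_eqF//; exact: period_gt0.
Qed.

Lemma mcmeas_samples F : cmeas F -> mcmeas (samples F).
Proof.
move=> mF i k; under eq_fun do rewrite mxE.
by apply: cmeasJ; exact: (cmeas_comp (measurable_shift _) mF).
Qed.

Lemma mcmeas_gramian : mcmeas (pre_gramian h phi).
Proof.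
move=> k j; under eq_fun do rewrite mxE.
apply: cmeasM; first exact: cmeas_cst.
apply: (cmeas_comp (measurable_shift _)); exact/L2_meas/L2_fourier_phi.
Qed.

(** Parseval's identity for each [gram_fun]; the factor h due to the unnormalized characters is
    absorbed by the [sqrt h] in the pre-Gramian. *)
Lemma frame_sum f : bandlimited w f ->
  (forall j, L2 (fun x => fourier f x * (P j x)^*)) ->
  (\sum_(j < N) \esum_(n in [set: int]) ((cabs (inner f (frame_elt t0 phi j n)) ^+ 2)%:E) =
   \int[mu]_(x in D) (rn2 (samples (fourier f) x *m pre_gramian h phi x))%:E)%E.
Proof.
move=> fB FP.
transitivity (\sum_(j < N) (h * nn (gram_fun (fourier f) j))%:E)%E.
  apply: eq_bigr => j _.
  rewrite -(@parseval_esum _ 0 h period_gt0 _ (L2_gram_fun (FP j))).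
    apply: eq_esum => n _; congr (cabs _ ^+ 2)%:E; exact: frame_coef.
  by rewrite add0r => x Dx; rewrite /gram_fun res_out.
transitivity (\sum_(j < N) \int[mu]_(x in D) (cabs ((samples (fourier f) x *m pre_gramian h phi x) 0 j) ^+ 2)%:E)%E.
  apply: eq_bigr => j _; rewrite EFinM -e2E; last exact: L2_gram_fun.
  rewrite /e2 -ge0_integralZl//;
    [|by apply: measurable_cabs2E; exact/L2_meas/L2_gram_fun
     |by move=> x _; rewrite lee_fin sqr_ge0|by rewrite lee_fin ltW// period_gt0].
  rewrite [RHS]integral_mkcond; apply: eq_integral => x _; rewrite patchE -EFinM.
  case: ifPn => [/set_mem Dx|/negP Dx]; last first.
    by rewrite /gram_fun res_out ?cabs0 ?expr0n ?mulr0// => Dx'; apply: Dx; exact: mem_set.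
  rewrite /gram_fun res_in// mxE.
  have -> : \sum_(k < N) samples (fourier f) x 0 k * pre_gramian h phi x k j =
      (Num.sqrt h)%:C * (\sum_(k < N) fourier f (x + nodek k) * (P j (x + nodek k))^*)^*.
    rewrite rmorph_sum mulr_sumr; apply: eq_bigr => k _.
    by rewrite !mxE /= rmorphM/= conjCK mulrCA.
  rewrite cabsM cabsJ exprMn cabs_real ger0_norm ?sqrtr_ge0// sqr_sqrtr//.
  exact/ltW/period_gt0.
rewrite -ge0_integral_sum//=.
- by apply: eq_integral => x _; rewrite sumEFin.
- move=> j; apply: (measurable_funS measurableT) => //; apply: measurable_cabs2E.
  apply: mcmeasM; last exact: mcmeas_gramian.
  by apply: mcmeas_samples; case: fB => f2 _; exact/L2_meas/L2_fourier.
- by move=> j x _; rewrite lee_fin sqr_ge0.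
Qed.

Lemma nn_samples f : bandlimited w f ->
  (e2 f = \int[mu]_(x in D) (rn2 (samples (fourier f) x))%:E)%E.
Proof.
move=> /bandlimitedP[f2 fw]; have F2 := L2_fourier f2.
rewrite e2E// -nn_fourier// -e2E//.
have mF := measurable_cabs2E (L2_meas F2).
have F0 (x : R) : (0 <= (cabs (fourier f x) ^+ 2)%:E)%E by rewrite lee_fin sqr_ge0.
transitivity (\int[mu]_(x in `[(- (l%:R * h))%R, (- (l%:R * h) + N%:R * h)%R[)
    (cabs (fourier f x) ^+ 2)%:E)%E.
  rewrite [RHS]integral_mkcond; apply: ae_eq_integral => //.
    by apply/(measurable_restrictT _ (measurable_itv _)); exact: (measurable_funS measurableT).
  apply: (aeS2 _ fw (ae_neq (l%:R * h))) => x xw xl _; rewrite patchE.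
  case: ifPn => // /negP Dx; rewrite xw ?cabs0 ?expr0n//.
  by apply: off_window => // Dx'; apply: Dx; exact: mem_set.
rewrite ge0_integral_tile ?period_gt0// -ge0_integral_sum//=.
- apply: eq_integral => x _; rewrite sumEFin; congr EFin; apply: eq_bigr => k _.
  by rewrite mxE cabsJ nodekE.
- move=> k; apply: (measurable_funS measurableT) => //.
  exact: (measurableT_comp mF (measurable_shift _)).
Qed.

End Periodization.

(** * Pointwise conditions *)

Section FrameToPointwise.
Context {R : realType}.
Local Notation mu := (@lebesgue_measure R).

Lemma ae_forall_ord n (P : 'I_n -> R -> Prop) : (forall k, {ae mu, forall x, P k x}) ->
  {ae mu, forall x, forall k, P k x}.
Proof.
move=> aeP; have : {ae mu, forall x, forall m : nat,
    if insub m is Some k then P k x else True}.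
  by apply: ae_foralln => m; case: insub => [k|]; [exact: aeP|exact: nearW].
by apply: aeS => x H k; have := H k; rewrite valK.
Qed.

(** The hypothesis is applied to the bad set where [q < p], cut by [b <= m]. The cut restricts the
    hypothesis to sets where b is bounded, and the finiteness of the integral of q allows the
    subtraction. *)
Lemma ae_le_of_integrals (p q b : R -> R) (D : set R) : measurable D ->
  measurable_fun setT p -> measurable_fun setT q -> measurable_fun setT b ->
  (forall x, 0 <= p x) -> (forall x, 0 <= q x) ->
  (forall (E : set R) (m : nat), measurable E -> E `<=` D -> (forall x, E x -> b x <= m%:R) ->
    (\int[mu]_(x in E) (p x)%:E <= \int[mu]_(x in E) (q x)%:E < +oo)%E) ->
  {ae mu, forall x, D x -> p x <= q x}.
Proof.
move=> mD mp mq mb p0 q0 H.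
pose E (m : nat) := D `&` ([set x | q x < p x] `&` [set x | b x <= m%:R]).
have mE m : measurable (E m).
  apply: measurableI => //; apply: measurableI.
    rewrite (_ : [set x | _] = setT `&` (fun x => p x - q x) @^-1` `]0, +oo[%classic).
      by apply: measurable_funB.
    by rewrite setTI; apply/seteqP; split => x; rewrite /= in_itv/= andbT subr_gt0.
  rewrite (_ : [set x | _] = setT `&` b @^-1` `]-oo, m%:R]%classic); first exact: mb.
  by rewrite setTI; apply/seteqP; split => x; rewrite /= in_itv.
suff : {ae mu, forall x, forall m, ~ E m x}.
  apply: aeS => x Ex Dx; rewrite leNgt; apply/negP => qp.
  apply: (Ex (Num.trunc (b x)).+1); split => //; split => //=.
  exact/ltW/Num.Theory.truncnS_gt.
apply: ae_foralln => m.
have /andP[H1 H2] := H (E m) m (mE m) (@subIsetl _ _ _) (fun x Ex => Ex.2.2).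
have d0 x : E m x -> (0 <= (p x - q x)%:E)%E.
  by move=> [_ [qp _]]; rewrite lee_fin subr_ge0 ltW.
have mpq : measurable_fun (E m) (fun x => (p x - q x)%:E).
  by apply: (measurable_funS measurableT) => //; apply/measurable_EFinP; exact: measurable_funB.
have : (\int[mu]_(x in E m) `|(p x - q x)%:E| = 0)%E.
  under eq_integral => x /set_mem Ex do rewrite gee0_abs ?d0//.
  have E1 : (\int[mu]_(x in E m) (p x)%:E =
      \int[mu]_(x in E m) (q x)%:E + \int[mu]_(x in E m) (p x - q x)%:E)%E.
    rewrite -ge0_integralD//.
    - by apply: eq_integral => x _; rewrite -EFinD addrC subrK.
    - exact: mE.
    - by move=> x _; rewrite lee_fin.
    - by apply: (measurable_funS measurableT) => //; apply/measurable_EFinP.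
  have qf : (\int[mu]_(x in E m) (q x)%:E)%E \is a fin_num.
    by rewrite ge0_fin_numE//; apply: integral_ge0 => x _; rewrite lee_fin.
  move: H1; rewrite E1 -{2}[(\int[mu]_(x in E m) (q x)%:E)%E]adde0 leeD2lE// => I0.
  by apply/eqP; rewrite eq_le I0/=; exact: integral_ge0.
move=> /(ae_eq_integral_abs mu (mE m) mpq); apply: aeS => x Hx Ex.
have [] := Hx Ex; move/eqP; rewrite subr_eq0 => /eqP pq.
by case: Ex => _ [/=]; rewrite pq ltxx.
Qed.

Definition extend0 n (k : 'I_n) (v : 'rV[R[i]]_n.-1) : 'rV[R[i]]_n :=
  \row_j if unlift k j is Some i then v 0 i else 0.

Lemma rn2_extend0 n (k : 'I_n) (v : 'rV[R[i]]_n.-1) : rn2 (extend0 k v) = rn2 v.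
Proof.
rewrite /rn2 (bigD1_ord k)//= mxE unlift_none cabs0 expr0n/= add0r.
by apply: eq_bigr => i _; rewrite mxE liftK.
Qed.

Lemma extend0_mul n m (k : 'I_n) (v : 'rV[R[i]]_n.-1) (M : 'M[R[i]]_(n, m)) :
  extend0 k v *m M = v *m row' k M.
Proof.
apply/rowP => j; rewrite !mxE (bigD1_ord k)//= mxE unlift_none mul0r add0r.
by apply: eq_bigr => i _; rewrite !mxE liftK.
Qed.

Lemma mcmeas_extend0 n (k : 'I_n) (v : R -> 'rV[R[i]]_n.-1) : mcmeas v ->
  mcmeas (fun x => extend0 k (v x)).
Proof.
move=> mv i j; under eq_fun do rewrite mxE.
by case: (unlift k j) => [i'|]; [exact: mv|exact: cmeas_cst].
Qed.

(** The bound [A^n] is what n eigenvalues at least A would give. Since the null set in the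
    hypothesis varies with v, no minimization over vectors is possible at a fixed x; induction on
    rows applies the hypothesis to one measurable field per step, the first row of the adjugate, and
    to fields extended by 0 on the removed row. *)
Lemma gram_det_ae n m (K : R -> 'M[R[i]]_(n, m)) (E : set R) (A : R) : 0 < A -> mcmeas K ->
  (forall v : R -> 'rV[R[i]]_n, mcmeas v ->
    {ae mu, forall x, E x -> A * rn2 (v x) <= rn2 (v x *m K x)}) ->
  {ae mu, forall x, E x -> A ^+ n <= cabs (\det (K x *m adjm (K x)))}.
Proof.
move=> A0; elim: n K => [|n ih] K mK HK.
  by apply: nearW => x _; rewrite det_mx00 cabs1.
have mK' : mcmeas (fun x => row' ord0 (K x)).
  by move=> i j; under eq_fun do rewrite mxE; exact: mK.
have := ih _ mK'; move=> /(_ _)/wrap[].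
  move=> v mv; apply: aeS (HK _ (@mcmeas_extend0 n.+1 ord0 v mv)) => x + Ex.
  by move=> /(_ Ex); rewrite rn2_extend0 extend0_mul.
have mr : mcmeas (fun x => row ord0 (\adj (K x *m adjm (K x)))).
  move=> i j; under eq_fun do rewrite mxE.
  by apply: mcmeas_adj; apply: mcmeasM => //; exact: mcmeas_adjm.
move=> H1; apply: (aeS2 _ H1 (HK _ mr)) => x h1 h2 Ex.
by apply: gram_det_step => //; [exact: h1|exact: h2].
Qed.

Lemma increasing_lift n (k : 'I_n.+1) : increasing_ffun [ffun i => lift k i].
Proof.
apply/forallP => i; apply/forallP => j; apply/implyP => ij; rewrite !ffunE /=.
by rewrite ltnNge leq_bump2 -ltnNge.
Qed.

(** Deleting one more column gives [n.+1] minors, each of them a single term of the double sum and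
    so at most the whole of it. *)
Lemma gram_det_le_sum_sq_minors n (J : 'M[R[i]]_n.+1) (k : 'I_n.+1) :
  cabs (\det (row' k J *m adjm (row' k J))) <= n.+1%:R * sum_sq_minors n J.
Proof.
apply: (le_trans (gram_det_le_minors _)).
rewrite mulr_natl -[X in _ *+ X](card_ord n.+1) -sumr_const; apply: ler_sum => j _.
rewrite /sum_sq_minors (bigD1 [ffun i => lift k i]) ?increasing_lift//=.
rewrite (bigD1 [ffun i => lift j i]) ?increasing_lift//= -addrA.
rewrite (_ : mxsub _ _ J = col' j (row' k J)); last first.
  by apply/matrixP => a b; rewrite !mxE !ffunE.
rewrite lerDl addr_ge0//; first by apply: sumr_ge0 => g _; rewrite sqr_ge0.
by apply: sumr_ge0 => f _; apply: sumr_ge0 => g _; rewrite sqr_ge0.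
Qed.

Variables (w t0 h : R) (l : nat) (phi : 'I_(2 * l) -> R -> R[i]).
Hypothesis w0 : 0 < w.
Hypothesis t00 : 0 < t0.
Hypothesis hE : h = 2 * pi / t0.
Hypothesis wlh : w <= l%:R * h.
Hypothesis phiB : forall j, bandlimited w (phi j).

Local Notation N := (2 * l)%N.
Local Notation P j := (fourier (phi j)).
Local Notation D := (`[0, h[%classic : set R).
Local Notation node k := (nodek h l k).
Local Notation J := (pre_gramian h phi).

Let h0 : 0 < h := period_gt0 t00 hE.

Lemma window_cover y : - (l%:R * h) <= y -> y < l%:R * h -> exists k : 'I_N, D (y - node k).
Proof.
move=> y1 y2; have q0 : 0 <= (y + l%:R * h) / h by apply: divr_ge0; [lra|exact: ltW].
have /andP[t1 t2] := Num.Theory.truncn_itv q0.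
set k := Num.trunc _ in t1 t2.
have kN : (k < N)%N.
  rewrite -(ltr_nat R); apply: (le_lt_trans t1); rewrite ltr_pdivrMr// natrM; lra.
exists (Ordinal kN); rewrite /= in_itv/= nodekE/=.
move: t1 t2; rewrite ler_pdivlMr// ltr_pdivrMr// -(@natr1 _ k) => t1 t2.
by apply/andP; split; lra.
Qed.

Lemma window_unique x (j k : 'I_N) : D x -> D (x + node k - node j) -> j = k.
Proof.
rewrite /= !in_itv/= !nodekE => /andP[x1 x2] /andP[y1 y2].
have H : `|k%:R - j%:R| * h < 1 * h.
  rewrite mul1r -[X in _ * X](@ger0_norm _ h) ?(ltW h0)// -normrM ltr_norml mulrBl.
  apply/andP; split; lra.
apply/val_inj => /=; move: H; rewrite ltr_pM2r// ltr_norml => /andP[H1 H2].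
have : (k%:R < j.+1%:R :> R) by rewrite -(@natr1 _ j); lra.
have : (j%:R < k.+1%:R :> R) by rewrite -(@natr1 _ k); lra.
rewrite !ltr_nat; lia.
Qed.

(** Encodes the admissible vectors: the k-th coordinate may be nonzero at x only if the
    corresponding translate of x lies in the band. *)
Definition live (k : 'I_N) (x : R) := (`[- w, w]%classic : set R) (x + node k).

(** The coordinates of v, laid side by side along the band, form a bounded function of bounded
    support, so its inverse transform is given by an integral. *)
Lemma realize_samples (v : R -> 'rV[R[i]]_N) (C : R) : mcmeas v ->
  (forall x k, cabs (v x 0 k) <= C) -> (forall x, ~ D x -> v x = 0) ->
  (forall x k, ~ live k x -> v x 0 k = 0) ->
  exists f, [/\ bandlimited w f, {ae mu, forall x, D x -> samples h l (fourier f) x = v x} &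
    {ae mu, forall x, cabs (fourier f x) <= N%:R * C}].
Proof.
move=> mv vC vD vlive.
(* At most one term is nonzero, as v vanishes off the period; the conjugation undoes the one in
   [samples]. *)
pose F y := \sum_(k < N) (v (y - node k) 0 k)^*.
have C0 (k : 'I_N) : 0 <= C by apply: le_trans (vC 0 k); exact: cabs_ge0.
have mF : cmeas F.
  apply: cmeas_sum => k _; apply: cmeasJ; exact: (cmeas_comp (measurable_shift _) (mv 0 k)).
have FC y : cabs (F y) <= N%:R * C.
  apply: (le_trans (@cabs_sum _ _ _ _ _)).
  rewrite mulr_natl -[X in _ *+ X](card_ord N) -sumr_const; apply: ler_sum => k _.
  by rewrite cabsJ.
have F0 y : ~ (`[- w, w]%classic : set R) y -> F y = 0.
  move=> yw; rewrite /F big1// => k _; rewrite vlive ?conjC0//.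
  by rewrite /live subrK.
have F2 : L2 F.
  apply: (@L2_dom _ _ (fun x => (N%:R * C) ^+ 2 * \1_(`[- w, w]%classic) x)) => //.
    move=> x; have [xw|xw] := pselect ((`[- w, w]%classic : set R) x).
      rewrite indicE mem_set// mulr1 ler_pXn2r ?nnegrE ?cabs_ge0//.
      exact: le_trans (cabs_ge0 _) (FC x).
    by rewrite F0// cabs0 expr0n indicE memNset// mulr0.
  exact: (integrableZl measurableT _ (integrable_indic_itv _ _ _ _)).
have cF : csupp F.
  split => //; exists (w + 1); first by rewrite addr_gt0.
  move=> x wx; apply: F0; rewrite /= in_itv/= -ler_norml => xw.
  by move: (le_trans wx xw); rewrite gerDl ler10.
have fF := fourier_IFT cF.
exists (IFT F); split.
- apply/bandlimitedP; split; first exact: L2_IFT.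
  by apply: aeS fF => x -> /F0.
- have := ae_forall_ord (fun k : 'I_N => ae_shift (node k) fF).
  apply: aeS => x Fx Dx; apply/rowP => k; rewrite mxE Fx /F (bigD1 k)//= big1 ?addr0.
    by rewrite conjCK addrK.
  move=> j jk; rewrite vD ?mxE ?conjC0// => Dj.
  by move/eqP: jk; apply; exact: window_unique Dj.
- by apply: aeS fF => x ->.
Qed.

Variables (A B : R).
Hypothesis A0 : 0 < A.
Hypothesis AB : A <= B.
Hypothesis frameAB : forall f, bandlimited w f ->
  let S := (\sum_(j < N) \esum_(n in [set: int])
                  ((cabs (inner f (frame_elt t0 phi j n)) ^+ 2)%:E))%E in
  (A%:E * L2norm f ^+ 2 <= S /\ S <= B%:E * L2norm f ^+ 2)%E.

Lemma frame_integral (v : R -> 'rV[R[i]]_N) (C : R) : mcmeas v ->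
  (forall x k, cabs (v x 0 k) <= C) -> (forall x, ~ D x -> v x = 0) ->
  (forall x k, ~ live k x -> v x 0 k = 0) ->
  (A%:E * \int[mu]_(x in D) (rn2 (v x))%:E <= \int[mu]_(x in D) (rn2 (v x *m J x))%:E /\
   \int[mu]_(x in D) (rn2 (v x *m J x))%:E <= B%:E * \int[mu]_(x in D) (rn2 (v x))%:E)%E.
Proof.
move=> mv vC vD vlive.
have [f [fB fv fC]] := realize_samples mv vC vD vlive.
have [f2 _] := fB; have F2 := L2_fourier f2.
have mD : measurable D by exact: measurable_itv.
have mJ := mcmeas_gramian h phiB.
have ms : mcmeas (samples h l (fourier f)) := @mcmeas_samples R h l _ (L2_meas F2).
have e1 : (\int[mu]_(x in D) (rn2 (samples h l (fourier f) x))%:E =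
    \int[mu]_(x in D) (rn2 (v x))%:E)%E.
  apply: ae_eq_integral => //.
  - by apply/measurable_EFinP; apply: (measurable_funS measurableT) => //; exact: measurable_rn2.
  - by apply/measurable_EFinP; apply: (measurable_funS measurableT) => //; exact: measurable_rn2.
  - by apply: aeS fv => x fv Dx; rewrite fv.
have e2' : (\int[mu]_(x in D) (rn2 (samples h l (fourier f) x *m J x))%:E =
    \int[mu]_(x in D) (rn2 (v x *m J x))%:E)%E.
  apply: ae_eq_integral => //.
  - apply/measurable_EFinP; apply: (measurable_funS measurableT) => //.
    by apply: measurable_rn2; exact: mcmeasM.
  - apply/measurable_EFinP; apply: (measurable_funS measurableT) => //.
    by apply: measurable_rn2; exact: mcmeasM.
  - by apply: aeS fv => x fv Dx; rewrite fv.
have := frameAB fB; cbv zeta; rewrite L2norm_sqr.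
rewrite (frame_sum t00 hE wlh phiB fB); last first.
  move=> j; apply: (L2_ae_bounded_mul (L2_meas F2) fC).
  by apply: L2J; exact: L2_fourier_phi phiB j.
by rewrite (nn_samples t00 hE wlh fB) e1 e2'.
Qed.

(** Only bounded fields come from [realize_samples], so v is cut to measurable sets E on which its
    norm is bounded; letting E vary localizes the integral inequalities. *)
Lemma frame_pointwise (v : R -> 'rV[R[i]]_N) : mcmeas v ->
  (forall x k, ~ live k x -> v x 0 k = 0) ->
  {ae mu, forall x, D x -> A * rn2 (v x) <= rn2 (v x *m J x) <= B * rn2 (v x)}.
Proof.
move=> mv vlive.
have mD : measurable D by exact: measurable_itv.
have mJ := mcmeas_gramian h phiB.
have B0 : 0 < B by exact: lt_le_trans AB.
have mr : measurable_fun setT (fun x => rn2 (v x)) by exact: measurable_rn2.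
have mrJ : measurable_fun setT (fun x => rn2 (v x *m J x)).
  by apply: measurable_rn2; exact: mcmeasM.
have key (E : set R) (m : nat) : measurable E -> E `<=` D -> (forall x, E x -> rn2 (v x) <= m%:R) ->
    (A%:E * \int[mu]_(x in E) (rn2 (v x))%:E <= \int[mu]_(x in E) (rn2 (v x *m J x))%:E /\
     \int[mu]_(x in E) (rn2 (v x *m J x))%:E <= B%:E * \int[mu]_(x in E) (rn2 (v x))%:E)%E /\
    (\int[mu]_(x in E) (rn2 (v x))%:E < +oo)%E.
  move=> mE ED Em; split; last first.
    apply: (@le_lt_trans _ _ (\int[mu]_(x in E) (m%:R)%:E)%E).
      apply: ge0_le_integral => //.
      - by move=> x _; rewrite lee_fin rn2_ge0.
      - by apply/measurable_EFinP; exact: (measurable_funS measurableT).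
    rewrite integral_cst// lte_mul_pinfty ?lee_fin//.
    apply: (@le_lt_trans _ _ (mu D)); first by apply: le_measure; rewrite ?inE.
    by rewrite lebesgue_measure_itv/= lte_fin h0 sube0 ltry.
  pose vE x : 'rV[R[i]]_N := (\1_E x)%:C *: v x.
  have vEi x : E x -> vE x = v x by move=> Ex; rewrite /vE indicE mem_set// scale1r.
  have vEo x : ~ E x -> vE x = 0 by move=> Ex; rewrite /vE indicE memNset// scale0r.
  have ext (p : 'rV[R[i]]_N -> R -> R) : (forall x, p 0 x = 0) ->
      (\int[mu]_(x in D) (p (vE x) x)%:E = \int[mu]_(x in E) (p (v x) x)%:E)%E.
    move=> p0; rewrite [LHS]integral_mkcond [RHS]integral_mkcond.
    apply: eq_integral => x _; rewrite !patchE.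
    have [Ex|Ex] := pselect (E x).
      by rewrite !mem_set ?vEi//; exact: ED.
    by rewrite [X in _ = if X then _ else _]memNset// vEo// p0; case: ifP.
  (* A real c with [c ^+ 2 <= m] satisfies [c <= m + 1]. *)
  have := @frame_integral vE (m%:R + 1) _ _ _ _.
  rewrite (ext (fun u _ => rn2 u)); last first.
    by move=> _; rewrite /rn2 big1// => k _; rewrite mxE cabs0 expr0n.
  rewrite (ext (fun u x => rn2 (u *m J x))); last first.
    by move=> x; rewrite mul0mx /rn2 big1// => k _; rewrite mxE cabs0 expr0n.
  apply.
  - move=> i k; under eq_fun do rewrite mxE.
    by apply: cmeasM; [exact/cmeas_real/measurable_indic|exact: mv].
  - move=> x k; have [Ex|Ex] := pselect (E x); last first.
      by rewrite vEo// mxE cabs0 addr_ge0.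
    rewrite vEi//; have := le_trans (cabs2_le_rn2 (v x) k) (Em x Ex).
    have := cabs_ge0 (v x 0 k); have : (0 <= m%:R :> R) by []. 
    set c := cabs _; set M := m%:R => M0 c0 cM; nra.
  - by move=> x Dx; apply: vEo => /ED.
  - by move=> x k lx; rewrite /vE mxE vlive// mulr0.
have lo : {ae mu, forall x, D x -> A * rn2 (v x) <= rn2 (v x *m J x)}.
  apply: (@ae_le_of_integrals (fun x => A * rn2 (v x)) (fun x => rn2 (v x *m J x)) (fun x => rn2 (v x))) => //.
  - exact: measurable_funM.
  - by move=> x; rewrite mulr_ge0 ?rn2_ge0// ltW.
  - by move=> x; rewrite rn2_ge0.
  move=> E m mE ED Em; have [[k1 k2] k3] := key E m mE ED Em.
  apply/andP; split.
    under eq_integral do rewrite EFinM.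
    rewrite ge0_integralZl ?lee_fin ?(ltW A0)//.
    - by apply/measurable_EFinP; exact: (measurable_funS measurableT).
    - by move=> x _; rewrite lee_fin rn2_ge0.
  by apply: (le_lt_trans k2); rewrite lte_mul_pinfty ?lee_fin// ltW.
have up : {ae mu, forall x, D x -> rn2 (v x *m J x) <= B * rn2 (v x)}.
  apply: (@ae_le_of_integrals (fun x => rn2 (v x *m J x)) (fun x => B * rn2 (v x)) (fun x => rn2 (v x))) => //.
  - exact: measurable_funM.
  - by move=> x; rewrite rn2_ge0.
  - by move=> x; rewrite mulr_ge0 ?rn2_ge0// ltW.
  move=> E m mE ED Em; have [[k1 k2] k3] := key E m mE ED Em.
  have e1 : (\int[mu]_(x in E) (B * rn2 (v x))%:E = B%:E * \int[mu]_(x in E) (rn2 (v x))%:E)%E.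
    under eq_integral do rewrite EFinM.
    rewrite ge0_integralZl ?lee_fin ?(ltW B0)//.
    - by apply/measurable_EFinP; exact: (measurable_funS measurableT).
    - by move=> x _; rewrite lee_fin rn2_ge0.
  by rewrite e1 k2/= lte_mul_pinfty ?lee_fin// ltW.
by apply: (aeS2 _ lo up) => x h1 h2 Dx; rewrite h1// h2.
Qed.

End FrameToPointwise.

(** * Lower bounds from minors of a matrix with a zero row *)

Section MinorBounds.
Context {R : realType}.

Lemma increasing_inj n m (f : {ffun 'I_n -> 'I_m}) : increasing_ffun f -> injective f.
Proof.
move=> /forallP fi i j fij; apply/val_inj/eqP; rewrite eqn_leq.
apply/andP; split; rewrite leqNgt; apply/negP => ij.
  by have /forallP/(_ i)/implyP/(_ ij) := fi j; rewrite fij ltnn.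
by have /forallP/(_ j)/implyP/(_ ij) := fi i; rewrite fij ltnn.
Qed.

Lemma sum_inj_le n m (g : 'I_n -> 'I_m) (a : 'I_m -> R) : injective g ->
  (forall k, 0 <= a k) -> \sum_i a (g i) <= \sum_k a k.
Proof.
move=> gi a0; rewrite (_ : \sum_i a (g i) = \sum_(k in g @: [set: 'I_n]%SET) a k); last first.
  rewrite big_imset; last by move=> i j _ _; exact: gi.
  by apply: eq_bigl => i; rewrite inE.
rewrite [leRHS](bigID [in g @: [set: 'I_n]%SET])/= lerDl.
by apply: sumr_ge0.
Qed.

(** By counting, an injection that misses k has all the other indices as its image. *)
Lemma sum_inj_avoid n (V : zmodType) (f : 'I_n -> 'I_n.+1) (k : 'I_n.+1) (a : 'I_n.+1 -> V) :
  injective f -> (forall i, f i != k) -> a k = 0 -> \sum_i a (f i) = \sum_j a j.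
Proof.
move=> fi fk ak; rewrite (bigD1 k)//= ak add0r.
rewrite (eq_bigl [in f @: [set: 'I_n]%SET]).
  rewrite big_imset; last by move=> i j _ _; exact: fi.
  by apply: eq_bigl => i; rewrite inE.
have -> : f @: [set: 'I_n]%SET = [set~ k]%SET.
  apply/eqP; rewrite eqEcard card_imset// cardsT cardsC1 !card_ord leqnn andbT.
  by apply/fintype.subsetP => _ /imsetP[i _ ->]; rewrite !inE.
by move=> j; rewrite !inE.
Qed.

(** Some minor is large by pigeonhole, and it avoids the zero row k. Its rows carry all of v because
    [v 0 k = 0], so Cramer's rule for this square submatrix suffices. *)
Lemma rn2_le_of_minors n (c sigma : R) : 0 < sigma -> exists2 K : R, 0 < K &
  forall (J : 'M[R[i]]_n.+1) (k : 'I_n.+1), (forall i j, cabs (J i j) <= c) -> (forall j, J k j = 0) ->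
  sigma <= sum_sq_minors n J -> forall v : 'rV[R[i]]_n.+1, v 0 k = 0 -> rn2 v <= K * rn2 (v *m J).
Proof.
move=> s0; pose T := {ffun 'I_n -> 'I_n.+1}; pose M : R := (#|{: T}|)%:R ^+ 2.
have M0 : 0 < M + 1 by rewrite ltr_wpDl// sqr_ge0.
(* M bounds the number of pairs of maps; [M + 1] makes the contradiction with sigma strict. *)
pose tau := sigma / (M + 1).
have tau0 : 0 < tau by rewrite divr_gt0.
have [K K0 HK] := @rn2_le_of_det R n c (Num.sqrt tau) ltac:(by rewrite sqrtr_gt0).
exists K => // J k Jc Jk Js v vk.
have [f [g [fi gi fg]]] : exists f g : T, [/\ increasing_ffun f, increasing_ffun g &
    tau <= cabs (\det (mxsub f g J)) ^+ 2].
  apply: contrapT => H; move: Js; apply/negP; rewrite -ltNge.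
  apply: (@le_lt_trans _ _ (\sum_(f : T) \sum_(g : T) tau)).
    rewrite /sum_sq_minors [leLHS]big_mkcond/=; apply: ler_sum => f _.
    case: ifPn => [fi|_]; last by apply: sumr_ge0 => g _; exact: ltW.
    rewrite big_mkcond/=; apply: ler_sum => g _.
    case: ifPn => [gi|_]; last exact: ltW.
    by rewrite leNgt; apply/negP => fg; apply: H; exists f, g; split => //; exact: ltW.
  rewrite !sumr_const -mulrnA -mulr_natl natrM -expr2 -/M /tau mulrA ltr_pdivrMr//.
  by rewrite mulrC ltr_pM2l// ltrDl.
have finj := increasing_inj fi; have ginj := increasing_inj gi.
(* A minor through the zero row would vanish. *)
have fk i : f i != k.
  apply: contraTneq fg => fik; rewrite -ltNge (_ : \det _ = 0) ?cabs0 ?expr0n//.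
  by rewrite (expand_det_row _ i) big1// => j _; rewrite mxE fik Jk mul0r.
pose v' : 'rV[R[i]]_n := \row_i v 0 (f i).
have e1 : rn2 v = rn2 v'.
  rewrite /rn2 -(@sum_inj_avoid n R f k (fun j => cabs (v 0 j) ^+ 2))//; last first.
    by rewrite vk cabs0 expr0n.
  by apply: eq_bigr => i _; rewrite mxE.
have e2' j : (v' *m mxsub f g J) 0 j = (v *m J) 0 (g j).
  rewrite !mxE -(@sum_inj_avoid n _ f k (fun i => v 0 i * J i (g j)))//; last first.
    by rewrite vk mul0r.
  by apply: eq_bigr => i _; rewrite !mxE.
rewrite e1; apply: (@le_trans _ _ (K * rn2 (v' *m mxsub f g J))).
  apply: HK; first by move=> i j; rewrite mxE.
  rewrite -(@ler_pXn2r _ 2)// ?nnegrE ?cabs_ge0 ?sqrtr_ge0// sqr_sqrtr//; exact: ltW.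
rewrite ler_pM2l// /rn2 (eq_bigr (fun j => cabs ((v *m J) 0 (g j)) ^+ 2)).
  by apply: (@sum_inj_le _ _ g (fun j => cabs ((v *m J) 0 j) ^+ 2)) => // j; rewrite sqr_ge0.
by move=> j _; rewrite e2'.
Qed.

End MinorBounds.

(** * Necessity of the three conditions *)

Section FrameConditions.
Context {R : realType}.
Local Notation mu := (@lebesgue_measure R).
Variables (w t0 h : R) (l : nat) (phi : 'I_(2 * l) -> R -> R[i]).
Hypothesis w0 : 0 < w.
Hypothesis t00 : 0 < t0.
Hypothesis hE : h = 2 * pi / t0.
Hypothesis l0 : (0 < l)%N.
Hypothesis wlh : w <= l%:R * h.
Hypothesis hw2 : (2 * l%:R - 1) * h < 2 * w.
Hypothesis phiB : forall j, bandlimited w (phi j).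

Local Notation N := (2 * l)%N.
Local Notation P j := (fourier (phi j)).
Local Notation D := (`[0, h[%classic : set R).
Local Notation node k := (nodek h l k).
Local Notation J := (pre_gramian h phi).
Local Notation live := (@live R w h l).

Let Iminus : set R := `]0, - w + l%:R * h[%classic.
Let I : set R := `]- w + l%:R * h, w - (l%:R - 1) * h[%classic.
Let Iplus : set R := `]w - (l%:R - 1) * h, h[%classic.

Let h0 : 0 < h := period_gt0 t00 hE.

Let natN : (2 * l)%N%:R = 2 * l%:R :> R. Proof. by rewrite natrM. Qed.

Let liveE (k : 'I_N) x : - w <= x + (k%:R - l%:R) * h -> x + (k%:R - l%:R) * h <= w -> live k x.
Proof. by move=> h1 h2; rewrite /live/= in_itv/= /nodek h1 h2. Qed.

Let lower_step (k m : nat) : (m <= k)%N -> m%:R * h <= k%:R * h.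
Proof. by move=> mk; rewrite ler_wpM2r ?ler_nat// ltW. Qed.

Let upper_step (k m : nat) : (k <= m)%N -> k%:R * h <= m%:R * h.
Proof. by move=> mk; rewrite ler_wpM2r ?ler_nat// ltW. Qed.

Let lastN : (N.-1)%:R * h = 2 * (l%:R * h) - h.
Proof.
have : (N.-1).+1%:R * h = 2 * (l%:R * h) by rewrite prednK ?muln_gt0// natN mulrA.
by rewrite -(@natr1 _ N.-1) mulrDl mul1r; lra.
Qed.

Let hw2' : 2 * (l%:R * h) - h < 2 * w.
Proof. by move: hw2; rewrite mulrBl mul1r -mulrA. Qed.

Let kmax (k : 'I_N) : (k <= N.-1)%N.
Proof. by rewrite -ltnS prednK ?muln_gt0//; exact: ltn_ord. Qed.

Lemma live_I x (k : 'I_N) : I x -> live k x.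
Proof.
rewrite /I/= in_itv/= mulrBl mul1r => /andP[x1 x2].
have := @lower_step k 0 isT; have := upper_step (kmax k); rewrite lastN mul0r => h1 h2.
by apply: liveE; rewrite mulrBl; lra.
Qed.

(** The bound [hw2] places the right end of I_- to the left of [w - (l - 1) h], so even the last
    translate of x stays in the band. *)
Lemma live_Iminus x (k : 'I_N) : Iminus x -> (0 < k)%N -> live k x.
Proof.
rewrite /Iminus/= in_itv/= => /andP[x1 x2] k0.
have := lower_step k0; have := upper_step (kmax k); rewrite lastN mul1r => h1 h2.
by apply: liveE; rewrite mulrBl; have := h0; have := hw2'; lra.
Qed.

Lemma live_Iplus x (k : 'I_N) : Iplus x -> (k < N.-1)%N -> live k x.
Proof.
rewrite /Iplus/= in_itv/= mulrBl mul1r => /andP[x1 x2] k0.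
have := @lower_step k 0 isT; have := upper_step k0; rewrite lastN mul0r -(@natr1 R k) mulrDl mul1r.
by move=> h1 h2; apply: liveE; rewrite mulrBl; have := h0; have := hw2'; lra.
Qed.

Lemma dead_Iminus x (k : 'I_N) : Iminus x -> k = 0%N :> nat -> ~ live k x.
Proof.
rewrite /Iminus /live/= !in_itv/= => /andP[x1 x2] k0; rewrite /nodek k0 => /andP[].
by rewrite sub0r mulNr; lra.
Qed.

Lemma dead_Iplus x (k : 'I_N) : Iplus x -> k = N.-1 :> nat -> ~ live k x.
Proof.
rewrite /Iplus /live/= !in_itv/= => /andP[x1 x2] kN; rewrite /nodek => /andP[_].
by rewrite mulrBl kN lastN; move: x1; rewrite mulrBl mul1r; lra.
Qed.

Lemma I_sub : I `<=` D.
Proof.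
move=> x; rewrite /I/= !in_itv/= mulrBl mul1r => /andP[x1 x2].
by apply/andP; split; have := wlh; lra.
Qed.

Lemma Iminus_sub : Iminus `<=` D.
Proof.
move=> x; rewrite /Iminus/= !in_itv/= => /andP[x1 x2].
by apply/andP; split; have := hw2'; have := h0; lra.
Qed.

Lemma Iplus_sub : Iplus `<=` D.
Proof.
move=> x; rewrite /Iplus/= !in_itv/= mulrBl mul1r => /andP[x1 x2].
by apply/andP; split; have := hw2'; have := h0; lra.
Qed.

Lemma D_cover x : D x -> x <> 0 -> x <> - w + l%:R * h -> x <> w - (l%:R - 1) * h ->
  Iminus x \/ I x \/ Iplus x.
Proof.
rewrite /D /I /Iminus /Iplus/= !in_itv/= => /andP[x1 x2] /eqP n0 /eqP n1 /eqP n2.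
have x0 : 0 < x by rewrite lt_neqAle eq_sym n0.
rewrite x0 x2 andbT.
by case: (ltgtP x (- w + l%:R * h)) n1 => // h1 _; [left|right];
  case: (ltgtP x (w - (l%:R - 1) * h)) n2 => // h2 _; [left|right].
Qed.

Section Necessary.
Variables (A B : R).
Hypothesis A0 : 0 < A.
Hypothesis AB : A <= B.
Hypothesis frameAB : forall f, bandlimited w f ->
  let S := (\sum_(j < N) \esum_(n in [set: int])
                  ((cabs (inner f (frame_elt t0 phi j n)) ^+ 2)%:E))%E in
  (A%:E * L2norm f ^+ 2 <= S /\ S <= B%:E * L2norm f ^+ 2)%E.

Let pointwise := frame_pointwise w0 t00 hE wlh phiB A0 AB frameAB.

(** The field is a unit vector wherever its coordinate is live: [rn2 (delta_mx 0 k *m J x)] is h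
    times the sum at the k-th translate of x, whence the division by h. *)
Lemma necessary_cond1 : {ae mu, forall x, (`]- w, w[%classic : set R) x ->
  A / h <= \sum_(j < N) cabs (P j x) ^+ 2 <= B / h}.
Proof.
pose v (k : 'I_N) x : 'rV[R[i]]_N := (\1_[set x | live k x] x)%:C *: delta_mx 0 k.
have mlive k : measurable [set x | live k x].
  by rewrite -[X in measurable X]setTI; apply: (measurable_shift (node k)) => //; exact: measurable_itv.
have mv k : mcmeas (v k).
  move=> i j; under eq_fun do rewrite mxE; apply: cmeasM; last exact: cmeas_cst.
  exact/cmeas_real/measurable_indic.
have vl k x j : ~ live j x -> v k x 0 j = 0.
  move=> lj; rewrite /v !mxE eqxx/= indicE.
  by have [jk|_] := eqVneq j k; rewrite ?mulr0// -jk memNset ?mul0r.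
have vk k : {ae mu, forall x, D x -> live k x ->
    A / h <= \sum_(j < N) cabs (P j (x + node k)) ^+ 2 <= B / h}.
  apply: aeS (pointwise (mv k) (vl k)) => x + Dx lx.
  move=> /(_ Dx); rewrite /v indicE mem_set// scale1r.
  have -> : rn2 (delta_mx 0 k : 'rV[R[i]]_N) = 1.
    rewrite /rn2 (bigD1 k)//= mxE !eqxx cabs1 expr1n big1 ?addr0// => j jk.
    by rewrite mxE (negbTE jk) andbF cabs0 expr0n.
  have -> : rn2 (delta_mx 0 k *m J x) = h * \sum_(j < N) cabs (P j (x + node k)) ^+ 2.
    rewrite -rowE /rn2 mulr_sumr; apply: eq_bigr => j _.
    by rewrite !mxE cabsM exprMn cabs_real ger0_norm ?sqrtr_ge0// sqr_sqrtr// ltW.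
  by rewrite !mulr1 ler_pdivrMr// ler_pdivlMr// mulrC.
(* Each point of the band lies in some cell, and the bound for that cell is shifted back to it. *)
have := ae_forall_ord (fun k => ae_shift (- node k) (vk k)).
apply: aeS => x H xw; move: (xw); rewrite /= in_itv/= => /andP[x1 x2].
have := wlh => wlh'.
have [k Dk] : exists k : 'I_N, D (x - node k) by apply: (window_cover t00 hE); lra.
have := H k Dk; rewrite subrK; apply; rewrite /live/= subrK in_itv/=.
by rewrite (ltW x1) (ltW x2).
Qed.

(** On I every coordinate is live and the Gram determinant is the square of [cabs (\det J)]; the
    exponent [2 l] is thus halved. *)
Lemma necessary_cond3 : {ae mu, forall x, I x -> A ^+ l <= cabs (\det (J x))}.
Proof.
have mJ := mcmeas_gramian h phiB.
have H : forall v : R -> 'rV[R[i]]_N, mcmeas v ->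
    {ae mu, forall x, I x -> A * rn2 (v x) <= rn2 (v x *m J x)}.
  move=> v mv; pose v' x := (\1_I x)%:C *: v x.
  have mv' : mcmeas v'.
    move=> i k; under eq_fun do rewrite mxE; apply: cmeasM => //.
    by apply/cmeas_real/measurable_indic; exact: measurable_itv.
  have v'l x k : ~ live k x -> v' x 0 k = 0.
    move=> lx; have Ix : ~ I x by move=> /live_I Ix; apply: lx.
    by rewrite /v' mxE indicE memNset// mul0r.
  apply: aeS (pointwise mv' v'l) => x + Ix.
  by move=> /(_ (I_sub Ix)) /andP[+ _]; rewrite /v' indicE mem_set// scale1r.
apply: aeS (gram_det_ae A0 mJ H) => x + Ix.
move=> /(_ Ix); rewrite det_mulmx det_adjm cabsM cabsJ -expr2.
rewrite [A ^+ _](_ : _ = (A ^+ l) ^+ 2); last by rewrite -exprM mulnC.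
by rewrite ler_pXn2r ?nnegrE ?cabs_ge0 ?exprn_ge0// ltW.
Qed.

(** The size [2 * l] is not syntactically a successor, so the inequality is transported along an
    equation. *)
Lemma cast_gram_det n (e : N = n.+1) (M : 'M[R[i]]_N) (k : 'I_N) :
  cabs (\det (row' k M *m adjm (row' k M))) <= N%:R * sum_sq_minors n M.
Proof. by case: _ / (esym e) M k => M k; exact: gram_det_le_sum_sq_minors. Qed.

(** Covers I_- and I_+ together, with k0 the first or the last row. The Gram determinant without row
    k0 is at least [A ^+ N.-1] and at most N times the sum of squared minors. *)
Lemma necessary_cond2_at (k0 : 'I_N) (E : set R) : measurable E -> E `<=` D ->
  (forall x k, E x -> k != k0 -> live k x) ->
  {ae mu, forall x, E x -> A ^+ N.-1 / N%:R <= sum_sq_minors (N - 1) (J x)}.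
Proof.
move=> mE ED El; have mJ := mcmeas_gramian h phiB.
have mK : mcmeas (fun x => row' k0 (J x)) by move=> i j; under eq_fun do rewrite mxE; exact: mJ.
have H : forall v : R -> 'rV[R[i]]_N.-1, mcmeas v ->
    {ae mu, forall x, E x -> A * rn2 (v x) <= rn2 (v x *m row' k0 (J x))}.
  move=> v mv; pose v' x := (\1_E x)%:C *: extend0 k0 (v x).
  have mv' : mcmeas v'.
    move=> i k; under eq_fun do rewrite mxE; apply: cmeasM.
      exact/cmeas_real/measurable_indic.
    exact: (@mcmeas_extend0 _ _ k0 v mv).
  have v'l x k : ~ live k x -> v' x 0 k = 0.
    move=> lx; rewrite /v' mxE; have [Ex|Ex] := pselect (E x); last first.
      by rewrite indicE memNset// mul0r.
    have [->|kk] := eqVneq k k0; first by rewrite mxE unlift_none mulr0.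
    by case: lx; exact: El.
  apply: aeS (pointwise mv' v'l) => x + Ex.
  move=> /(_ (ED _ Ex)) /andP[+ _]; rewrite /v' indicE mem_set// scale1r.
  by rewrite rn2_extend0 extend0_mul.
apply: aeS (gram_det_ae A0 mK H) => x + Ex.
move=> /(_ Ex) /le_trans H1; rewrite ler_pdivrMr ?ltr0n ?muln_gt0// mulrC; apply: H1.
apply: cast_gram_det; lia.
Qed.

Lemma necessary_cond2 : {ae mu, forall x, (Iminus `|` Iplus) x ->
  A ^+ N.-1 / N%:R <= sum_sq_minors (N - 1) (J x)}.
Proof.
have N0 : (0 < N)%N by rewrite muln_gt0.
have N1 : (N.-1 < N)%N by rewrite prednK.
have H1 : {ae mu, forall x, Iminus x -> A ^+ N.-1 / N%:R <= sum_sq_minors (N - 1) (J x)}.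
  apply: (@necessary_cond2_at (Ordinal N0)); [exact: measurable_itv|exact: Iminus_sub|].
  move=> x k Ix kk; apply: live_Iminus => //; rewrite lt0n; apply: contraNneq kk => k0.
  exact/eqP/val_inj.
have H2 : {ae mu, forall x, Iplus x -> A ^+ N.-1 / N%:R <= sum_sq_minors (N - 1) (J x)}.
  apply: (@necessary_cond2_at (Ordinal N1)); [exact: measurable_itv|exact: Iplus_sub|].
  move=> x k Ix kk; apply: live_Iplus => //; rewrite ltn_neqAle kmax andbT.
  by apply: contraNneq kk => k0; exact/eqP/val_inj.
by apply: (aeS2 _ H1 H2) => x h1 h2 [/h1|/h2].
Qed.

End Necessary.

End FrameConditions.

Lemma rn2_le_of_sum_sq_minors {R : realType} n (c sigma : R) : (0 < n)%N -> 0 < sigma ->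
  exists2 K : R, 0 < K &
  forall (J : 'M[R[i]]_n) (k : 'I_n), (forall i j, cabs (J i j) <= c) -> (forall j, J k j = 0) ->
  sigma <= sum_sq_minors (n - 1) J -> forall v : 'rV[R[i]]_n, v 0 k = 0 -> rn2 v <= K * rn2 (v *m J).
Proof. by case: n => // n _ /(rn2_le_of_minors n c)[K K0 HK]; exists K => //; rewrite subn1. Qed.

(** * Sufficiency of the three conditions *)

Section ConditionsToFrame.
Context {R : realType}.
Local Notation mu := (@lebesgue_measure R).
Variables (w t0 h : R) (l : nat) (phi : 'I_(2 * l) -> R -> R[i]).
Hypothesis t00 : 0 < t0.
Hypothesis hE : h = 2 * pi / t0.
Hypothesis l0 : (0 < l)%N.
Hypothesis wlh : w <= l%:R * h.
Hypothesis phiB : forall j, bandlimited w (phi j).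

Local Notation N := (2 * l)%N.
Local Notation P j := (fourier (phi j)).
Local Notation D := (`[0, h[%classic : set R).
Local Notation node k := (nodek h l k).
Local Notation J := (pre_gramian h phi).
Local Notation live := (@live R w h l).

Let Iminus : set R := `]0, - w + l%:R * h[%classic.
Let I : set R := `]- w + l%:R * h, w - (l%:R - 1) * h[%classic.
Let Iplus : set R := `]w - (l%:R - 1) * h, h[%classic.

Let h0 : 0 < h := period_gt0 t00 hE.

Variables gamma sigma eta : R.
Hypothesis gamma0 : 0 < gamma.
Hypothesis sigma0 : 0 < sigma.
Hypothesis eta0 : 0 < eta.
Hypothesis cond1 : {ae mu, forall x, (`]- w, w[%classic : set R) x ->
  \sum_(j < N) cabs (P j x) ^+ 2 <= gamma}.
Hypothesis cond2 : {ae mu, forall x, (Iminus `|` Iplus) x ->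
  sigma <= sum_sq_minors (N - 1) (J x)}.
Hypothesis cond3 : {ae mu, forall x, I x -> eta <= cabs (\det (J x))}.

Lemma fourier_bounded j : {ae mu, forall x, cabs (P j x) <= Num.sqrt gamma}.
Proof.
apply: (aeS2 _ (aeS2 (fun x a b => conj a b) (ae_neq w) (ae_neq (- w)))
  (aeS2 (fun x a b => conj a b) cond1 (fourier_phi_off_band phiB j))) => x [/eqP xw /eqP xw'] [c1 off].
have [xI|xI] := pselect ((`[- w, w]%classic : set R) x); last by rewrite off// cabs0 sqrtr_ge0.
rewrite -(@ler_pXn2r _ 2)// ?nnegrE ?cabs_ge0 ?sqrtr_ge0// sqr_sqrtr ?(ltW gamma0)//.
have xJ : (`]- w, w[%classic : set R) x.
  move: xI; rewrite /= !in_itv/= => /andP[x1 x2].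
  by rewrite !lt_neqAle x1 x2 xw eq_sym xw'.
apply: le_trans (c1 xJ); rewrite (bigD1 j)//= lerDl.
by apply: sumr_ge0 => k _; rewrite sqr_ge0.
Qed.

Lemma gramian_bounded : {ae mu, forall x, forall k j, cabs (J x k j) <= Num.sqrt (h * gamma)}.
Proof.
apply: ae_forall_ord => k; apply: ae_forall_ord => j.
apply: aeS (ae_shift (node k) (fourier_bounded j)) => x H.
rewrite mxE cabsM cabs_real ger0_norm ?sqrtr_ge0// sqrtrM ?(ltW h0)//.
by apply: ler_wpM2l => //; exact: sqrtr_ge0.
Qed.

Lemma ae_dead (F : R -> R[i]) :
  {ae mu, forall x, ~ (`[- w, w]%classic : set R) x -> F x = 0} ->
  {ae mu, forall x, forall k : 'I_N, ~ live k x -> F (x + node k) = 0}.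
Proof.
move=> H; apply: ae_forall_ord => k.
exact: (@ae_shift R (node k) (fun y => ~ (`[- w, w]%classic : set R) y -> F y = 0) H).
Qed.

Lemma gramian_dead : {ae mu, forall x, forall (k j : 'I_N), ~ live k x -> J x k j = 0}.
Proof.
have H j := ae_dead (fourier_phi_off_band phiB j).
apply: aeS (ae_forall_ord H) => x {}H k j lk.
by rewrite mxE; have := H j k lk; rewrite /nodek => ->; rewrite mulr0.
Qed.

(** The matrix estimates are uniform, so one null set serves all vectors v. The sum [K1 + K2] covers
    both the middle interval and the two outer ones. *)
Lemma pointwise_lower : exists2 K : R, 0 < K & {ae mu, forall x, D x ->
  forall v : 'rV[R[i]]_N, (forall k, ~ live k x -> v 0 k = 0) -> rn2 v <= K * rn2 (v *m J x)}.
Proof.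
have N0 : (0 < N)%N by rewrite muln_gt0.
have N1 : (N.-1 < N)%N by rewrite prednK.
have [K1 K10 H1] := @rn2_le_of_det R N (Num.sqrt (h * gamma)) eta eta0.
have [K2 K20 H2] := @rn2_le_of_sum_sq_minors R N (Num.sqrt (h * gamma)) sigma N0 sigma0.
exists (K1 + K2); first exact: addr_gt0.
have neq := aeS2 (fun x a b => conj a b) (ae_neq (0 : R))
  (aeS2 (fun x a b => conj a b) (ae_neq (- w + l%:R * h)) (ae_neq (w - (l%:R - 1) * h))).
have gr := aeS2 (fun x a b => conj a b) gramian_bounded gramian_dead.
have cond := aeS2 (fun x a b => conj a b) cond2 cond3.
apply: (aeS2 _ neq (aeS2 (fun x a b => conj a b) gr cond)).
move=> x [n0 [n1 n2]] [[Jc Jd] [c2 c3]] Dx v vl.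
have r0 : 0 <= rn2 (v *m J x) by exact: rn2_ge0.
have le1 : K1 * rn2 (v *m J x) <= (K1 + K2) * rn2 (v *m J x).
  by rewrite ler_wpM2r// lerDl ltW.
have le2 : K2 * rn2 (v *m J x) <= (K1 + K2) * rn2 (v *m J x).
  by rewrite ler_wpM2r// lerDr ltW.
have [xm|[xi|xp]] := D_cover Dx n0 n1 n2.
- have dk := @dead_Iminus R w h l x (Ordinal N0) xm erefl.
  apply: le_trans le2; apply: (H2 _ (Ordinal N0)) => //.
  + by move=> j; exact: Jd.
  + by apply: c2; left.
  + exact: vl.
- by apply: le_trans le1; apply: H1 => //; exact: c3.
- have dk := @dead_Iplus R w h l l0 x (Ordinal N1) xp erefl.
  apply: le_trans le2; apply: (H2 _ (Ordinal N1)) => //.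
  + by move=> j; exact: Jd.
  + by apply: c2; right.
  + exact: vl.
Qed.

Lemma pointwise_upper : {ae mu, forall x, forall v : 'rV[R[i]]_N,
  rn2 (v *m J x) <= (N * N)%:R * (h * gamma) * rn2 v}.
Proof.
apply: aeS gramian_bounded => x Jc v; apply: rn2_mul_le => i j.
have hg : 0 <= h * gamma by rewrite mulr_ge0// ltW.
by rewrite -[leRHS]sqr_sqrtr// ler_pXn2r ?nnegrE ?cabs_ge0 ?sqrtr_ge0.
Qed.

Lemma frame_of_conditions : is_frame w t0 phi.
Proof.
have [K K0 HK] := pointwise_lower.
(* The maximum ensures [A <= B]. *)
pose B := Num.max K^-1 ((N * N)%:R * (h * gamma)).
have A0 : 0 < K^-1 by rewrite invr_gt0.
have AB : K^-1 <= B by rewrite le_max lexx.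
have B0 : 0 < B := lt_le_trans A0 AB.
exists K^-1, B; split => // f fB; cbv zeta.
have [f2 foff] := (bandlimitedP w f).1 fB; have F2 := L2_fourier f2.
have mD : measurable D by exact: measurable_itv.
have mJ := mcmeas_gramian h phiB.
have ms : mcmeas (samples h l (fourier f)) := @mcmeas_samples R h l _ (L2_meas F2).
have ms2 : measurable_fun D (fun x => rn2 (samples h l (fourier f) x)).
  by apply: (measurable_funS measurableT) => //; exact: measurable_rn2.
have mJ2 : measurable_fun D (fun x => rn2 (samples h l (fourier f) x *m J x)).
  by apply: (measurable_funS measurableT) => //; apply: measurable_rn2; exact: mcmeasM.
rewrite L2norm_sqr (nn_samples t00 hE wlh fB) (frame_sum t00 hE wlh phiB fB); last first.
  move=> j; have bP : {ae mu, forall x, cabs (P j x)^* <= Num.sqrt gamma}.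
    by apply: aeS (fourier_bounded j) => x; rewrite cabsJ.
  have := L2_ae_bounded_mul (cmeasJ (L2_meas (L2_fourier_phi phiB j))) bP F2.
  by congr L2; apply/funext => x; rewrite mulrC.
split.
- rewrite -ge0_integralZl//; last first.
  + by rewrite lee_fin ltW.
  + by move=> x _; rewrite lee_fin rn2_ge0.
  + by apply/measurable_EFinP.
  apply: ae_ge0_le_integral => //.
  + by move=> x _; rewrite -EFinM lee_fin mulr_ge0 ?rn2_ge0// ltW.
  + by apply/measurable_EFinP; exact: measurable_funM.
  + by move=> x _; rewrite lee_fin rn2_ge0.
  + by apply/measurable_EFinP.
  apply: (aeS2 _ HK (ae_dead foff)) => x Hx dead Dx.
  rewrite -EFinM lee_fin ler_pdivrMl//; apply: Hx => // k lk.
  by rewrite mxE dead// rmorph0.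
- rewrite -ge0_integralZl//; last first.
  + by rewrite lee_fin ltW.
  + by move=> x _; rewrite lee_fin rn2_ge0.
  + by apply/measurable_EFinP.
  apply: ae_ge0_le_integral => //.
  + by move=> x _; rewrite lee_fin rn2_ge0.
  + by apply/measurable_EFinP.
  + by move=> x _; rewrite -EFinM lee_fin mulr_ge0 ?rn2_ge0// ltW.
  + by apply/measurable_EFinP; exact: measurable_funM.
  apply: aeS pointwise_upper => x Hx Dx.
  rewrite -EFinM lee_fin; apply: (le_trans (Hx _)).
  by apply: ler_wpM2r; [exact: rn2_ge0|rewrite /B le_max lexx orbT].
Qed.

End ConditionsToFrame.

(** * Riesz bases *)

Section Synthesis.
Context {R : realType}.
Variables (N : nat) (e : 'I_N -> int -> R -> R[i]) (B : R).
Hypothesis e_L2 : forall j n, L2 (e j n).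
Hypothesis B0 : 0 < B.
Implicit Types c d : 'I_N -> int -> R[i].

Definition psum c M : R -> R[i] :=
  fun x => \sum_(j < N) symsum M (fun n => c j n * e j n x).

Definition energy c M : R := \sum_(j < N) symsum M (fun n => cabs (c j n) ^+ 2).

Definition tail c (M : nat) : 'I_N -> int -> R[i] :=
  fun j n => if (`|n| <= M)%N then 0 else c j n.

Hypothesis bessel : forall c M,
  energy (fun j n => inner (psum c M) (e j n)) M <= B * nn (psum c M).

Lemma symsumB (V : zmodType) M (a b : int -> V) :
  symsum M (fun n => a n - b n) = symsum M a - symsum M b.
Proof. exact: sumrB. Qed.

Lemma L2_psum c M : L2 (psum c M).
Proof. by apply: L2_sum => j; apply: L2_sum => k; apply: L2Z. Qed.

Lemma inner_psuml c M f : L2 f ->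
  inner (psum c M) f = \sum_(j < N) symsum M (fun n => c j n * inner (e j n) f).
Proof.
move=> f2; rewrite inner_suml//; last by move=> j; apply: L2_sum => k; apply: L2Z.
apply: eq_bigr => j _; rewrite inner_suml//; last by move=> k; apply: L2Z.
by apply: eq_bigr => k _; rewrite innerZl.
Qed.

Lemma inner_psumr c M f : L2 f ->
  inner f (psum c M) = \sum_(j < N) symsum M (fun n => (c j n)^* * inner f (e j n)).
Proof.
move=> f2; rewrite inner_sumr//; last by move=> j; apply: L2_sum => k; apply: L2Z.
apply: eq_bigr => j _; rewrite inner_sumr//; last by move=> k; apply: L2Z.
by apply: eq_bigr => k _; rewrite innerZr.
Qed.

(* AM-GM: |c z| <= (B |c|^2 + |z|^2 / B) / 2 *)
Lemma nn_psum_le c M : nn (psum c M) <= B * energy c M.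
Proof.
set g := psum c M; have g2 : L2 g by exact: L2_psum.
have := bessel c M; rewrite -/g => H.
have : cabs (inner g g) <= (B * energy c M + energy (fun j n => inner g (e j n)) M / B) / 2.
  rewrite {2}/g inner_psumr// mulr_sumr mulr_suml -big_split/= mulr_suml.
  apply: (le_trans (@cabs_sum _ _ _ _ _)); apply: ler_sum => j _.
  rewrite /symsum mulr_sumr mulr_suml -big_split/= mulr_suml.
  apply: (le_trans (@cabs_sum _ _ _ _ _)); apply: ler_sum => k _.
  rewrite cabsM cabsJ; move: (cabs _) (cabs _) => b a.
  have -> : (B * a ^+ 2 + b ^+ 2 / B) / 2 = a * b + (B * a - b) ^+ 2 / (2 * B).
    by field; rewrite gt_eqF.
  by rewrite lerDl divr_ge0 ?sqr_ge0// mulr_ge0// ltW.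
rewrite innerff cabs_real (ger0_norm (nn_ge0 _)).
(* The second term is at most [nn g / 2] by the Bessel bound, and is absorbed on the left. *)
move: H; rewrite mulrC -ler_pdivrMr// => H; lra.
Qed.

Lemma psumB c M M' x : (M <= M')%N -> psum c M' x - psum c M x = psum (tail c M) M' x.
Proof.
move=> MM; rewrite /psum -sumrB; apply: eq_bigr => j _.
rewrite -(symsum_cut (fun n => c j n * e j n x) MM) -symsumB.
apply: eq_symsum => n _; rewrite /tail.
by case: ifP => _; rewrite ?subrr ?mul0r ?subr0.
Qed.

Lemma energy_tail c M M' : (M <= M')%N -> energy (tail c M) M' = energy c M' - energy c M.
Proof.
move=> MM; rewrite /energy -sumrB; apply: eq_bigr => j _.
rewrite -(symsum_cut (fun n => cabs (c j n) ^+ 2) MM) -symsumB.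
apply: eq_symsum => n _; rewrite /tail.
by case: ifP => _; rewrite ?cabs0 ?expr0n ?subrr ?subr0.
Qed.

Lemma symsum_le_esum M (a : int -> R) : (forall n, 0 <= a n) ->
  ((symsum M a)%:E <= \esum_(n in [set: int]) (a n)%:E)%E.
Proof.
move=> a0; apply: (cvge_ge _ (esum_symsum a0)).
by exists M => // m /= Mm; rewrite lee_fin; exact: symsum_nondecreasing.
Qed.

Lemma energy_bound c : ell2 c -> exists E : R, forall M, energy c M <= E.
Proof.
rewrite /ell2; set S := (\sum_(j < N) _)%E => Sy.
have S0 : (0 <= S)%E.
  by apply: sume_ge0 => j _; apply: esum_ge0 => n _; rewrite lee_fin sqr_ge0.
exists (fine S) => M; rewrite -lee_fin fineK ?ge0_fin_numE// /energy -sumEFin.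
by apply: lee_sum => j _; apply: symsum_le_esum => n; rewrite sqr_ge0.
Qed.

(** A difference of partial sums is a partial sum of a tail, whose squared norm is at most B times
    the energy still missing from a convergent sequence. *)
Lemma psum_lim c : ell2 c -> exists g, is_L2lim (psum c) g.
Proof.
move=> /energy_bound[E HE].
have nd : nondecreasing_seq (energy c).
  move=> m n mn; apply: ler_sum => j _.
  by apply: symsum_nondecreasing => // k; rewrite sqr_ge0.
have cv : cvgn (energy c).
  by apply: nondecreasing_is_cvgn => //; exists E => _ [m _ <-].
have key M M' : (M <= M')%N ->
    nn (fun x => psum c M' x - psum c M x) <= B * (limn (energy c) - energy c M).
  move=> MM; rewrite (_ : (fun x => _) = psum (tail c M) M'); last first.
    by apply/funext => x; exact: psumB.
  apply: (le_trans (nn_psum_le _ _)); rewrite energy_tail// ler_pM2l// lerB//.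
  exact: nondecreasing_cvgn_le.
apply: L2_complete; first exact: L2_psum.
move=> r r0; have rB : 0 < r / B by rewrite divr_gt0.
have /cvgrPdist_le/(_ _ rB)[n0 _ Hn] := cv.
have Hn' m : (n0 <= m)%N -> B * (limn (energy c) - energy c m) <= r.
  move=> nm; have := Hn m nm; rewrite ger0_norm ?subr_ge0; last exact: nondecreasing_cvgn_le.
  by rewrite ler_pdivlMr// mulrC.
exists n0 => m n nm nn'; have [mn|/ltnW nm'] := leqP m n.
  by rewrite nn_BC; [apply: (le_trans (key _ _ mn)); exact: Hn'|exact: L2_psum|exact: L2_psum].
by apply: (le_trans (key _ _ nm')); exact: Hn'.
Qed.

Lemma psum_coef c g f j0 n0 : is_L2lim (psum c) g -> L2 f ->
  (forall j n, inner (e j n) f = ((j == j0) && (n == n0))%:R) -> inner g f = c j0 n0.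
Proof.
move=> cg f2 Hf; apply: (inner_lim (L2_psum c) cg f2).
exists `|n0|%N => // M /= nM; rewrite inner_psuml// (bigD1 j0)//= [X in _ + X]big1 ?addr0.
  rewrite -[RHS](_ : (if (`|n0| <= M)%N then c j0 n0 else 0) = _); last by rewrite nM.
  rewrite -symsum_delta; apply: eq_symsum => n _; rewrite Hf eqxx/=.
  by case: eqP => [->|_]; rewrite ?mulr1 ?mulr0.
move=> j jj; rewrite /symsum big1// => k _.
by rewrite Hf (negbTE jj) mulr0.
Qed.

End Synthesis.

Section ComplexInverse.
Context {R : realType}.

Lemma conjC_realE (t : R) : (t%:C)^* = t%:C :> R[i].
Proof. by apply/eqP; rewrite eq_complex/= oppr0 !eqxx. Qed.

(** The inverse is the conjugate over the squared modulus, also at 0, where both are 0. *)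
Lemma cmeasV (f : R -> R[i]) : cmeas f -> cmeas (fun x => (f x)^-1).
Proof.
move=> mf; rewrite (_ : (fun x => _) = fun x => (powR (cabs (f x) ^+ 2) (-1))%:C * (f x)^*).
  apply: cmeasM; last exact: cmeasJ.
  apply: cmeas_real; apply: (measurableT_comp (@measurable_powR R (-1))).
  exact: measurable_cabs2.
apply/funext => x; rewrite powR_inv1 ?sqr_ge0//.
have [->|f0] := eqVneq (f x) 0; first by rewrite invr0 rmorph0 mulr0.
apply: (mulfI f0); rewrite mulfV// mulrCA mulJ_cabs2 -rmorphM mulVf ?rmorph1//.
by rewrite sqrf_eq0 cabs_eq0.
Qed.

End ComplexInverse.

Section BandLimitedSpace.
Context {R : realType}.
Local Notation mu := (@lebesgue_measure R).
Implicit Types (f g : R -> R[i]).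

Lemma bandlimited0 (w : R) : bandlimited w (fun=> 0 : R[i]).
Proof.
apply/bandlimitedP; split; first exact: L20.
have z2 := @L20 R; have nz : nn (fourier (fun=> 0 : R[i])) = 0.
  rewrite nn_fourier//; have := nnZ 0 z2.
  by rewrite cabs0 expr0n/= !mul0r.
by apply: aeS (nn_eq0 (L2_fourier z2) nz) => x.
Qed.

Lemma bandlimited_linear (w : R) (c : R[i]) f g : bandlimited w f -> bandlimited w g ->
  bandlimited w (fun x => f x + c * g x).
Proof.
move=> /bandlimitedP[f2 fw] /bandlimitedP[g2 gw]; apply/bandlimitedP; split.
  by apply: L2D => //; exact: L2Z.
apply: (aeS2 _ (fourier_linear c f2 g2) (aeS2 (fun x a b => conj a b) fw gw)).
by move=> x -> [fx gx] xw; rewrite fx// gx// mulr0 addr0.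
Qed.

Lemma bandlimited_sum (w : R) I (s : seq I) (F : I -> R -> R[i]) (c : I -> R[i]) :
  (forall i, bandlimited w (F i)) -> bandlimited w (fun x => \sum_(i <- s) c i * F i x).
Proof.
move=> FB; elim: s => [|i s ih].
  by under eq_fun do rewrite big_nil; exact: bandlimited0.
under eq_fun do rewrite big_cons addrC.
exact: (@bandlimited_linear w (c i) _ (F i) ih (FB i)).
Qed.

Lemma bandlimited_translate (w a : R) f : bandlimited w f -> bandlimited w (translate a f).
Proof.
move=> /bandlimitedP[f2 fw]; apply/bandlimitedP; split; first exact: L2_shift.
apply: (aeS2 _ (fourier_translate a f2) fw) => x -> fx xw.
by rewrite fx// mulr0.
Qed.

End BandLimitedSpace.

(** * Biorthogonal functions and injectivity of the synthesis *)

Section RieszBasis.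
Context {R : realType}.
Local Notation mu := (@lebesgue_measure R).
Variables (w t0 h : R) (l : nat) (phi : 'I_(2 * l) -> R -> R[i]).
Hypothesis w0 : 0 < w.
Hypothesis t00 : 0 < t0.
Hypothesis hE : h = 2 * pi / t0.
Hypothesis hw : w = l%:R * h.
Hypothesis phiB : forall j, bandlimited w (phi j).

Local Notation N := (2 * l)%N.
Local Notation P j := (fourier (phi j)).
Local Notation D := (`[0, h[%classic : set R).
Local Notation node k := (nodek h l k).
Local Notation J := (pre_gramian h phi).
Local Notation elt := (frame_elt t0 phi).

Let h0 : 0 < h := period_gt0 t00 hE.
Let wlh : w <= l%:R * h. Proof. by rewrite hw. Qed.

Let elt_B j n : bandlimited w (elt j n).
Proof. exact: bandlimited_translate. Qed.

Let elt_L2 j n : L2 (elt j n).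
Proof. by have /bandlimitedP[] := elt_B j n. Qed.

Variables gamma eta : R.
Hypothesis gamma0 : 0 < gamma.
Hypothesis eta0 : 0 < eta.
Hypothesis cond1 : {ae mu, forall x, (`]- w, w[%classic : set R) x ->
  \sum_(j < N) cabs (P j x) ^+ 2 <= gamma}.
Hypothesis cond3 : {ae mu, forall x,
  (`]- w + l%:R * h, w - (l%:R - 1) * h[%classic : set R) x -> eta <= cabs (\det (J x))}.

(** The measurable part of the period, of full measure, on which the bounds on J hold at every
    point: [realize_samples] asks for a field bounded everywhere. *)
Let S : set R := D `&` [set x | eta <= cabs (\det (J x))] `&`
  \bigcap_(k in [set: 'I_N]) \bigcap_(j in [set: 'I_N])
    [set x | cabs (J x k j) <= Num.sqrt (h * gamma)].

Let mS : measurable S.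
Proof.
have mJ := mcmeas_gramian h phiB.
apply: measurableI; first apply: measurableI; first exact: measurable_itv.
  rewrite -[X in measurable X]setTI; apply: measurable_fun_le => //.
  by apply: measurable_cabs; exact: cmeas_det.
apply: fin_bigcap_measurable => [|k _]; first exact: finite_finset.
apply: fin_bigcap_measurable => [|j _]; first exact: finite_finset.
rewrite -[X in measurable X]setTI; apply: measurable_fun_le => //.
by apply: measurable_cabs; exact: mJ.
Qed.

Let aeS_D : {ae mu, forall x, D x -> S x}.
Proof.
apply: (aeS2 _ (aeS2 (fun x a b => conj a b) (gramian_bounded t00 hE phiB gamma0 cond1) cond3)
  (ae_neq (0 : R))) => x [Jb c3] n0 Dx.
split; first split => //.
- apply: c3; move: Dx; rewrite /= !in_itv/= => /andP[x1 x2].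
  by rewrite hw addNr lt_neqAle eq_sym x1 andbT; apply/andP; split; [exact/eqP|lra].
- by move=> k _ j _; exact: Jb.
Qed.

Lemma biorthogonal (j0 : 'I_N) (n0 : int) : exists f, L2 f /\
  forall j n, inner (elt j n) f = ((j == j0) && (n == n0))%:R.
Proof.
have mJ := mcmeas_gramian h phiB.
have [K K0 HK] := @rn2_le_of_det R N (Num.sqrt (h * gamma)) eta eta0.
(* With this scale the j0-th [gram_fun] is [h^-1] times a character, whose squared norm on the
   period is h. *)
pose s : R[i] := ((Num.sqrt h)^-1)%:C.
have s0 : Num.sqrt h != 0 by rewrite gt_eqF// sqrtr_gt0.
(* The adjugate divided by the determinant keeps the inverse manifestly measurable; off S the field
   is 0. *)
pose v x : 'rV[R[i]]_N := (s * (bchar 0 h n0 x)^* * (\1_S x)%:C / \det (J x)) *: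
   row j0 (\adj (J x)).
have detS x : S x -> \det (J x) != 0.
  by move=> [[_ /= H] _]; rewrite -cabs_eq0 gt_eqF// (lt_le_trans eta0).
have vJ x : S x -> v x *m J x = (s * (bchar 0 h n0 x)^*) *: delta_mx 0 j0.
  move=> Sx; rewrite /v -scalemxAl -row_mul mul_adj_mx indicE mem_set// mulr1.
  apply/rowP => j; rewrite !mxE eqxx/= eq_sym -mulrA; congr (_ * _).
  by case: eqP => _; rewrite ?mulr1n ?mulr0n ?mulr0// mulVf// detS.
have vS x : ~ S x -> v x = 0.
  by move=> Sx; rewrite /v indicE memNset// mulr0 mul0r scale0r.
have mv : mcmeas v.
  move=> i k; under eq_fun do rewrite mxE [row _ _ _ _]mxE.
  apply: cmeasM; last exact: (mcmeas_adj mJ).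
  apply: cmeasM; last by apply: cmeasV; exact: cmeas_det.
  apply: cmeasM; last by apply/cmeas_real/measurable_indic.
  by apply: cmeasM; [exact: cmeas_cst|apply: cmeasJ; exact/L2_meas/L2_bchar].
(* On S, [rn2 (v x *m J x)] is [h^-1], and K is the constant from Cramer's rule. *)
have vb x k : cabs (v x 0 k) <= Num.sqrt (K / h).
  have Kh : 0 <= K / h by rewrite divr_ge0// ltW.
  have [Sx|Sx] := pselect (S x); last by rewrite vS// mxE cabs0 sqrtr_ge0.
  have [[Dx dx] Jx] := Sx.
  rewrite -(@ler_pXn2r _ 2)// ?nnegrE ?cabs_ge0 ?sqrtr_ge0// sqr_sqrtr//.
  apply: (le_trans (cabs2_le_rn2 _ _)); apply: (le_trans (HK (J x) _ dx (v x))).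
    by move=> a b; exact: Jx.
  rewrite ler_pM2l// vJ// /rn2 (bigD1 j0)//= big1 ?addr0.
    rewrite !mxE !eqxx mulr1 cabsM cabsJ /bchar res_in; last by rewrite add0r.
    rewrite cabs_expi mulr1 cabs_real ger0_norm ?invr_ge0 ?sqrtr_ge0//.
    by rewrite exprVn sqr_sqrtr// ltW.
  by move=> j jj; rewrite !mxE (negbTE jj) andbF mulr0 cabs0 expr0n.
have vD x : ~ D x -> v x = 0 by move=> Dx; apply: vS => -[[]].
(* When [w = l h] every coordinate is live on the whole period. *)
have vl x k : ~ live w h k x -> v x 0 k = 0.
  move=> lx; have [Dx|Dx] := pselect (D x); last by rewrite vD// mxE.
  case: lx; move: Dx; rewrite /live/= !in_itv/= nodekE => /andP[x1 x2].
  have k0 : 0 <= k%:R * h by rewrite mulr_ge0// ltW.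
  have kN : k%:R * h <= 2 * (l%:R * h) - h.
    have : (k.+1)%:R * h <= N%:R * h by rewrite ler_wpM2r ?ler_nat// ltW.
    by rewrite natrM -(@natr1 R k) mulrDl mul1r -mulrA; lra.
  by rewrite hw; apply/andP; split; lra.
have [f [fB fv fb]] := realize_samples w0 t00 hE wlh mv vb vD vl.
have [f2 _] := fB; have F2 := L2_fourier f2.
exists f; split => // j n.
have FP : L2 (fun x => fourier f x * (P j x)^*).
  by apply: (L2_ae_bounded_mul (L2_meas F2) fb); apply: L2J; exact: L2_fourier_phi phiB j.
have G2 : L2 (gram_fun h phi (fourier f) j) by exact: L2_gram_fun.
pose c : R[i] := (h^-1)%:C * (j == j0)%:R.
rewrite innerC// (frame_coef t00 hE wlh phiB j n fB).
rewrite (@ae_eq_innerl _ _ (fun x => c * bchar 0 h n0 x))//; last first.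
- apply: (aeS2 _ fv aeS_D) => x Hs HS; rewrite /gram_fun /bchar.
  have [Dx|Dx] := pselect (D x); last first.
    by rewrite !res_out ?mulr0//= add0r.
  have Sx := HS Dx; rewrite res_in// -/(bchar 0 h n0 x).
  have := congr1 (fun u : 'rV[R[i]]_N => (u 0 j)^*) (vJ x Sx).
  rewrite /= -(Hs Dx) !mxE rmorph_sum/= => e1.
  have e2' : \sum_(k < N) fourier f (x + node k) * (P j (x + node k))^* =
      s * (s * (bchar 0 h n0 x)^* * ((j == j0)%:R))^*.
    rewrite -e1 mulr_sumr; apply: eq_bigr => k _; rewrite !mxE !rmorphM/= conjCK.
    rewrite conjC_realE mulrCA [s * _]mulrA [s * (Num.sqrt h)%:C](_ : _ = 1) ?mul1r//.
    by rewrite /s -rmorphM mulVf ?rmorph1.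
  have ss : s * s = (h^-1)%:C.
    by rewrite /s -rmorphM -invfM -expr2 sqr_sqrtr// ltW.
  rewrite e2'; move: (bchar 0 h n0 x) => b.
  rewrite !rmorphM/= conjCK conjC_realE rmorph_nat /c -ss -/s.
  by rewrite !mulrA mulrAC.
- exact: L2_bchar.
- by apply: L2Z; exact: L2_bchar.
rewrite innerZl; [|exact: L2_bchar|exact: L2_bchar].
rewrite inner_bchar// /c [n == n0]eq_sym; have [_|_] := eqVneq n0 n; last first.
  by rewrite mulr0 rmorph0 andbF.
have hh : (h^-1)%:C * h%:C = 1 :> R[i] by rewrite -rmorphM mulVf ?gt_eqF.
by rewrite andbT mulrAC hh mul1r rmorph_nat.
Qed.

Lemma frame_upper_bound (B : R) (c : 'I_N -> int -> R[i]) M :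
  (forall f, bandlimited w f ->
    (\sum_(j < N) \esum_(n in [set: int]) ((cabs (inner f (elt j n)) ^+ 2)%:E)
      <= B%:E * L2norm f ^+ 2)%E) ->
  energy (fun j n => inner (psum elt c M) (elt j n)) M <= B * nn (psum elt c M).
Proof.
move=> HB; have gB : bandlimited w (psum elt c M).
  rewrite (_ : psum elt c M = fun x => \sum_(j < N) 1 *
      (\sum_(0 <= k < (2 * M).+1) c j (k%:Z - M%:Z) * elt j (k%:Z - M%:Z) x)).
    apply: (@bandlimited_sum R w _ _ _ (fun=> 1)) => j.
    exact: (@bandlimited_sum R w _ _ (fun k : nat => elt j (k%:Z - M%:Z)) (fun k : nat => c j (k%:Z - M%:Z))).
  by apply/funext => x; apply: eq_bigr => j _; rewrite mul1r.
have [g2 _] := gB; have := HB _ gB; rewrite L2norm_sqr e2E// -EFinM -lee_fin.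
apply: le_trans; rewrite /energy -sumEFin; apply: lee_sum => j _.
by apply: symsum_le_esum => n; rewrite sqr_ge0.
Qed.

(** The upper frame bound makes both series converge, so [synthesis] returns true limits; pairing
    with a biorthogonal function ignores null sets and recovers each coefficient. *)
Lemma riesz_injective c c' : is_frame w t0 phi -> ell2 c -> ell2 c' ->
  {ae mu, forall x, synthesis t0 phi c x = synthesis t0 phi c' x} -> c = c'.
Proof.
move=> [A [B [A0 AB HAB]]] c2 c2' cc.
have B0 : 0 < B by exact: lt_le_trans AB.
have bessel d M : energy (fun j n => inner (psum elt d M) (elt j n)) M <= B * nn (psum elt d M).
  by apply: frame_upper_bound => f /HAB[].
have lim d : ell2 d -> is_L2lim (psum elt d) (synthesis t0 phi d).
  by move=> /(psum_lim elt_L2 B0 bessel)[g gl]; exact: (xgetPex _ (ex_intro _ g gl)).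
have [l1 l2] := (lim c c2, lim c' c2').
apply/funext => j; apply/funext => n.
have [f [f2 Hf]] := biorthogonal j n.
rewrite -(psum_coef elt_L2 l1 f2 Hf) -(psum_coef elt_L2 l2 f2 Hf).
by apply: ae_eq_innerl; [case: l1|case: l2| |].
Qed.

End RieszBasis.

Unset Implicit Arguments.
Set Strict Implicit.

Theorem theorem3p6 (R : realType) (w t0 h : R) (l : nat)
    (phi : 'I_(2 * l) -> R -> R[i])
    (w_gt0 : 0 < w) (t0_gt0 : 0 < t0) (hE : h = 2 * pi / t0)
    (l_ge1 : (1 <= l)%N)
    (h_bounds : w / l%:R <= h < w / (l%:R - 1 / 2))
    (phiB : forall j, bandlimited w (phi j)) :
  let mu := @lebesgue_measure R in
  let Iminus := `]0, - w + l%:R * h[%classic in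
  let I := `]- w + l%:R * h, w - (l%:R - 1) * h[%classic in
  let Iplus := `]w - (l%:R - 1) * h, h[%classic in
  let cond1 (delta gamma : R) :=
    {ae mu, forall x, `]- w, w[%classic x ->
      delta <= \sum_(j < 2 * l) cabs (fourier (phi j) x) ^+ 2 <= gamma} in
  let cond2 (sigma : R) :=
    {ae mu, forall x, (Iminus `|` Iplus) x ->
      sigma <= sum_sq_minors (2 * l - 1) (pre_gramian h phi x)} in
  let cond3 (eta : R) :=
    {ae mu, forall x, I x -> eta <= cabs (\det (pre_gramian h phi x))} in
  (is_frame w t0 phi <->
    exists delta gamma sigma eta : R,
      [/\ 0 < delta, 0 < gamma, 0 < sigma & 0 < eta] /\
      [/\ cond1 delta gamma, cond2 sigma & cond3 eta]) /\
  (h = w / l%:R ->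
    [/\ Iminus = set0, Iplus = set0 &
      is_riesz_basis w t0 phi <->
      exists delta gamma eta : R,
        [/\ 0 < delta, 0 < gamma & 0 < eta] /\
        (cond1 delta gamma /\ cond3 eta)]).
Proof.
move=> mu Iminus I Iplus cond1 cond2 cond3.
have l0 : 0 < l%:R :> R by rewrite ltr0n.
have l1 : 1 <= l%:R :> R by rewrite (ler_nat R 1 l).
have [wl wh] := andP h_bounds.
have wlh : w <= l%:R * h by move: wl; rewrite ler_pdivrMr// mulrC.
have l12 : 0 < l%:R - 1 / 2 :> R by lra.
(* The upper bound on h in the form that says that the endpoints of I are in increasing order. *)
have hw2 : (2 * l%:R - 1) * h < 2 * w.
  by move: wh; rewrite ltr_pdivlMr//; nra.
have N0 : (0 < 2 * l)%N by rewrite muln_gt0.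
have h0 : 0 < h by rewrite hE divr_gt0// mulr_gt0// pi_gt0.
have necessary : is_frame w t0 phi -> exists delta gamma sigma eta : R,
    [/\ 0 < delta, 0 < gamma, 0 < sigma & 0 < eta] /\
    [/\ cond1 delta gamma, cond2 sigma & cond3 eta].
  move=> [A [B [A0 AB HAB]]]; have B0 : 0 < B := lt_le_trans A0 AB.
  exists (A / h), (B / h), (A ^+ (2 * l).-1 / (2 * l)%:R), (A ^+ l).
  split; first by rewrite !divr_gt0 ?exprn_gt0 ?ltr0n.
  split.
  - exact: (necessary_cond1 w_gt0 t0_gt0 hE wlh phiB A0 AB HAB).
  - exact: (necessary_cond2 w_gt0 t0_gt0 hE l_ge1 wlh hw2 phiB A0 AB HAB).
  - exact: (necessary_cond3 w_gt0 t0_gt0 hE l_ge1 wlh phiB A0 AB HAB).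
have upper delta gamma : cond1 delta gamma -> {ae mu, forall x, (`]- w, w[%classic : set R) x ->
    \sum_(j < 2 * l) cabs (fourier (phi j) x) ^+ 2 <= gamma}.
  by apply: aeS => x H /H/andP[].
split; first split => //.
  move=> [delta [gamma [sigma [eta [[_ g0 s0 e0] [c1 c2 c3]]]]]].
  exact: (frame_of_conditions t0_gt0 hE l_ge1 wlh phiB g0 s0 e0 (upper _ _ c1) c2 c3).
move=> hwl; have hw : w = l%:R * h by rewrite hwl mulrC divfK// gt_eqF.
have Im0 : Iminus = set0 by rewrite /Iminus hw addNr set_itvoo0.
have Ip0 : Iplus = set0.
  by rewrite /Iplus hw (_ : _ - _ = h) ?set_itvoo0//; ring.
split => //; split.
  move=> [fr _]; have [delta [gamma [sigma [eta [[d0 g0 s0 e0] [c1 c2 c3]]]]]] := necessary fr.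
  by exists delta, gamma, eta.
move=> [delta [gamma [eta [[d0 g0 e0] [c1 c3]]]]].
(* Vacuous, as both outer intervals are empty; any positive sigma would serve. *)
have c2 : cond2 1 by apply: nearW => x; rewrite Im0 Ip0 => -[].
have fr : is_frame w t0 phi.
  exact: (frame_of_conditions t0_gt0 hE l_ge1 wlh phiB g0 ltr01 e0 (upper _ _ c1) c2 c3).
split => // c c'.
exact: (riesz_injective w_gt0 t0_gt0 hE hw phiB g0 e0 (upper _ _ c1) c3 fr).
Qed.
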